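(* Under the condition $|q^{N-1}|<|a_1a_2\cdots a_{2N}|$, $I_N$ can be written in terms of $\mathcal J_N(a_k)$, $1\le k\le N-1$, through $$I_N=\sum_{i=1}^{N-1}\Big(R_i+\sum_{k=N}^{2N}R_kA_{ki}\Big)\,\mathcal J_N(a_i),$$ where $$R_k=\frac{a_k^{N/2-1}\,\theta(a_k^{-N};q^{N/2})}{(q;q)_\infty^2\prod_{1\le j\le 2N,\ j\ne k}\theta(a_ja_k;q)\,\theta(a_j/a_k;q)}$$ and $$A_{ki}=\prod_{1\le j\le N-1,\ j\ne i}\frac{\theta(a_ja_k;q)\,\theta(a_j/a_k;q)}{\theta(a_ja_i;q)\,\theta(a_j/a_i;q)}.$$
   Context: Let $N\ge 2$ be an integer and $|q|<1$. Notation: $(a;q)_\infty=\prod_{k\ge0}(1-aq^k)$, $(az^{\pm1};q)_\infty=(az;q)_\infty(az^{-1};q)_\infty$, $(z^{\pm N};q^{N/2})_\infty=(z^{N};q^{N/2})_\infty(z^{-N};q^{N/2})_\infty$, $\theta(z;q)=(z;q)_\infty(qz^{-1};q)_\infty$. The parameters are $a_j=q^{s_j}$ with $|a_j|<1$, $1\le j\le 2N$. Put $$\Phi(z)=\frac{z-z^{-1}}{z^{N/2}-z^{-N/2}}\,\frac{(z^{\pm N};q^{N/2})_\infty}{\prod_{j=1}^{2N}(a_jz^{\pm1};q)_\infty},\qquad I_N=\int_C\frac{dz}{2\pi\sqrt{-1}\,z}\,\Phi(z).$$ For $N$ even, $C$ is the unit circle $\mathbb T$ traversed anticlockwise. For $N$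 odd, the integrand has a branch cut, conventionally taken to be $(-\infty,0)$, and $C=\mathbb T\cup\mathbb H$ is a contour of Hankel type with a tail $\mathbb H$, starting at $\infty e^{-\pi i}$ and finishing at $\infty e^{+\pi i}$; the tail contributes an integral over $[1,\infty)$, which (using an asymptotic expansion of the integrand valid for $|\arg(a_j)|\le\pi$) converges under the additional condition $\sum_{j=1}^{2N}\mathrm{Re}(s_j)<N-1$. The $BC_1$-type Jackson integral is $J_N(z)=\sum_{\nu=-\infty}^{\infty}Q(zq^\nu)$, $z\in\mathbb C^*$, where $$Q(z)=(z^{-1}-z)\prod_{j=1}^{2N}z^{1/2-s_j}\frac{(qa_j^{-1}z;q)_\infty}{(a_jz;q)_\infty};$$ it converges when $|q^{N-1}|<|a_1\cdots a_{2N}|$. Its regularisation, holomorphic on $\mathbb C^*$, is $$\mathcal J_N(z)=\frac{J_N(z)}{h(z)},\qquad h(z)=z^{N-1-s_1-\cdots-s_{2N}}\frac{\theta(z^2;q)}{\prod_{j=1}^{2N}\theta(a_jz;q)}.$$ At $z=a_i$ the sum truncates to $J_N(a_i)=\sum_{\nu=0}^\infty Q(a_iq^\nu)$.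
   Formalization: For N odd the formal theorem takes 0<q<1 and |arg a_j|<π (otherwise poles meet or cross the branch cut and the identity fails or I_N is undefined); it also assumes θ(a_i²;q)≠0 for i≤N-1, so that J_N/h is literally defined at a_i; the excluded values follow by continuity. *)

(* Defs.v *)
From Stdlib Require Export Reals List.
From Coquelicot Require Export Coquelicot.

Open Scope C_scope.

Definition Cexp (w : C) : C :=
  (exp (Re w) * cos (Im w), exp (Re w) * sin (Im w))%R.

(* Total operators: the values are meaningful when the limit (series) exists. *)
Definition Clim_seq (u : nat -> C) : C :=
  (real (Lim_seq (fun n => Re (u n))), real (Lim_seq (fun n => Im (u n)))).

Definition Cseries (u : nat -> C) : C :=
  (Series (fun n => Re (u n)), Series (fun n => Im (u n))).

(* Sum over all integers n: n = 0, 1, 2, ... and n = -1, -2, ... *)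
Definition Cbiseries (u : Z -> C) : C :=
  Cseries (fun n => u (Z.of_nat n)) + Cseries (fun n => u (- Z.of_nat (S n))%Z).

Definition Cprod (l : list nat) (f : nat -> C) : C :=
  fold_right (fun j r => f j * r) 1 l.

Definition except (k : nat) (l : list nat) : list nat :=
  filter (fun j => negb (Nat.eqb j k)) l.

(* (x; p)_oo *)
Definition qpoch (x p : C) : C :=
  Clim_seq (fun n => Cprod (seq 0 n) (fun k => 1 - x * p ^ k)).

Definition theta (x p : C) : C := qpoch x p * qpoch (p / x) p.

(* Throughout, logq is the logarithm of q which fixes the powers
   q^c = exp (c log q). The functions Phi, Q_N, J_N, h_N, calJ_N take the logarithm w
   of their argument z = exp w, and z^c is exp (c w). This makes z^(N/2) and
   z^(1/2 - s_j) unambiguous; in particular (z q^n)^c = z^c q^(n c), and the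
   point z = a_k = q^(s_k) is w = s_k log q. *)
Definition qpow (logq c : C) : C := Cexp (c * logq).

Definition Phi (N : nat) (logq : C) (s : nat -> C) (w : C) : C :=
  let z := Cexp w in
  let q := Cexp logq in
  let p := qpow logq (INR N / 2) in
  (z - / z) / (Cexp (INR N / 2 * w) - Cexp (- (INR N / 2) * w))
  * (qpoch (z ^ N) p * qpoch (/ z ^ N) p)
  / Cprod (seq 1 (2 * N))
      (fun j => qpoch (qpow logq (s j) * z) q * qpoch (qpow logq (s j) / z) q).

(* dz / (2 pi i z) = dw / (2 pi i), pulled back along a path w(t) with
   derivative dw. *)
Definition Phi_form (N : nat) (logq : C) (s : nat -> C) (w dw : C) : C :=
  Phi N logq s w * dw / (2 * PI * Ci).

(* The unit circle is w = i t, -pi <= t <= pi. The two sides of the tail are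
   z = e^u e^(-i pi), with u from +oo to 0, and z = e^u e^(i pi), with u from 0
   to +oo: the logarithms w = u - i pi, u + i pi are the boundary values of the
   principal branch on the two sides of the cut. *)
Definition circle_form (N : nat) (logq : C) (s : nat -> C) (t : R) : C :=
  Phi_form N logq s (t * Ci) Ci.

Definition lower_tail_form (N : nat) (logq : C) (s : nat -> C) (u : R) : C :=
  Phi_form N logq s (u - PI * Ci) 1.

Definition upper_tail_form (N : nat) (logq : C) (s : nat -> C) (u : R) : C :=
  Phi_form N logq s (u + PI * Ci) 1.

Definition ex_I_N (N : nat) (logq : C) (s : nat -> C) : Prop :=
  ex_RInt (V := C_R_CompleteNormedModule) (circle_form N logq s) (- PI)%R PI /\
  (Nat.odd N = true ->
     ex_RInt_gen (V := C_R_CompleteNormedModule)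
       (lower_tail_form N logq s) (Rbar_locally p_infty) (at_point 0%R) /\
     ex_RInt_gen (V := C_R_CompleteNormedModule)
       (upper_tail_form N logq s) (at_point 0%R) (Rbar_locally p_infty)).

Definition I_N (N : nat) (logq : C) (s : nat -> C) : C :=
  let circle : C :=
    RInt (V := C_R_CompleteNormedModule) (circle_form N logq s) (- PI)%R PI in
  let lower_tail : C :=
    RInt_gen (V := C_R_CompleteNormedModule)
      (lower_tail_form N logq s) (Rbar_locally p_infty) (at_point 0%R) in
  let upper_tail : C :=
    RInt_gen (V := C_R_CompleteNormedModule)
      (upper_tail_form N logq s) (at_point 0%R) (Rbar_locally p_infty) in
  if Nat.odd N then lower_tail + circle + upper_tail else circle.

Definition Q_N (N : nat) (logq : C) (s : nat -> C) (w : C) : C :=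
  let z := Cexp w in
  let q := Cexp logq in
  (/ z - z)
  * Cprod (seq 1 (2 * N))
      (fun j => Cexp ((1 / 2 - s j) * w)
                * (qpoch (q / qpow logq (s j) * z) q / qpoch (qpow logq (s j) * z) q)).

Definition J_N (N : nat) (logq : C) (s : nat -> C) (w : C) : C :=
  Cbiseries (fun n => Q_N N logq s (w + IZR n * logq)).

Definition h_N (N : nat) (logq : C) (s : nat -> C) (w : C) : C :=
  let z := Cexp w in
  let q := Cexp logq in
  Cexp ((INR N - 1 - sum_n_m s 1 (2 * N)) * w)
  * (theta (z ^ 2) q
     / Cprod (seq 1 (2 * N)) (fun j => theta (qpow logq (s j) * z) q)).

Definition calJ_N (N : nat) (logq : C) (s : nat -> C) (w : C) : C :=
  J_N N logq s w / h_N N logq s w.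

Definition R_coef (N : nat) (logq : C) (s : nat -> C) (k : nat) : C :=
  let q := Cexp logq in
  let p := qpow logq (INR N / 2) in
  let a := fun j => qpow logq (s j) in
  Cexp ((INR N / 2 - 1) * (s k * logq)) * theta (/ (a k) ^ N) p
  / (qpoch q q ^ 2
     * Cprod (except k (seq 1 (2 * N)))
         (fun j => theta (a j * a k) q * theta (a j / a k) q)).

Definition A_coef (N : nat) (logq : C) (s : nat -> C) (k i : nat) : C :=
  let q := Cexp logq in
  let a := fun j => qpow logq (s j) in
  Cprod (except i (seq 1 (N - 1)))
    (fun j => (theta (a j * a k) q * theta (a j / a k) q)
              / (theta (a j * a i) q * theta (a j / a i) q)).

(* Main.v *)
(** Write [z = exp w] and [F = exp (sg w) (z - 1/z) g(z) / prod_j (a_j z; q) (a_j / z; q)], where [sg = 0]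
    or [1/2]; the integrand [Phi] has this form, because [(z^N; p) (z^-N; p) / (z^(N/2) - z^(-N/2))] is
    [z^(-N/2) theta (z^N; p)] for [p = q^(N/2)]. Closing the Hankel contour by circles [|z| = R |q|^(-n)],
    on which [F] decays like [|q^(N-1) / (a_1 ... a_2N)|^n], writes [I_N] as the sum of the residues at
    [z = 1 / (a_k q^n)]. For fixed [k] these are proportional to the terms of the Jackson series at [a_k].
    Residues on a finite annulus need no Cauchy theory: the regular part of the integrand is a uniform limit
    of Laurent polynomials, and partial fractions reduce everything to the kernel [1 / (1 - b z)], which is
    integrated by a geometric series ([sg = 0]) or by an explicit primitive ([sg = 1/2]).

    To eliminate the Jackson integral at [a_k], [k >= N], take for [g] the product of the
    [theta (a_j z) theta (a_j / z)] over the [N] indices [j >= N], [j <> k]. Then [F] is odd under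
    [z -> 1/z], its integral vanishes, and the residue sum is a linear relation between the Jackson
    integrals at [a_1, ..., a_(N-1)] and [a_k]. *)

Require Import Defs.
From Stdlib Require FinFun.
From Stdlib Require Import ZArith Lra Lia Psatz ClassicalEpsilon ssreflect.

(** * Complex limits, finite sums and products *)

(** One transformation law drives everything: both choices of [exp (sg w) g] are multiplied by
    [z^(2N) / q^N] under [z -> z/q], the theta of step [p] because [p * p = q^N], the product of
    theta pairs because each of its [N] pairs contributes [z^2 / q]. The [2N] thetas [theta (a_j z)]
    in the denominator gain [z^(2N) prod a_j / q^(2N)], so one step outwards multiplies the
    integrand, up to a bounded factor, by [q^(N-1) / prod a_j]. This single constant governs the
    decay on the circles, the convergence of the tails and the ratio of the Jackson series, and the
    same law propagates the residue formula from one pole to the next. It also dictates the size of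
    [g]: of the [N+1] indices [j >= N] exactly [N] may enter, and since [theta 1 = 0] only the index
    left out survives among them. For odd [N] the half-integer power is two-valued, so each pole is
    recorded by a chosen logarithm; [log q] is real there, hence a step by [q] preserves the edges
    of the cut and keeps every pole off it. *)

Lemma exp_le (x y : R) : (x <= y)%R -> (exp x <= exp y)%R.
Proof. move=> [h|->]; [by apply Rlt_le, exp_increasing | lra]. Qed.

Lemma Cexp_plus (u v : C) : Cexp (u + v) = Cexp u * Cexp v.
Proof.
  rewrite /Cexp re_plus im_plus exp_plus cos_plus sin_plus /Cmult /=.
  f_equal; ring.
Qed.

Lemma Cexp_0 : Cexp 0 = 1.
Proof. by rewrite /Cexp /= exp_0 cos_0 sin_0; apply: injective_projections => /=; ring. Qed.

Lemma Cmod_Cexp (w : C) : Cmod (Cexp w) = exp (Re w).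
Proof.
  rewrite /Cexp /Cmod /=.
  rewrite !Rmult_1_r.
  have -> : (exp (Re w) * cos (Im w) * (exp (Re w) * cos (Im w)) +
    exp (Re w) * sin (Im w) * (exp (Re w) * sin (Im w)) =
    (exp (Re w))² * ((sin (Im w))² + (cos (Im w))²))%R by rewrite /Rsqr; ring.
  rewrite sin2_cos2 Rmult_1_r sqrt_Rsqr //.
  apply Rlt_le, exp_pos.
Qed.

Lemma Cexp_neq0 (w : C) : Cexp w <> 0.
Proof. apply Cmod_gt_0; rewrite Cmod_Cexp; apply exp_pos. Qed.

Lemma Cexp_opp (w : C) : Cexp (- w) = / Cexp w.
Proof.
  have H : Cexp w * Cexp (- w) = 1.
  { rewrite -Cexp_plus. have -> : w + - w = 0 by ring. exact Cexp_0. }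
  have Hw := Cexp_neq0 w.
  have -> : Cexp (- w) = (Cexp w * Cexp (- w)) / Cexp w by field.
  rewrite H; field; done.
Qed.

Lemma Cexp_minus (u v : C) : Cexp (u - v) = Cexp u / Cexp v.
Proof. by rewrite /Cminus Cexp_plus Cexp_opp. Qed.

Lemma Cexp_INR_mult (n : nat) (w : C) : Cexp (INR n * w) = Cexp w ^ n.
Proof.
  elim: n => [|n IH].
  - by rewrite /= Cmult_0_l Cexp_0.
  - rewrite S_INR RtoC_plus Cmult_plus_distr_r Cmult_1_l Cexp_plus IH /=; ring.
Qed.

Lemma Cinv_0 : / (0 : C) = 0.
Proof. by apply: injective_projections; rewrite /= /Rdiv ?Ropp_0 Rmult_0_l. Qed.

Lemma Cdiv_0_r (x : C) : x / 0 = 0.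
Proof. by rewrite /Cdiv Cinv_0 Cmult_0_r. Qed.

Lemma Cinv_neq0 (x : C) : x <> 0 -> / x <> 0.
Proof. move=> hx E. apply C1_nz. rewrite -(Cinv_r x hx) E; ring. Qed.

(** The convention [/ 0 = 0] makes inversion multiplicative without side conditions, so products of
    quotients can be rearranged at points where a denominator may vanish. *)
Lemma Cinv_mult (x y : C) : / (x * y) = / x * / y.
Proof.
  case: (Ceq_dec x 0) => [->|hx]; first by rewrite Cmult_0_l Cinv_0 Cmult_0_l.
  case: (Ceq_dec y 0) => [->|hy]; first by rewrite Cmult_0_r Cinv_0 Cmult_0_r.
  by field.
Qed.

Lemma Cmod_minus_sym (x y : C) : Cmod (x - y) = Cmod (y - x).
Proof. by rewrite -Cmod_opp; f_equal; ring. Qed.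

Lemma Cmod_triangle_minus (x y z : C) : (Cmod (x - z) <= Cmod (x - y) + Cmod (y - z))%R.
Proof. have -> : x - z = (x - y) + (y - z) by ring. apply Cmod_triangle. Qed.

Lemma Cmod_ge_minus (x y : C) : (Cmod x - Cmod y <= Cmod (x - y))%R.
Proof.
  have := Cmod_triangle (x - y) y.
  have -> : x - y + y = x by ring.
  lra.
Qed.

Lemma im_le_Cmod (c : C) : (Rabs (Im c) <= Cmod c)%R.
Proof. eapply Rle_trans; last apply Rmax_Cmod. apply Rmax_r. Qed.

Lemma Cmod_le_abs (c : C) : (Cmod c <= Rabs (Re c) + Rabs (Im c))%R.
Proof.
  have E : c = RtoC (Re c) + Ci * RtoC (Im c)
    by apply: injective_projections; rewrite /Re /Im /=; ring.
  rewrite {1}E. eapply Rle_trans; first apply Cmod_triangle.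
  rewrite Cmod_mult Cmod_Ci !Cmod_R Rmult_1_l. apply Rle_refl.
Qed.

(** An epsilon form with the complex modulus; [Clim_Clim_seq] transfers it to the total operator of
    the definitions, whose value means something only once convergence is proved. *)
Definition Clim (u : nat -> C) (l : C) : Prop :=
  forall eps : R, (0 < eps)%R -> exists n0 : nat, forall n : nat, (n0 <= n)%nat ->
    (Cmod (u n - l) < eps)%R.

Lemma is_lim_seq_eps (u : nat -> R) (l : R) :
  (forall eps : R, (0 < eps)%R -> exists n0 : nat, forall n : nat, (n0 <= n)%nat ->
    (Rabs (u n - l) < eps)%R) -> is_lim_seq u l.
Proof.
  move=> H; apply is_lim_seq_spec => eps.
  have [n0 Hn] := H eps (cond_pos eps); by exists n0.
Qed.

Lemma Clim_Re (u : nat -> C) (l : C) : Clim u l -> is_lim_seq (fun n => Re (u n)) (Re l).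
Proof.
  move=> H; apply is_lim_seq_eps => eps Heps.
  have [n0 Hn] := H eps Heps; exists n0 => n hn.
  eapply Rle_lt_trans; last exact (Hn n hn).
  have -> : (Re (u n) - Re l)%R = Re (u n - l) by rewrite /Re /Im /=; ring.
  apply re_le_Cmod.
Qed.

Lemma Clim_Im (u : nat -> C) (l : C) : Clim u l -> is_lim_seq (fun n => Im (u n)) (Im l).
Proof.
  move=> H; apply is_lim_seq_eps => eps Heps.
  have [n0 Hn] := H eps Heps; exists n0 => n hn.
  eapply Rle_lt_trans; last exact (Hn n hn).
  have -> : (Im (u n) - Im l)%R = Im (u n - l) by rewrite /Re /Im /=; ring.
  apply im_le_Cmod.
Qed.

Lemma Clim_Clim_seq (u : nat -> C) (l : C) : Clim u l -> Clim_seq u = l.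
Proof.
  move=> H; rewrite /Clim_seq.
  rewrite (is_lim_seq_unique _ _ (Clim_Re _ _ H)) (is_lim_seq_unique _ _ (Clim_Im _ _ H)).
  by rewrite /= -surjective_pairing.
Qed.

Lemma Clim_of_Re_Im (u : nat -> C) (l : C) :
  is_lim_seq (fun n => Re (u n)) (Re l) -> is_lim_seq (fun n => Im (u n)) (Im l) ->
  Clim u l.
Proof.
  move=> /is_lim_seq_spec H1 /is_lim_seq_spec H2 eps Heps.
  have he : (0 < eps / 2)%R by lra.
  have [n1 Hn1] := H1 (mkposreal _ he).
  have [n2 Hn2] := H2 (mkposreal _ he).
  exists (n1 + n2)%nat => n hn.
  have A1 := Hn1 n ltac:(lia). have A2 := Hn2 n ltac:(lia).
  rewrite /= in A1 A2.
  eapply Rle_lt_trans; first apply Cmod_le_abs.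
  rewrite /=.
  have -> : (fst (u n) + - fst l = fst (u n) - fst l)%R by ring.
  have -> : (snd (u n) + - snd l = snd (u n) - snd l)%R by ring.
  rewrite /Re /Im in A1 A2.
  lra.
Qed.

Lemma Clim_unique (u : nat -> C) (l m : C) : Clim u l -> Clim u m -> l = m.
Proof. by move=> /Clim_Clim_seq <- /Clim_Clim_seq <-. Qed.

Lemma Clim_ext_ev (u v : nat -> C) (l : C) (n0 : nat) :
  (forall n, (n0 <= n)%nat -> u n = v n) -> Clim u l -> Clim v l.
Proof.
  move=> E H eps he. have [n1 Hn] := H eps he.
  exists (n0 + n1)%nat => n hn. rewrite -E; last lia. apply Hn; lia.
Qed.

Lemma Clim_ext (u v : nat -> C) (l : C) : (forall n, u n = v n) -> Clim u l -> Clim v l.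
Proof. move=> E; apply (Clim_ext_ev _ _ _ 0) => n _; apply E. Qed.

Lemma Clim_const (c : C) : Clim (fun _ => c) c.
Proof.
  move=> eps he; exists 0%nat => n _.
  have -> : c - c = 0 by ring. by rewrite Cmod_0.
Qed.

Lemma Clim_subseq (u : nat -> C) (l : C) (phi : nat -> nat) :
  Clim u l -> (forall M, exists n0, forall n, (n0 <= n)%nat -> (M <= phi n)%nat) ->
  Clim (fun n => u (phi n)) l.
Proof.
  move=> H Hphi eps he. have [n1 Hn] := H eps he. have [n0 Hn0] := Hphi n1.
  exists n0 => n hn. apply Hn, Hn0, hn.
Qed.

Lemma Clim_incr (u : nat -> C) (l : C) : Clim (fun n => u (S n)) l <-> Clim u l.
Proof.
  split=> H eps he; have [n0 Hn] := H eps he.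
  - exists (S n0) => [[|n] hn]; first lia. apply Hn; lia.
  - exists n0 => n hn. apply Hn; lia.
Qed.

Lemma Clim_plus (u v : nat -> C) (l m : C) :
  Clim u l -> Clim v m -> Clim (fun n => u n + v n) (l + m).
Proof.
  move=> Hu Hv eps he.
  have [n1 Hn1] := Hu (eps / 2)%R ltac:(lra).
  have [n2 Hn2] := Hv (eps / 2)%R ltac:(lra).
  exists (n1 + n2)%nat => n hn.
  have A1 := Hn1 n ltac:(lia). have A2 := Hn2 n ltac:(lia).
  have -> : u n + v n - (l + m) = (u n - l) + (v n - m) by ring.
  eapply Rle_lt_trans; first apply Cmod_triangle. lra.
Qed.

Lemma Clim_scal (c : C) (u : nat -> C) (l : C) :
  Clim u l -> Clim (fun n => c * u n) (c * l).
Proof.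
  move=> Hu eps he. have hc := Cmod_ge_0 c.
  have [n1 Hn1] := Hu (eps / (Cmod c + 1))%R ltac:(apply Rdiv_lt_0_compat; lra).
  exists n1 => n hn. have A := Hn1 n hn.
  have -> : c * u n - c * l = c * (u n - l) by ring.
  rewrite Cmod_mult.
  have B : ((Cmod c + 1) * Cmod (u n - l) < eps)%R.
  { apply Rmult_lt_reg_r with (/ (Cmod c + 1))%R; first by apply Rinv_0_lt_compat; lra.
    replace ((Cmod c + 1) * Cmod (u n - l) * / (Cmod c + 1))%R with (Cmod (u n - l)) by (field; lra).
    exact A. }
  have := Cmod_ge_0 (u n - l). nra.
Qed.

Lemma Clim_opp (u : nat -> C) (l : C) : Clim u l -> Clim (fun n => - u n) (- l).
Proof.
  move=> H eps he. have [n0 Hn] := H eps he. exists n0 => n hn.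
  have -> : - u n - - l = - (u n - l) by ring. rewrite Cmod_opp; by apply Hn.
Qed.

Lemma Clim_minus (u v : nat -> C) (l m : C) :
  Clim u l -> Clim v m -> Clim (fun n => u n - v n) (l - m).
Proof. move=> Hu Hv. apply Clim_plus => //. by apply Clim_opp. Qed.

Lemma Clim_Cmod_le (u : nat -> C) (l : C) (M : R) (n0 : nat) :
  (forall n, (n0 <= n)%nat -> (Cmod (u n) <= M)%R) -> Clim u l -> (Cmod l <= M)%R.
Proof.
  move=> H Hl. apply Rle_plus_epsilon => eps he.
  have [n1 Hn] := Hl eps he.
  have A := Hn (n0 + n1)%nat ltac:(lia). have B := H (n0 + n1)%nat ltac:(lia).
  have := Cmod_ge_minus l (u (n0 + n1)%nat). rewrite Cmod_minus_sym. lra.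
Qed.

Lemma Clim_Cmod_ge (u : nat -> C) (l : C) (M : R) (n0 : nat) :
  (forall n, (n0 <= n)%nat -> (M <= Cmod (u n))%R) -> Clim u l -> (M <= Cmod l)%R.
Proof.
  move=> H Hl. apply Rle_plus_epsilon => eps he.
  have [n1 Hn] := Hl eps he.
  have A := Hn (n0 + n1)%nat ltac:(lia). have B := H (n0 + n1)%nat ltac:(lia).
  have := Cmod_ge_minus (u (n0 + n1)%nat) l. lra.
Qed.

Definition Csum {T : Type} (l : list T) (f : T -> C) : C :=
  fold_right (fun j r => f j + r) 0 l.

(** Convertible to [Cprod] on [nat]; a general index type is wanted because poles are indexed by
    pairs [(k, n)]. *)
Definition Gprod {T : Type} (l : list T) (f : T -> C) : C :=
  fold_right (fun j r => f j * r) 1 l.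

Lemma Gprod_nat (l : list nat) (f : nat -> C) : Gprod l f = Cprod l f.
Proof. done. Qed.

Lemma Csum_ext {T} (l : list T) (f g : T -> C) :
  (forall x, In x l -> f x = g x) -> Csum l f = Csum l g.
Proof.
  elim: l => [|x l IH] H //=. rewrite H; last by left. rewrite IH // => y hy.
  apply H; by right.
Qed.

Lemma Gprod_ext {T} (l : list T) (f g : T -> C) :
  (forall x, In x l -> f x = g x) -> Gprod l f = Gprod l g.
Proof.
  elim: l => [|x l IH] H //=. rewrite H; last by left. rewrite IH // => y hy.
  apply H; by right.
Qed.

Lemma Csum_plus {T} (l : list T) (f g : T -> C) :
  Csum l (fun x => f x + g x) = Csum l f + Csum l g.
Proof. elim: l => [|x l IH] /=; first ring. rewrite IH; ring. Qed.

Lemma Csum_scal {T} (l : list T) (c : C) (f : T -> C) :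
  Csum l (fun x => c * f x) = c * Csum l f.
Proof. elim: l => [|x l IH] /=; first ring. rewrite IH; ring. Qed.

Lemma Csum_0 {T} (l : list T) : Csum l (fun _ => 0) = 0.
Proof. elim: l => [|x l IH] //=. rewrite IH; ring. Qed.

Lemma Csum_app {T} (l m : list T) (f : T -> C) : Csum (l ++ m) f = Csum l f + Csum m f.
Proof. elim: l => [|x l IH] /=; first ring. rewrite IH; ring. Qed.

Lemma Gprod_app {T} (l m : list T) (f : T -> C) : Gprod (l ++ m) f = Gprod l f * Gprod m f.
Proof. elim: l => [|x l IH] /=; first ring. rewrite IH; ring. Qed.

Lemma Csum_map {S T} (h : S -> T) (l : list S) (f : T -> C) :
  Csum (map h l) f = Csum l (fun x => f (h x)).
Proof. elim: l => [|x l IH] //=. by rewrite IH. Qed.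

Lemma Gprod_map {S T} (h : S -> T) (l : list S) (f : T -> C) :
  Gprod (map h l) f = Gprod l (fun x => f (h x)).
Proof. elim: l => [|x l IH] //=. by rewrite IH. Qed.

Lemma Csum_flat_map {S T} (h : S -> list T) (l : list S) (f : T -> C) :
  Csum (flat_map h l) f = Csum l (fun x => Csum (h x) f).
Proof. elim: l => [|x l IH] //=. by rewrite Csum_app IH. Qed.

Lemma Gprod_flat_map {S T} (h : S -> list T) (l : list S) (f : T -> C) :
  Gprod (flat_map h l) f = Gprod l (fun x => Gprod (h x) f).
Proof. elim: l => [|x l IH] //=. by rewrite Gprod_app IH. Qed.

Lemma Csum_swap {S T} (l : list S) (m : list T) (f : S -> T -> C) :
  Csum l (fun x => Csum m (f x)) = Csum m (fun y => Csum l (fun x => f x y)).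
Proof.
  elim: l => [|x l IH] /=; first by rewrite Csum_0.
  by rewrite IH Csum_plus.
Qed.

Lemma Gprod_mult {T} (l : list T) (f g : T -> C) :
  Gprod l (fun x => f x * g x) = Gprod l f * Gprod l g.
Proof. elim: l => [|x l IH] /=; first ring. rewrite IH; ring. Qed.

Lemma Gprod_inv {T} (l : list T) (f : T -> C) :
  Gprod l (fun x => / f x) = / Gprod l f.
Proof. elim: l => [|x l IH] /=; first field. by rewrite IH Cinv_mult. Qed.

Lemma Gprod_div {T} (l : list T) (f g : T -> C) :
  Gprod l (fun x => f x / g x) = Gprod l f / Gprod l g.
Proof. by rewrite /Cdiv Gprod_mult Gprod_inv. Qed.

Lemma Gprod_neq0 {T} (l : list T) (f : T -> C) :
  (forall x, In x l -> f x <> 0) -> Gprod l f <> 0.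
Proof.
  elim: l => [|x l IH] H /=; first exact C1_nz.
  apply Cmult_neq_0; first by apply H; left.
  apply IH => y hy; apply H; by right.
Qed.

Lemma Gprod_eq0 {T} (l : list T) (f : T -> C) (x : T) : In x l -> f x = 0 -> Gprod l f = 0.
Proof.
  elim: l => [|y l IH] //= [-> ->|h1 h2]; first ring. rewrite IH //; ring.
Qed.

Lemma Gprod_const {T} (l : list T) (c : C) : Gprod l (fun _ => c) = c ^ length l.
Proof. elim: l => [|x l IH] //=. by rewrite IH. Qed.

Lemma Clim_Csum {T} (l : list T) (u : nat -> T -> C) (v : T -> C) :
  (forall x, In x l -> Clim (fun n => u n x) (v x)) ->
  Clim (fun n => Csum l (u n)) (Csum l v).
Proof.
  elim: l => [|x l IH] H /=; first apply Clim_const.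
  apply Clim_plus; first by apply H; left. apply IH => y hy; apply H; by right.
Qed.

Lemma Csum_seq_S (n : nat) (f : nat -> C) : Csum (seq 0 (S n)) f = Csum (seq 0 n) f + f n.
Proof. rewrite seq_S Csum_app /=; ring. Qed.

Lemma Gprod_seq_S (n : nat) (f : nat -> C) : Gprod (seq 0 (S n)) f = Gprod (seq 0 n) f * f n.
Proof. rewrite seq_S Gprod_app /=; ring. Qed.

Lemma Gprod_seq_S_l (n : nat) (f : nat -> C) :
  Gprod (seq 0 (S n)) f = f 0%nat * Gprod (seq 0 n) (fun k => f (S k)).
Proof. by rewrite -cons_seq -seq_shift /= Gprod_map. Qed.

Lemma Cseries_eq (u : nat -> C) (l : C) :
  Clim (fun n => Csum (seq 0 n) u) l -> Cseries u = l.
Proof.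
  move=> H. rewrite /Cseries.
  have H' : Clim (fun n => Csum (seq 0 (S n)) u) l
    by exact (proj2 (Clim_incr (fun n => Csum (seq 0 n) u) l) H).
  have A : forall n, Re (Csum (seq 0 (S n)) u) = sum_n (fun k => Re (u k)) n.
  { elim=> [|n IH]; first by rewrite sum_O /Csum /Re /Im /=; ring.
    rewrite Csum_seq_S re_plus IH sum_Sn //. }
  have B : forall n, Im (Csum (seq 0 (S n)) u) = sum_n (fun k => Im (u k)) n.
  { elim=> [|n IH]; first by rewrite sum_O /Csum /Re /Im /=; ring.
    rewrite Csum_seq_S im_plus IH sum_Sn //. }
  have E1 : Series (fun k => Re (u k)) = Re l.
  { apply is_series_unique. exact: (is_lim_seq_ext _ _ _ A (Clim_Re _ _ H')). }
  have E2 : Series (fun k => Im (u k)) = Im l.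
  { apply is_series_unique. exact: (is_lim_seq_ext _ _ _ B (Clim_Im _ _ H')). }
  by rewrite E1 E2 /Re /Im -surjective_pairing.
Qed.

Lemma Cseries_geom_ex (u : nat -> C) (M r : R) :
  (0 <= r < 1)%R -> (forall n, (Cmod (u n) <= M * r ^ n)%R) ->
  exists l, Clim (fun n => Csum (seq 0 n) u) l.
Proof.
  move=> hr Hu.
  have Hg : ex_series (fun n => (M * r ^ n)%R).
  { apply: ex_series_scal_l. apply ex_series_geom. rewrite Rabs_pos_eq; lra. }
  have [l1 H1] : ex_series (fun k => Re (u k)).
  { apply: (ex_series_le (V := R_CompleteNormedModule)) Hg => n.
    eapply Rle_trans; last apply Hu. apply re_le_Cmod. }
  have [l2 H2] : ex_series (fun k => Im (u k)).
  { apply: (ex_series_le (V := R_CompleteNormedModule)) Hg => n.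
    eapply Rle_trans; last apply Hu. apply im_le_Cmod. }
  exists (l1, l2). apply (proj1 (Clim_incr (fun n => Csum (seq 0 n) u) (l1, l2))).
  have A : forall n, sum_n (fun k => Re (u k)) n = Re (Csum (seq 0 (S n)) u).
  { elim=> [|n IH]; first by rewrite sum_O /Csum /Re /Im /=; ring.
    rewrite Csum_seq_S re_plus -IH sum_Sn //. }
  have B : forall n, sum_n (fun k => Im (u k)) n = Im (Csum (seq 0 (S n)) u).
  { elim=> [|n IH]; first by rewrite sum_O /Csum /Re /Im /=; ring.
    rewrite Csum_seq_S im_plus -IH sum_Sn //. }
  apply Clim_of_Re_Im.
  - apply (is_lim_seq_ext _ _ _ A). exact H1.
  - apply (is_lim_seq_ext _ _ _ B). exact H2.
Qed.

(** * q-Pochhammer symbols and theta functions *)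

Definition qpochn (n : nat) (x p : C) : C := Gprod (seq 0 n) (fun k => 1 - x * p ^ k).

Lemma qpochn_S (n : nat) (x p : C) : qpochn (S n) x p = qpochn n x p * (1 - x * p ^ n).
Proof. apply Gprod_seq_S. Qed.

Lemma qpochn_add (n m : nat) (x p : C) :
  qpochn (n + m) x p = qpochn n x p * qpochn m (x * p ^ n) p.
Proof.
  elim: m => [|m IH]; first by rewrite Nat.add_0_r /qpochn /=; ring.
  rewrite Nat.add_succ_r !qpochn_S IH Cpow_add_r; ring.
Qed.

Lemma exp_ge_1_plus (y : R) : (0 <= y -> 1 + y <= exp y)%R.
Proof. move=> [hy|<-]; first by apply Rlt_le, exp_ineq1; lra. rewrite exp_0; lra. Qed.

Lemma Cmod_1_minus_le (y : C) : (Cmod (1 - y) <= 1 + Cmod y)%R.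
Proof.
  eapply Rle_trans; first apply Cmod_triangle.
  rewrite Cmod_opp Cmod_1; lra.
Qed.

Lemma Cmod_1_minus_ge (y : C) : (1 - Cmod y <= Cmod (1 - y))%R.
Proof. have := Cmod_ge_minus 1 y. rewrite Cmod_1; lra. Qed.

Lemma geom_small (M r eps : R) : (0 <= r < 1)%R -> (0 < eps)%R ->
  exists n0 : nat, forall n, (n0 <= n)%nat -> (M * r ^ n <= eps)%R.
Proof.
  move=> hr he.
  have hM : (0 < eps / (Rabs M + 1))%R.
  { apply Rdiv_lt_0_compat; first lra. have := Rabs_pos M; lra. }
  have [K HK] := pow_lt_1_zero r ltac:(rewrite Rabs_pos_eq; lra) _ hM.
  exists K => n hn. have := HK n hn.
  rewrite Rabs_pos_eq; last by apply pow_le; lra.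
  have h1 := pow_le r n (proj1 hr). have h2 := Rle_abs M. have h3 := Rabs_pos M.
  move=> h4.
  have h5 : (r ^ n * (Rabs M + 1) < eps)%R.
  { apply Rmult_lt_reg_r with (/ (Rabs M + 1))%R; first by apply Rinv_0_lt_compat; lra.
    replace (r ^ n * (Rabs M + 1) * / (Rabs M + 1))%R with (r ^ n)%R by (field; lra).
    exact h4. }
  nra.
Qed.

Section QPoch.
Variable p : C.
Hypothesis hp : (Cmod p < 1)%R.

Let r := Cmod p.

Lemma Cmod_pow_le_1 (n : nat) : (0 <= Cmod p ^ n <= 1)%R.
Proof.
  split; first by apply pow_le, Cmod_ge_0.
  rewrite -(pow1 n). apply pow_incr. split; [apply Cmod_ge_0 | lra].
Qed.

Lemma qpochn_le (n : nat) (x : C) : (Cmod (qpochn n x p) <= exp (Cmod x / (1 - r)))%R.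
Proof.
  have hr : (0 <= r < 1)%R by (split; [apply Cmod_ge_0 | exact hp]).
  have hx := Cmod_ge_0 x.
  have A : (Cmod (qpochn n x p) <= exp (Cmod x * ((1 - r ^ n) / (1 - r))))%R.
  { elim: n => [|n IH].
    - rewrite /qpochn /= Cmod_1 Rminus_diag Rdiv_0_l Rmult_0_r exp_0; lra.
    - rewrite qpochn_S Cmod_mult.
      have -> : (Cmod x * ((1 - r ^ S n) / (1 - r)) =
        Cmod x * ((1 - r ^ n) / (1 - r)) + Cmod x * r ^ n)%R by rewrite /=; field; lra.
      rewrite exp_plus. apply Rmult_le_compat; try apply Cmod_ge_0; first exact IH.
      eapply Rle_trans; first apply Cmod_1_minus_le.
      rewrite Cmod_mult Cmod_pow. apply exp_ge_1_plus.
      apply Rmult_le_pos; [exact hx | apply Cmod_pow_le_1]. }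
  eapply Rle_trans; first exact A.
  have B := Cmod_pow_le_1 n. fold r in B.
  have B2 : (Cmod x * ((1 - r ^ n) / (1 - r)) <= Cmod x / (1 - r))%R.
  { rewrite /Rdiv -Rmult_assoc. apply Rmult_le_compat_r; first by apply Rlt_le, Rinv_0_lt_compat; lra.
    nra. }
  by apply exp_le.
Qed.

(** Passing from [n] to [n+1] changes the product by [x p^n] times a uniformly bounded quantity. The
    induction carries the sharper [r^n - r^(n+m)], which telescopes. *)
Lemma qpochn_cauchy (n m : nat) (x : C) :
  (Cmod (qpochn (n + m) x p - qpochn n x p) <=
     exp (Cmod x / (1 - r)) * (Cmod x / (1 - r)) * r ^ n)%R.
Proof.
  have hr : (0 <= r < 1)%R by (split; [apply Cmod_ge_0 | exact hp]).
  have hx := Cmod_ge_0 x.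
  have he := exp_pos (Cmod x / (1 - r)).
  have A : (Cmod (qpochn (n + m) x p - qpochn n x p) <=
    exp (Cmod x / (1 - r)) * (Cmod x / (1 - r)) * (r ^ n - r ^ (n + m)))%R.
  { elim: m => [|m IH].
    - rewrite Nat.add_0_r. have -> : qpochn n x p - qpochn n x p = 0 by ring.
      rewrite Cmod_0; lra.
    - rewrite Nat.add_succ_r qpochn_S.
      have -> : qpochn (n + m) x p * (1 - x * p ^ (n + m)) - qpochn n x p =
        (qpochn (n + m) x p - qpochn n x p) + - (qpochn (n + m) x p * (x * p ^ (n + m))) by ring.
      eapply Rle_trans; first apply Cmod_triangle.
      rewrite Cmod_opp !Cmod_mult Cmod_pow.
      have -> : (exp (Cmod x / (1 - r)) * (Cmod x / (1 - r)) * (r ^ n - r ^ S (n + m)) =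
        exp (Cmod x / (1 - r)) * (Cmod x / (1 - r)) * (r ^ n - r ^ (n + m)) +
        exp (Cmod x / (1 - r)) * (Cmod x * r ^ (n + m)))%R by rewrite /=; field; lra.
      apply Rplus_le_compat; first exact IH.
      apply Rmult_le_compat_r; last apply qpochn_le.
      apply Rmult_le_pos; [exact hx | apply Cmod_pow_le_1]. }
  eapply Rle_trans; first exact A.
  apply Rmult_le_compat_l; last by have := Cmod_pow_le_1 (n + m); fold r; lra.
  apply Rmult_le_pos; first lra. apply Rmult_le_pos; first lra.
  apply Rlt_le, Rinv_0_lt_compat; lra.
Qed.

Lemma qpoch_lim (x : C) : Clim (fun n => qpochn n x p) (qpoch x p).
Proof.
  have hr : (0 <= r < 1)%R by (split; [apply Cmod_ge_0 | exact hp]).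
  have [l Hl] : exists l, Clim (fun n => qpochn n x p) l.
  { have [l Hl] := Cseries_geom_ex (fun n => qpochn (n + 1) x p - qpochn n x p) _ r hr
      (fun n => qpochn_cauchy n 1 x).
    exists (l + 1). apply: Clim_ext (Clim_plus _ _ _ _ Hl (Clim_const 1)).
    elim=> [|n IH]; first by rewrite /qpochn /=; ring.
    rewrite Csum_seq_S Nat.add_1_r.
    transitivity (Csum (seq 0 n) (fun n => qpochn (n + 1) x p - qpochn n x p) + 1 +
      (qpochn (S n) x p - qpochn n x p)); first ring.
    rewrite IH; ring. }
  have E : qpoch x p = l by apply Clim_Clim_seq.
  by rewrite E.
Qed.

Lemma qpoch_approx (n : nat) (x : C) :
  (Cmod (qpoch x p - qpochn n x p) <= exp (Cmod x / (1 - r)) * (Cmod x / (1 - r)) * r ^ n)%R.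
Proof.
  have H := Clim_minus _ _ _ _ (qpoch_lim x) (Clim_const (qpochn n x p)).
  apply: (Clim_Cmod_le _ _ _ n _ H) => m hm.
  have -> : m = (n + (m - n))%nat by lia.
  apply qpochn_cauchy.
Qed.

Lemma qpoch_approx_le (n : nat) (M : R) (x : C) : (Cmod x <= M)%R ->
  (Cmod (qpoch x p - qpochn n x p) <= exp (M / (1 - r)) * (M / (1 - r)) * r ^ n)%R.
Proof.
  move=> hx. have h0 := Cmod_ge_0 x.
  have hi : (0 < / (1 - r))%R by apply Rinv_0_lt_compat; rewrite /r; lra.
  have h1 : (0 <= Cmod x / (1 - r) <= M / (1 - r))%R by rewrite /Rdiv; split; nra.
  eapply Rle_trans; first apply qpoch_approx.
  apply Rmult_le_compat_r; first by apply pow_le, Cmod_ge_0.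
  apply Rmult_le_compat; [apply Rlt_le, exp_pos | lra | apply exp_le, h1 | lra].
Qed.

Lemma qpoch_le (x : C) : (Cmod (qpoch x p) <= exp (Cmod x / (1 - r)))%R.
Proof. apply: (Clim_Cmod_le _ _ _ 0 _ (qpoch_lim x)) => n _. apply qpochn_le. Qed.

Lemma qpoch_split (n : nat) (x : C) : qpoch x p = qpochn n x p * qpoch (x * p ^ n) p.
Proof.
  have H := Clim_scal (qpochn n x p) _ _ (qpoch_lim (x * p ^ n)).
  have H2 : Clim (fun m => qpochn (n + m) x p) (qpoch x p).
  { apply (Clim_subseq _ _ (fun m => (n + m)%nat) (qpoch_lim x)) => M. exists M => m; lia. }
  apply: (Clim_unique _ _ _ H2). apply: Clim_ext H => m. by rewrite qpochn_add.
Qed.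

Lemma qpoch_step (x : C) : qpoch x p = (1 - x) * qpoch (x * p) p.
Proof.
  rewrite (qpoch_split 1) /qpochn /= Cmult_1_r. ring_simplify (x * (p * 1)). ring.
Qed.

(** The inductive bound is the Weierstrass inequality: a product of factors [1 - u_k] is at least
    [1] minus the sum of the [u_k], and this geometric sum is at most [1/2]. *)
Lemma qpochn_ge_half (n : nat) (x : C) : (Cmod x <= (1 - r) / 2)%R -> (/ 2 <= Cmod (qpochn n x p))%R.
Proof.
  move=> hx0.
  have hr : (0 <= r < 1)%R by (split; [apply Cmod_ge_0 | exact hp]).
  have hx := Cmod_ge_0 x.
  have A : (1 - (1 - r ^ n) / 2 <= Cmod (qpochn n x p))%R.
  { elim: n => [|n IH]; first by rewrite /qpochn /= Cmod_1; lra.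
    rewrite qpochn_S Cmod_mult.
    have B := Cmod_pow_le_1 n. fold r in B.
    have C1 := Cmod_1_minus_ge (x * p ^ n). rewrite Cmod_mult Cmod_pow in C1. fold r in C1.
    have C2 : (Cmod x * r ^ n <= (1 - r) / 2 * r ^ n)%R by apply Rmult_le_compat_r; lra.
    apply Rle_trans with ((1 - (1 - r ^ n) / 2) * (1 - Cmod x * r ^ n))%R.
    - rewrite /=. have D : (0 <= r ^ n)%R by lra. have D2 : (0 <= Cmod x * r ^ n)%R by nra. nra.
    - apply Rmult_le_compat; [lra | nra | exact IH | exact C1]. }
  have B := Cmod_pow_le_1 n. fold r in B. lra.
Qed.

(** Beyond some [K] independent of [x] the remaining product is at least [1/2], and the first [K]
    factors are bounded below one at a time. Uniformity in [n] is what lets the reciprocals of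
    finite products converge uniformly. *)
Lemma qpochn_lower (M c : R) : (0 < c)%R ->
  exists m : R, (0 < m)%R /\ forall (x : C), (Cmod x <= M)%R ->
    (forall k, (c <= Cmod (1 - x * p ^ k))%R) -> forall n, (m <= Cmod (qpochn n x p))%R.
Proof.
  move=> hc.
  have hr : (0 <= r < 1)%R by (split; [apply Cmod_ge_0 | exact hp]).
  have [K HK] : exists K : nat, (M * r ^ K <= (1 - r) / 2)%R.
  { have [K HK] := geom_small M r ((1 - r) / 2) hr ltac:(lra). exists K. by apply HK. }
  (* Capped at [1] so that [c1^K] is also below [c1^n] for every [n <= K]. *)
  set c1 := Rmin c 1.
  have hc1 : (0 < c1 <= 1)%R by rewrite /c1; split; [apply Rmin_pos; lra | apply Rmin_r].
  have hcK : (0 < c1 ^ K)%R by apply pow_lt; lra.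
  exists (c1 ^ K * / 2)%R. split; first lra.
  move=> x hx hk n.
  have A : forall j, (c1 ^ j <= Cmod (qpochn j x p))%R.
  { elim=> [|j IH]; first by rewrite /qpochn /= Cmod_1; lra.
    rewrite qpochn_S Cmod_mult /= Rmult_comm.
    apply Rmult_le_compat; [apply pow_le; lra | lra | exact IH |].
    eapply Rle_trans; last apply hk. apply Rmin_l. }
  case: (Nat.le_gt_cases n K) => hn.
  - eapply Rle_trans; last apply A.
    have -> : K = (n + (K - n))%nat by lia.
    rewrite pow_add.
    have h1 : (0 < c1 ^ n)%R by apply pow_lt; lra.
    have h2 : (c1 ^ (K - n) <= 1)%R by rewrite -(pow1 (K - n)); apply pow_incr; lra.
    have h3 : (0 < c1 ^ (K - n))%R by apply pow_lt; lra.
    nra.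
  - have -> : n = (K + (n - K))%nat by lia.
    rewrite qpochn_add Cmod_mult.
    apply Rmult_le_compat; [lra | lra | apply A |].
    apply qpochn_ge_half. rewrite Cmod_mult Cmod_pow. fold r.
    eapply Rle_trans; last exact HK.
    apply Rmult_le_compat_r; [apply pow_le; lra | exact hx].
Qed.

Lemma qpoch_lower (M c : R) : (0 < c)%R ->
  exists m : R, (0 < m)%R /\ forall (x : C), (Cmod x <= M)%R ->
    (forall k, (c <= Cmod (1 - x * p ^ k))%R) -> (m <= Cmod (qpoch x p))%R.
Proof.
  move=> hc. have [m [hm H]] := qpochn_lower M c hc.
  exists m; split=> // x hx hk.
  apply: (Clim_Cmod_ge _ _ _ 0 _ (qpoch_lim x)) => n _. by apply H.
Qed.

Lemma Cmod_pow_mult_le (x : C) (rho : R) (k : nat) : (Cmod x <= rho)%R ->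
  (Cmod (x * p ^ k) <= rho)%R.
Proof.
  move=> hx. rewrite Cmod_mult Cmod_pow. have := Cmod_pow_le_1 k. have := Cmod_ge_0 x. nra.
Qed.

Lemma qpoch_ratio_bounded (M d : R) : (d < 1)%R ->
  exists K : R, forall x y, (Cmod x <= M)%R -> (Cmod y <= d)%R -> (Cmod (qpoch x p / qpoch y p) <= K)%R.
Proof.
  move=> hd. have [m [hm Hm]] := qpoch_lower d (1 - d) ltac:(lra).
  exists (exp (M / (1 - r)) * / m)%R => x y hx hy.
  have h2 : (m <= Cmod (qpoch y p))%R.
  { apply Hm => // k. have := Cmod_1_minus_ge (y * p ^ k). have := Cmod_pow_mult_le y d k hy. lra. }
  rewrite Cmod_div; last by apply Cmod_gt_0; lra.
  apply Rmult_le_compat; [apply Cmod_ge_0 | apply Rlt_le, Rinv_0_lt_compat; lra | | apply Rinv_le_contravar; lra].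
  eapply Rle_trans; first by apply qpoch_le. apply exp_le. rewrite /r.
  apply Rmult_le_compat_r => //. apply Rlt_le, Rinv_0_lt_compat; lra.
Qed.

Lemma qpoch_neq0 (x : C) : (forall k, x * p ^ k <> 1) -> qpoch x p <> 0.
Proof.
  move=> Hk.
  have hr : (0 <= r < 1)%R by (split; [apply Cmod_ge_0 | exact hp]).
  have [K HK] : exists K : nat, (Cmod x * r ^ K <= (1 - r) / 2)%R.
  { have [K HK] := geom_small (Cmod x) r ((1 - r) / 2) hr ltac:(lra). exists K. by apply HK. }
  rewrite (qpoch_split K). apply Cmult_neq_0.
  - apply Gprod_neq0 => k _ E. apply (Hk k).
    have -> : x * p ^ k = 1 - (1 - x * p ^ k) by ring. rewrite E; ring.
  - apply Cmod_gt_0.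
    apply Rlt_le_trans with (/ 2)%R; first lra.
    apply: (Clim_Cmod_ge _ _ _ 0 _ (qpoch_lim _)) => n _. apply qpochn_ge_half.
    by rewrite Cmod_mult Cmod_pow.
Qed.

Lemma qpoch_eq0 (x : C) (k : nat) : x * p ^ k = 1 -> qpoch x p = 0.
Proof.
  move=> H. rewrite (qpoch_split (S k)) qpochn_S H. ring.
Qed.

Lemma qpoch_neq0_small (x : C) : (Cmod x < 1)%R -> qpoch x p <> 0.
Proof.
  move=> hx. apply qpoch_neq0 => k E.
  have : (Cmod (x * p ^ k) < 1)%R.
  { rewrite Cmod_mult Cmod_pow. have := Cmod_pow_le_1 k. have := Cmod_ge_0 x. nra. }
  rewrite E Cmod_1; lra.
Qed.

Hypothesis hp0 : p <> 0.

Lemma theta_mul_p (x : C) : x <> 0 -> theta (p * x) p = - theta x p / x.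
Proof.
  move=> hx. rewrite /theta.
  have -> : p / (p * x) = / x by field.
  rewrite (qpoch_step (/ x)) (qpoch_step x).
  have -> : / x * p = p / x by rewrite /Cdiv; ring.
  rewrite (Cmult_comm p x). field. done.
Qed.

Lemma theta_inv (x : C) : x <> 0 -> theta (/ x) p = - theta x p / x.
Proof.
  move=> hx. rewrite /theta.
  have -> : p / / x = x * p by field.
  rewrite (qpoch_step (/ x)) (qpoch_step x).
  have -> : / x * p = p / x by rewrite /Cdiv; ring.
  field. done.
Qed.

Lemma theta_div_p (x : C) : x <> 0 -> theta (x / p) p = - (x / p) * theta x p.
Proof.
  move=> hx. have hxp : x / p <> 0 by apply Cmult_neq_0 => //; apply Cinv_neq0.
  have := theta_mul_p (x / p) hxp.
  have -> : p * (x / p) = x by field.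
  move=> ->. field. done.
Qed.

Lemma theta_neq0_l (x : C) : theta x p <> 0 -> qpoch x p <> 0.
Proof. move=> H E. apply H. rewrite /theta E; ring. Qed.

Lemma theta_neq0_pow (x : C) (k : nat) : theta x p <> 0 -> x * p ^ k <> 1.
Proof. move=> H E. apply (theta_neq0_l x H). by apply qpoch_eq0 with k. Qed.

Lemma theta_neq0_pow_r (x : C) (k : nat) : x <> 0 -> theta x p <> 0 -> x <> p ^ S k.
Proof.
  move=> hx H E. apply H. rewrite /theta.
  rewrite (qpoch_eq0 (p / x) k); first ring.
  have -> : p / x * p ^ k = p ^ S k / x by rewrite /= /Cdiv; ring.
  rewrite -E. field. done.
Qed.

End QPoch.

(** * Laurent approximation on annuli *)

(** Generated by operations instead of coefficients, so that integration against a pole is an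
    induction over these rules. *)
Inductive laurent : (C -> C) -> Prop :=
| laurent_const (c : C) : laurent (fun _ => c)
| laurent_mulz (f : C -> C) : laurent f -> laurent (fun z => z * f z)
| laurent_divz (f : C -> C) : laurent f -> laurent (fun z => / z * f z)
| laurent_plus (f g : C -> C) : laurent f -> laurent g -> laurent (fun z => f z + g z).

(** [laurent] is a predicate on function terms, so the product is delivered up to pointwise
    equality. *)
Lemma laurent_mult (f g : C -> C) : laurent f -> laurent g ->
  exists h, laurent h /\ forall z, h z = f z * g z.
Proof.
  move=> Hf Hg. elim: Hf => {f} [c|f _ [h [Hh E]]|f _ [h [Hh E]]|f1 f2 _ [h1 [Hh1 E1]] _ [h2 [Hh2 E2]]].
  - elim: Hg => {g} [d|g _ [h [Hh E]]|g _ [h [Hh E]]|g1 g2 _ [h1 [Hh1 E1]] _ [h2 [Hh2 E2]]].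
    + exists (fun _ => c * d); split=> //; constructor.
    + exists (fun z => z * h z); split; first by constructor. move=> z; rewrite E; ring.
    + exists (fun z => / z * h z); split; first by constructor. move=> z; rewrite E; ring.
    + exists (fun z => h1 z + h2 z); split; first by constructor. move=> z; rewrite E1 E2; ring.
  - exists (fun z => z * h z); split; first by constructor. move=> z; rewrite E; ring.
  - exists (fun z => / z * h z); split; first by constructor. move=> z; rewrite E; ring.
  - exists (fun z => h1 z + h2 z); split; first by constructor. move=> z; rewrite E1 E2; ring.
Qed.

Definition annulus (L : R) (z : C) : Prop := (1 <= Cmod z <= exp L)%R.

Lemma annulus_neq0 (L : R) (z : C) : annulus L z -> z <> 0.
Proof. move=> [h _] E. rewrite E Cmod_0 in h. lra. Qed.

Lemma annulus_inv (L : R) (z : C) : annulus L z -> (Cmod (/ z) <= 1)%R.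
Proof.
  move=> h. rewrite Cmod_inv; last by apply (annulus_neq0 L).
  rewrite -Rinv_1. apply Rinv_le_contravar; [lra | apply h].
Qed.

(* Stands in for holomorphy: all that is used of it is uniform approximability by Laurent polynomials. *)
Definition hol (L : R) (f : C -> C) : Prop :=
  forall eps : R, (0 < eps)%R -> exists P, laurent P /\
    forall z, annulus L z -> (Cmod (f z - P z) <= eps)%R.

Section Hol.
Variable L : R.

Lemma laurent_bounded (P : C -> C) : laurent P ->
  exists M, (0 <= M)%R /\ forall z, annulus L z -> (Cmod (P z) <= M)%R.
Proof.
  elim=> {P} [c|f _ [M [hM H]]|f _ [M [hM H]]|f g _ [M1 [hM1 H1]] _ [M2 [hM2 H2]]].
  - exists (Cmod c); split; [apply Cmod_ge_0 | move=> z _; lra].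
  - exists (exp L * M)%R; split; first by have := exp_pos L; nra.
    move=> z hz; rewrite Cmod_mult. apply Rmult_le_compat; [apply Cmod_ge_0 | apply Cmod_ge_0 | apply hz | by apply H].
  - exists M; split=> // z hz; rewrite Cmod_mult.
    have := annulus_inv L z hz. have := H z hz. have := Cmod_ge_0 (f z). have := Cmod_ge_0 (/ z). nra.
  - exists (M1 + M2)%R; split; first lra. move=> z hz.
    eapply Rle_trans; first apply Cmod_triangle. have := H1 z hz; have := H2 z hz; lra.
Qed.

Lemma hol_bounded (f : C -> C) : hol L f ->
  exists M, (0 <= M)%R /\ forall z, annulus L z -> (Cmod (f z) <= M)%R.
Proof.
  move=> Hf. have [P [HP E]] := Hf 1%R Rlt_0_1.
  have [M [hM H]] := laurent_bounded P HP.
  exists (M + 1)%R; split; first lra. move=> z hz.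
  have := E z hz; have := H z hz. have := Cmod_ge_minus (f z) (P z). lra.
Qed.

Lemma hol_laurent (P : C -> C) : laurent P -> hol L P.
Proof.
  move=> HP eps he; exists P; split=> // z _.
  have -> : P z - P z = 0 by ring. rewrite Cmod_0; lra.
Qed.

Lemma hol_ext (f g : C -> C) : (forall z, annulus L z -> f z = g z) -> hol L f -> hol L g.
Proof.
  move=> E Hf eps he. have [P [HP H]] := Hf eps he.
  exists P; split=> // z hz. rewrite -E //. by apply H.
Qed.

Lemma hol_const (c : C) : hol L (fun _ => c).
Proof. apply hol_laurent; constructor. Qed.

Lemma hol_id : hol L (fun z => z).
Proof.
  apply (hol_ext (fun z => z * 1)); first by move=> z _; ring.
  apply hol_laurent; constructor; constructor.
Qed.

Lemma hol_inv : hol L (fun z => / z).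
Proof.
  apply (hol_ext (fun z => / z * 1)); first by move=> z _; ring.
  apply hol_laurent; constructor; constructor.
Qed.

Lemma hol_plus (f g : C -> C) : hol L f -> hol L g -> hol L (fun z => f z + g z).
Proof.
  move=> Hf Hg eps he.
  have [P [HP EP]] := Hf (eps / 2)%R ltac:(lra).
  have [Q [HQ EQ]] := Hg (eps / 2)%R ltac:(lra).
  exists (fun z => P z + Q z); split; first by constructor.
  move=> z hz. have -> : f z + g z - (P z + Q z) = (f z - P z) + (g z - Q z) by ring.
  eapply Rle_trans; first apply Cmod_triangle. have := EP z hz; have := EQ z hz; lra.
Qed.

Lemma hol_mult (f g : C -> C) : hol L f -> hol L g -> hol L (fun z => f z * g z).
Proof.
  move=> Hf Hg eps he.
  have [Mf [hMf HMf]] := hol_bounded f Hf.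
  have [Mg [hMg HMg]] := hol_bounded g Hg.
  (* The cap [d <= 1] bounds the approximant of [g] by [Mg + 1], which absorbs the quadratic error
     term. *)
  set d := Rmin 1 (eps / (Mf + Mg + 1)).
  have hd : (0 < d)%R by apply Rmin_pos; [lra | apply Rdiv_lt_0_compat; lra].
  have hd1 : (d <= 1)%R by apply Rmin_l.
  have hd2 : (d * (Mf + Mg + 1) <= eps)%R.
  { apply Rle_trans with (eps / (Mf + Mg + 1) * (Mf + Mg + 1))%R.
    - apply Rmult_le_compat_r; [lra | apply Rmin_r].
    - right; field; lra. }
  have [P [HP EP]] := Hf d hd.
  have [Q [HQ EQ]] := Hg d hd.
  have [h [Hh E]] := laurent_mult P Q HP HQ.
  exists h; split=> // z hz. rewrite E.
  have -> : f z * g z - P z * Q z = f z * (g z - Q z) + (f z - P z) * (g z - (g z - Q z)) by ring.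
  eapply Rle_trans; first apply Cmod_triangle. rewrite !Cmod_mult.
  have A1 := EP z hz; have A2 := EQ z hz. have B1 := HMf z hz; have B2 := HMg z hz.
  have C1 : (Cmod (g z - (g z - Q z)) <= Mg + 1)%R.
  { eapply Rle_trans; first apply Cmod_triangle. rewrite Cmod_opp. lra. }
  have D1 := Cmod_ge_0 (f z); have D2 := Cmod_ge_0 (g z - Q z); have D3 := Cmod_ge_0 (f z - P z).
  have D4 := Cmod_ge_0 (g z - (g z - Q z)).
  apply Rle_trans with (Mf * d + d * (Mg + 1))%R; last lra.
  apply Rplus_le_compat; by apply Rmult_le_compat.
Qed.

Lemma hol_opp (f : C -> C) : hol L f -> hol L (fun z => - f z).
Proof.
  move=> H. apply (hol_ext (fun z => (- (1)) * f z)); first by move=> z _; ring.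
  apply hol_mult => //. apply hol_const.
Qed.

Lemma hol_minus (f g : C -> C) : hol L f -> hol L g -> hol L (fun z => f z - g z).
Proof. move=> Hf Hg. apply hol_plus => //. by apply hol_opp. Qed.

Lemma hol_pow (f : C -> C) (n : nat) : hol L f -> hol L (fun z => f z ^ n).
Proof.
  move=> H; elim: n => [|n IH] /=; first apply hol_const. by apply hol_mult.
Qed.

Lemma hol_Gprod {T} (l : list T) (f : T -> C -> C) :
  (forall x, In x l -> hol L (f x)) -> hol L (fun z => Gprod l (fun x => f x z)).
Proof.
  elim: l => [|x l IH] H /=; first apply hol_const.
  apply hol_mult; first by apply H; left. apply IH => y hy; apply H; by right.
Qed.

Lemma hol_Csum {T} (l : list T) (f : T -> C -> C) :
  (forall x, In x l -> hol L (f x)) -> hol L (fun z => Csum l (fun x => f x z)).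
Proof.
  elim: l => [|x l IH] H /=; first apply hol_const.
  apply hol_plus; first by apply H; left. apply IH => y hy; apply H; by right.
Qed.

Lemma hol_lim (u : nat -> C -> C) (f : C -> C) : (forall n, hol L (u n)) ->
  (forall eps : R, (0 < eps)%R -> exists n, forall z, annulus L z -> (Cmod (f z - u n z) <= eps)%R) ->
  hol L f.
Proof.
  move=> Hu Hl eps he.
  have [n Hn] := Hl (eps / 2)%R ltac:(lra).
  have [P [HP EP]] := Hu n (eps / 2)%R ltac:(lra).
  exists P; split=> // z hz.
  have := Cmod_triangle_minus (f z) (u n z) (P z). have := Hn z hz; have := EP z hz; lra.
Qed.

Lemma hol_qpochn (p : C) (x : C -> C) (n : nat) : hol L x -> hol L (fun z => qpochn n (x z) p).
Proof.
  move=> Hx. apply hol_Gprod => k _. apply hol_minus; first apply hol_const.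
  apply hol_mult => //. apply hol_const.
Qed.

Lemma hol_qpoch (p : C) (x : C -> C) : (Cmod p < 1)%R -> hol L x -> hol L (fun z => qpoch (x z) p).
Proof.
  move=> hp Hx. have [M [hM HM]] := hol_bounded x Hx.
  have hr : (0 <= Cmod p < 1)%R by (split; [apply Cmod_ge_0 | exact hp]).
  apply (hol_lim (fun n z => qpochn n (x z) p)); first by move=> n; apply hol_qpochn.
  move=> eps he.
  have [n0 Hn] := geom_small (exp (M / (1 - Cmod p)) * (M / (1 - Cmod p))) _ eps hr he.
  exists n0 => z hz. eapply Rle_trans; last apply (Hn n0 (Nat.le_refl _)).
  apply qpoch_approx_le => //. by apply HM.
Qed.

Lemma hol_inv_1_minus (x : C -> C) (rho : R) : (rho < 1)%R -> hol L x ->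
  (forall z, annulus L z -> (Cmod (x z) <= rho)%R) -> hol L (fun z => / (1 - x z)).
Proof.
  move=> hrho Hx Hr.
  case: (Rlt_le_dec rho 0) => hrho0.
  (* A negative [rho] leaves only an empty annulus, where every function is admissible. *)
  { apply (hol_ext (fun _ => 0)); last apply hol_const.
    move=> z hz. have := Hr z hz. have := Cmod_ge_0 (x z). lra. }
  apply (hol_lim (fun n z => Csum (seq 0 n) (fun k => x z ^ k))).
  { move=> n. apply hol_Csum => k _. by apply hol_pow. }
  move=> eps he. have [n0 Hn] := geom_small (/ (1 - rho)) rho eps ltac:(lra) he.
  exists n0 => z hz. have h := Hr z hz. have h0 := Cmod_ge_0 (x z).
  have h1 : (1 - rho <= Cmod (1 - x z))%R by have := Cmod_1_minus_ge (x z); lra.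
  have hne : 1 - x z <> 0 by apply Cmod_gt_0; lra.
  have E : forall n, / (1 - x z) - Csum (seq 0 n) (fun k => x z ^ k) = x z ^ n / (1 - x z).
  { elim=> [|n IH]; first by rewrite /=; field.
    rewrite Csum_seq_S.
    transitivity (/ (1 - x z) - Csum (seq 0 n) (fun k => x z ^ k) - x z ^ n); first ring.
    rewrite IH /=. field. done. }
  rewrite E Cmod_div // Cmod_pow. eapply Rle_trans; last apply (Hn n0 (Nat.le_refl _)).
  rewrite Rmult_comm. apply Rmult_le_compat; [by apply pow_le | apply Rlt_le, Rinv_0_lt_compat; lra | |].
  - by apply pow_incr.
  - by apply Rinv_le_contravar; lra.
Qed.

(** The reciprocals of the finite products are finite products of geometric series; they converge
    uniformly because the products are bounded away from [0]. The bound [rho < 1] keeps all zeros of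
    the symbol off the annulus. *)
Lemma hol_inv_qpoch (p : C) (x : C -> C) (rho : R) : (Cmod p < 1)%R -> (rho < 1)%R -> hol L x ->
  (forall z, annulus L z -> (Cmod (x z) <= rho)%R) -> hol L (fun z => / qpoch (x z) p).
Proof.
  move=> hp hrho Hx Hr.
  have hr : (0 <= Cmod p < 1)%R by (split; [apply Cmod_ge_0 | exact hp]).
  have [m [hm Hm]] := qpochn_lower p hp rho (1 - rho)%R ltac:(lra).
  have Hm' : forall z n, annulus L z -> (m <= Cmod (qpochn n (x z) p))%R.
  { move=> z n hz. apply Hm; first by apply Hr.
    move=> k. have := Cmod_1_minus_ge (x z * p ^ k).
    have := Cmod_pow_mult_le p hp (x z) rho k (Hr z hz). lra. }
  have Hm2 : forall z, annulus L z -> (m <= Cmod (qpoch (x z) p))%R.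
  { move=> z hz. apply: (Clim_Cmod_ge _ _ _ 0 _ (qpoch_lim p hp (x z))) => n _. by apply Hm'. }
  apply (hol_lim (fun n z => / qpochn n (x z) p)).
  { move=> n. apply (hol_ext (fun z => Gprod (seq 0 n) (fun k => / (1 - x z * p ^ k)))).
    { move=> z _. apply Gprod_inv. }
    apply hol_Gprod => k _. apply (hol_inv_1_minus _ rho) => //.
    - apply hol_mult => //. apply hol_const.
    - move=> z hz. apply Cmod_pow_mult_le => //. by apply Hr. }
  move=> eps he.
  have [n0 Hn] := geom_small (exp (rho / (1 - Cmod p)) * (rho / (1 - Cmod p)) * / m * / m) _ eps hr he.
  exists n0 => z hz.
  have h1 := Hm' z n0 hz. have h2 := Hm2 z hz.
  have e1 : qpochn n0 (x z) p <> 0 by apply Cmod_gt_0; lra.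
  have e2 : qpoch (x z) p <> 0 by apply Cmod_gt_0; lra.
  have -> : / qpoch (x z) p - / qpochn n0 (x z) p =
    - ((qpoch (x z) p - qpochn n0 (x z) p) * / qpochn n0 (x z) p * / qpoch (x z) p) by field.
  rewrite Cmod_opp !Cmod_mult !Cmod_inv //.
  eapply Rle_trans; last apply (Hn n0 (Nat.le_refl _)).
  have B := qpoch_approx_le p hp n0 rho (x z) (Hr z hz).
  have i1 : (0 < / Cmod (qpochn n0 (x z) p) <= / m)%R.
  { split; [apply Rinv_0_lt_compat; lra | apply Rinv_le_contravar; lra]. }
  have i2 : (0 < / Cmod (qpoch (x z) p) <= / m)%R.
  { split; [apply Rinv_0_lt_compat; lra | apply Rinv_le_contravar; lra]. }
  have D := Cmod_ge_0 (qpoch (x z) p - qpochn n0 (x z) p).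
  set X := (exp (rho / (1 - Cmod p)) * (rho / (1 - Cmod p)))%R in B |- *.
  have -> : (X * / m * / m * Cmod p ^ n0 = X * Cmod p ^ n0 * / m * / m)%R by ring.
  apply Rmult_le_compat; [| lra | | lra].
  - apply Rmult_le_pos; lra.
  - apply Rmult_le_compat; lra.
Qed.

End Hol.

(** * Complex-valued integrals *)

Definition CInt (f : R -> C) (a b : R) (v : C) : Prop :=
  is_RInt (V := C_R_CompleteNormedModule) f a b v.

Lemma CInt_of_Re_Im (f : R -> C) (a b : R) (v : C) :
  is_RInt (fun t => Re (f t)) a b (Re v) -> is_RInt (fun t => Im (f t)) a b (Im v) ->
  CInt f a b v.
Proof.
  move=> H1 H2. rewrite /CInt (surjective_pairing v).
  exact: (is_RInt_fct_extend_pair (U := R_NormedModule) (V := R_NormedModule) f a b _ _ H1 H2).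
Qed.

Lemma CInt_Re (f : R -> C) (a b : R) (v : C) :
  CInt f a b v -> is_RInt (fun t => Re (f t)) a b (Re v).
Proof.
  move=> H.
  exact: (is_RInt_fct_extend_fst (U := R_NormedModule) (V := R_NormedModule) f a b _ H).
Qed.

Lemma CInt_Im (f : R -> C) (a b : R) (v : C) :
  CInt f a b v -> is_RInt (fun t => Im (f t)) a b (Im v).
Proof.
  move=> H.
  exact: (is_RInt_fct_extend_snd (U := R_NormedModule) (V := R_NormedModule) f a b _ H).
Qed.

Lemma CInt_unique (f : R -> C) (a b : R) (v w : C) : CInt f a b v -> CInt f a b w -> v = w.
Proof.
  move=> H1 H2. rewrite -(is_RInt_unique (V := C_R_CompleteNormedModule) f a b v H1).
  exact: (is_RInt_unique (V := C_R_CompleteNormedModule) f a b w H2).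
Qed.

Lemma CInt_ext (f g : R -> C) (a b : R) (v : C) : (a <= b)%R ->
  (forall t, (a < t < b)%R -> f t = g t) -> CInt f a b v -> CInt g a b v.
Proof.
  move=> hab E. apply (is_RInt_ext (V := C_R_CompleteNormedModule)) => t.
  rewrite Rmin_left // Rmax_right //. apply E.
Qed.

Lemma CInt_plus (f g : R -> C) (a b : R) (v w : C) :
  CInt f a b v -> CInt g a b w -> CInt (fun t => f t + g t) a b (v + w).
Proof. apply (is_RInt_plus (V := C_R_CompleteNormedModule)). Qed.

(** Complex numbers are treated here as a real module of pairs, so multiplication by a complex
    constant has to be done on components. *)
Lemma CInt_scal (c : C) (f : R -> C) (a b : R) (v : C) :
  CInt f a b v -> CInt (fun t => c * f t) a b (c * v).
Proof.
  move=> H. have H1 := CInt_Re _ _ _ _ H. have H2 := CInt_Im _ _ _ _ H.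
  apply CInt_of_Re_Im.
  - exact: (is_RInt_minus _ _ _ _ _ _ (is_RInt_scal _ _ _ (Re c) _ H1) (is_RInt_scal _ _ _ (Im c) _ H2)).
  - exact: (is_RInt_plus _ _ _ _ _ _ (is_RInt_scal _ _ _ (Re c) _ H2) (is_RInt_scal _ _ _ (Im c) _ H1)).
Qed.

Lemma CInt_const (c : C) (a b : R) : CInt (fun _ => c) a b (RtoC (b - a) * c).
Proof.
  apply CInt_of_Re_Im.
  - have -> : Re ((b - a)%R * c) = scal (b - a)%R (Re c)
      by rewrite /scal /= /mult /= /Re; ring.
    exact: (is_RInt_const (V := R_NormedModule)  a b _).
  - have -> : Im ((b - a)%R * c) = scal (b - a)%R (Im c)
      by rewrite /scal /= /mult /= /Im; ring.
    exact: (is_RInt_const (V := R_NormedModule)  a b _).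
Qed.

Lemma CInt_bound (f : R -> C) (a b M : R) (v : C) : (a <= b)%R ->
  (forall t, (a <= t <= b)%R -> (Cmod (f t) <= M)%R) -> CInt f a b v ->
  (Cmod v <= M * (b - a))%R.
Proof.
  move=> hab HM H.
  have Hc : is_RInt (fun _ => M) a b (M * (b - a))%R.
  { have -> : (M * (b - a) = scal (b - a) M)%R by rewrite /scal /= /mult /=; ring.
    apply (is_RInt_const (V := R_NormedModule)). }
  have N : forall x : C, norm (V := C_R_CompleteNormedModule) x = Cmod x.
  { move=> x. rewrite /norm /= /prod_norm /norm /= /abs /= /Cmod.
    rewrite !Rmult_1_r -!Rabs_mult !(Rabs_pos_eq (_ * _)); try apply Rle_0_sqr.
    by rewrite /= !Rmult_1_r. }
  rewrite -N.
  apply (norm_RInt_le (V := C_R_CompleteNormedModule) f (fun _ => M) a b v _ hab) => // t ht.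
  rewrite N. exact: (HM t ht).
Qed.

Lemma CInt_lim (u : nat -> R -> C) (f : R -> C) (a b : R) (v : nat -> C) : (a <= b)%R ->
  (forall n, CInt (u n) a b (v n)) ->
  (forall eps : R, (0 < eps)%R -> exists n0, forall n, (n0 <= n)%nat ->
     forall t, (a <= t <= b)%R -> (Cmod (f t - u n t) < eps)%R) ->
  exists l, Clim v l /\ CInt f a b l.
Proof.
  move=> hab Hu Hl.
  (* The limit theorem for integrals wants uniform convergence on the whole line; all functions are
     set to zero outside [[a, b]]. *)
  set cut := fun (g : R -> C) (t : R) => match Rle_dec a t, Rle_dec t b with
    | left _, left _ => g t | _, _ => (0 : C) end.
  have cutE : forall g t, (a < t < b)%R -> g t = cut g t.
  { move=> g t ht. rewrite /cut. case: Rle_dec => h1; last lra. case: Rle_dec => h2; lra || done. }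
  have Hu' : forall n, is_RInt (V := C_R_CompleteNormedModule) (cut (u n)) a b (v n).
  { move=> n. apply (CInt_ext (u n)) => // t ht. by apply cutE. }
  have Hf : filterlim (fun n => cut (u n)) Hierarchy.eventually
     (locally (T := fct_UniformSpace R C_R_CompleteNormedModule) (cut f)).
  { apply filterlim_locally => eps.
    have [n0 Hn] := Hl eps (cond_pos eps). exists n0 => n hn t.
    have A : (Cmod (cut (u n) t - cut f t) < eps)%R.
    { rewrite /cut. have h0 : (Cmod (0 - 0) < eps)%R.
      { have -> : 0 - 0 = 0 by ring. rewrite Cmod_0. apply cond_pos. }
      case: Rle_dec => h1 //. case: Rle_dec => h2 //.
      rewrite Cmod_minus_sym. by apply Hn. }
    split; rewrite /ball /= /AbsRing_ball /abs /= /minus /plus /opp /=.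
    - eapply Rle_lt_trans; last exact A. apply (re_le_Cmod (cut (u n) t - cut f t)).
    - eapply Rle_lt_trans; last exact A. apply (im_le_Cmod (cut (u n) t - cut f t)). }
  have [l [H1 H2]] := filterlim_RInt (V := C_R_CompleteNormedModule) _ a b Hierarchy.eventually _ (cut f) v Hu' Hf.
  exists l; split; last first.
  { apply (CInt_ext (cut f)) => // t ht. by rewrite -cutE. }
  have H3 := proj1 (filterlim_locally (F := Hierarchy.eventually) v l) H1.
  apply Clim_of_Re_Im; apply is_lim_seq_eps => eps he.
  - have [n0 Hn] := H3 _ (mkposreal _ he). exists n0 => n hn. have [A _] := Hn n hn. exact A.
  - have [n0 Hn] := H3 _ (mkposreal _ he). exists n0 => n hn. have [_ A] := Hn n hn. exact A.
Qed.

(** [w0 + t * d] is a straight path with velocity [d]: [d = Ci] gives the circles and [d = 1] the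
    edges of the cut. *)
Lemma CInt_Cexp (c w0 d : C) (a b : R) : c <> 0 ->
  CInt (fun t => d * Cexp (c * (w0 + t * d))) a b
    ((Cexp (c * (w0 + b * d)) - Cexp (c * (w0 + a * d))) / c).
Proof.
  move=> hc.
  have H : forall c w0 : C, CInt (fun t => c * Cexp (w0 + t * c)) a b
    (Cexp (w0 + b * c) - Cexp (w0 + a * c)).
  { clear. move=> [c1 c2] [w1 w2]. apply CInt_of_Re_Im.
    - set F := fun t => (exp (w1 + t * c1) * cos (w2 + t * c2))%R.
      have -> : Re (Cexp ((w1, w2) + b * (c1, c2)) - Cexp ((w1, w2) + a * (c1, c2))) = minus (F b) (F a).
      { rewrite /F /minus /plus /opp /Cexp /Re /Im /=. rewrite !Rmult_0_l !Rminus_0_r !Rplus_0_r. done. }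
      apply (is_RInt_ext (fun t => c1 * (exp (w1 + t * c1) * cos (w2 + t * c2)) - c2 * (exp (w1 + t * c1) * sin (w2 + t * c2)))%R).
      { move=> t _. rewrite /Cexp /Re /Im /=. rewrite !Rmult_0_l !Rminus_0_r !Rplus_0_r. done. }
      apply: is_RInt_derive => t _.
      + rewrite /F. auto_derive => //. ring.
      + apply: ex_derive_continuous. auto_derive. done.
    - set F := fun t => (exp (w1 + t * c1) * sin (w2 + t * c2))%R.
      have -> : Im (Cexp ((w1, w2) + b * (c1, c2)) - Cexp ((w1, w2) + a * (c1, c2))) = minus (F b) (F a).
      { rewrite /F /minus /plus /opp /Cexp /Re /Im /=. rewrite !Rmult_0_l !Rminus_0_r !Rplus_0_r. done. }
      apply (is_RInt_ext (fun t => c1 * (exp (w1 + t * c1) * sin (w2 + t * c2)) + c2 * (exp (w1 + t * c1) * cos (w2 + t * c2)))%R).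
      { move=> t _. rewrite /Cexp /Re /Im /=. rewrite !Rmult_0_l !Rminus_0_r !Rplus_0_r. done. }
      apply: is_RInt_derive => t _.
      + rewrite /F. auto_derive => //. ring.
      + apply: ex_derive_continuous. auto_derive. done. }
  have K := CInt_scal (/ c) _ _ _ _ (H (c * d) (c * w0)).
  have -> : (Cexp (c * (w0 + b * d)) - Cexp (c * (w0 + a * d))) / c =
    / c * (Cexp (c * w0 + b * (c * d)) - Cexp (c * w0 + a * (c * d))).
  { have -> : c * (w0 + b * d) = c * w0 + b * (c * d) by ring.
    have -> : c * (w0 + a * d) = c * w0 + a * (c * d) by ring.
    rewrite /Cdiv; ring. }
  have E : forall t : R, / c * (c * d * Cexp (c * w0 + t * (c * d))) = d * Cexp (c * (w0 + t * d)).
  { move=> t. have -> : c * (w0 + t * d) = c * w0 + t * (c * d) by ring. field. done. }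
  apply: (is_RInt_ext (V := C_R_CompleteNormedModule)) K => t _. exact (E t).
Qed.

(** * The Hankel loop *)

Lemma Cexp_add_PI (w : C) : Cexp (w + PI * Ci) = - Cexp w.
Proof.
  rewrite Cexp_plus. have -> : Cexp (PI * Ci) = - (1).
  { have -> : PI * Ci = (0, PI)%R by apply: injective_projections; rewrite /=; ring.
    rewrite /Cexp /Re /Im /= exp_0 cos_PI sin_PI.
    by apply: injective_projections; rewrite /=; ring. }
  ring.
Qed.

Lemma Cexp_sub_PI (w : C) : Cexp (w - PI * Ci) = - Cexp w.
Proof.
  have H := Cexp_add_PI (w - PI * Ci).
  have E : w - PI * Ci + PI * Ci = w by ring. rewrite E in H. rewrite H. ring.
Qed.

Definition zpow (z : C) (n : Z) : C := z ^ Z.to_nat n * (/ z) ^ Z.to_nat (- n).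

Lemma zpow_Cexp (n : Z) (w : C) : zpow (Cexp w) n = Cexp (IZR n * w).
Proof.
  rewrite /zpow -Cexp_opp -!Cexp_INR_mult -Cexp_plus. f_equal.
  case: (Z.le_ge_cases 0 n) => hn.
  - have -> : Z.to_nat (- n) = 0%nat by lia.
    rewrite INR_IZR_INZ Z2Nat.id // /=. ring.
  - have -> : Z.to_nat n = 0%nat by lia.
    rewrite (INR_IZR_INZ (Z.to_nat (- n))) Z2Nat.id; last lia.
    rewrite opp_IZR RtoC_opp /=. ring.
Qed.

Lemma zpow_0 (z : C) : zpow z 0 = 1.
Proof. rewrite /zpow /=; ring. Qed.

Definition tau (sg : R) : C := Cexp (sg * (PI * Ci)) - Cexp (- (sg * (PI * Ci))).

(* In the variable [w = log z] the integrand is [F(w) = exp (sg w) f(exp w)]; [tau] collects the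
   difference of its boundary values [F(u + i pi) - F(u - i pi)] on the two sides of the cut. *)
Definition circ (sg u : R) (f : C -> C) (v : C) : Prop :=
  CInt (fun t => Ci * (Cexp (sg * (u + t * Ci)) * f (Cexp (u + t * Ci)))) (- PI) PI v.

Definition cut (sg L : R) (f : C -> C) (v : C) : Prop :=
  CInt (fun u => tau sg * (Cexp (sg * u) * f (- Cexp u))) 0 L v.

(** The boundary of the annulus slit along the negative axis, traversed clockwise: inner circle,
    upper edge outwards, outer circle backwards, lower edge inwards. The two edges are merged in
    [cut], which vanishes when [tau sg = 0], that is, when the integrand is single-valued. *)
Definition loop (sg L : R) (f : C -> C) (v : C) : Prop :=
  exists v0 vL vt, circ sg 0 f v0 /\ circ sg L f vL /\ cut sg L f vt /\ v = v0 - vL + vt.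

(** The slit counts only when [tau sg <> 0]; for a single-valued integrand poles may well lie on the
    negative axis. *)
Definition on_loop (sg L : R) (z : C) : Prop :=
  Cmod z = 1%R \/ Cmod z = exp L \/ (tau sg <> 0 /\ exists u : R, (0 <= u <= L)%R /\ z = - Cexp u).

Lemma PI_le : (- PI <= PI)%R.
Proof. have := PI_RGT_0; lra. Qed.

Lemma Cmod_Cexp_line (u t : R) : Cmod (Cexp (u + t * Ci)) = exp u.
Proof. rewrite Cmod_Cexp; f_equal. rewrite /Re /=; ring. Qed.

Lemma Cmod_opp_Cexp (u : R) : Cmod (- Cexp u) = exp u.
Proof. by rewrite Cmod_opp Cmod_Cexp. Qed.

Lemma on_loop_annulus (sg L : R) (z : C) : (0 <= L)%R -> on_loop sg L z -> annulus L z.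
Proof.
  move=> hL. have h1 : (1 <= exp L)%R by rewrite -exp_0; apply exp_le.
  rewrite /annulus. case=> [->|[->|[_ [u [hu ->]]]]]; try lra.
  rewrite Cmod_opp_Cexp -exp_0. split.
  - apply exp_le, hu.
  - apply exp_le, hu.
Qed.

Lemma circ_plus sg u f g v w : circ sg u f v -> circ sg u g w ->
  circ sg u (fun z => f z + g z) (v + w).
Proof.
  move=> H1 H2. apply: (CInt_ext _ _ _ _ _ PI_le _ (CInt_plus _ _ _ _ _ _ H1 H2)) => t _. ring.
Qed.

Lemma circ_scal sg u c f v : circ sg u f v -> circ sg u (fun z => c * f z) (c * v).
Proof.
  move=> H1. apply: (CInt_ext _ _ _ _ _ PI_le _ (CInt_scal c _ _ _ _ H1)) => t _. ring.
Qed.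

Lemma circ_ext sg u f g v : (forall z, Cmod z = exp u -> f z = g z) -> circ sg u f v -> circ sg u g v.
Proof.
  move=> E H1. apply: (CInt_ext _ _ _ _ _ PI_le _ H1) => t _. rewrite E //. apply Cmod_Cexp_line.
Qed.

Lemma cut_plus sg L f g v w : (0 <= L)%R -> cut sg L f v -> cut sg L g w ->
  cut sg L (fun z => f z + g z) (v + w).
Proof.
  move=> hL H1 H2. apply: (CInt_ext _ _ _ _ _ hL _ (CInt_plus _ _ _ _ _ _ H1 H2)) => t _. ring.
Qed.

Lemma cut_scal sg L c f v : (0 <= L)%R -> cut sg L f v -> cut sg L (fun z => c * f z) (c * v).
Proof.
  move=> hL H1. apply: (CInt_ext _ _ _ _ _ hL _ (CInt_scal c _ _ _ _ H1)) => t _. ring.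
Qed.

Lemma cut_ext sg L f g v : (0 <= L)%R ->
  (tau sg <> 0 -> forall u : R, (0 <= u <= L)%R -> f (- Cexp u) = g (- Cexp u)) ->
  cut sg L f v -> cut sg L g v.
Proof.
  move=> hL E H1. apply: (CInt_ext _ _ _ _ _ hL _ H1) => t ht.
  case: (Ceq_dec (tau sg) 0) => [->|h]; first ring.
  rewrite E //; lra.
Qed.

Lemma loop_plus sg L f g v w : (0 <= L)%R -> loop sg L f v -> loop sg L g w ->
  loop sg L (fun z => f z + g z) (v + w).
Proof.
  move=> hL [a0 [aL [at_ [A0 [AL [At ->]]]]]] [b0 [bL [bt [B0 [BL [Bt ->]]]]]].
  exists (a0 + b0), (aL + bL), (at_ + bt); repeat split.
  - by apply circ_plus. - by apply circ_plus. - by apply cut_plus. - ring.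
Qed.

Lemma loop_scal sg L c f v : (0 <= L)%R -> loop sg L f v -> loop sg L (fun z => c * f z) (c * v).
Proof.
  move=> hL [a0 [aL [at_ [A0 [AL [At ->]]]]]].
  exists (c * a0), (c * aL), (c * at_); repeat split.
  - by apply circ_scal. - by apply circ_scal. - by apply cut_scal. - ring.
Qed.

Lemma loop_ext sg L f g v : (0 <= L)%R -> (forall z, on_loop sg L z -> f z = g z) ->
  loop sg L f v -> loop sg L g v.
Proof.
  move=> hL E [a0 [aL [at_ [A0 [AL [At ->]]]]]].
  exists a0, aL, at_; repeat split.
  - apply: circ_ext A0 => z hz. apply E; left. by rewrite hz exp_0.
  - apply: circ_ext AL => z hz. apply E; right; by left.
  - apply: cut_ext At => // ht u hu. apply E; right; right. split=> //. by exists u.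
Qed.

Lemma loop_Csum {T} sg L (l : list T) (f : T -> C -> C) (v : T -> C) : (0 <= L)%R ->
  loop sg L (fun _ => 0) 0 ->
  (forall x, In x l -> loop sg L (f x) (v x)) ->
  loop sg L (fun z => Csum l (fun x => f x z)) (Csum l v).
Proof.
  move=> hL H0. elim: l => [|x l IH] H //=.
  apply loop_plus => //; first by apply H; left. apply IH => y hy; apply H; by right.
Qed.

Lemma loop_lim sg L (u : nat -> C -> C) (f : C -> C) (v : nat -> C) (l : C) : (0 <= L)%R ->
  (forall n, loop sg L (u n) (v n)) ->
  (forall eps : R, (0 < eps)%R -> exists n0, forall n, (n0 <= n)%nat ->
     forall z, on_loop sg L z -> (Cmod (f z - u n z) < eps)%R) ->
  Clim v l -> loop sg L f l.
Proof.
  move=> hL Hu Hl Hv.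
  (* Only the total [v n] is assumed to converge; the three parts are named by choice, and
     [CInt_lim] gives each of them its own limit. *)
  set v0 := fun n => proj1_sig (constructive_indefinite_description _ (Hu n)).
  have H0 : forall n, exists vL vt, circ sg 0 (u n) (v0 n) /\ circ sg L (u n) vL /\ cut sg L (u n) vt /\ v n = v0 n - vL + vt
    := fun n => proj2_sig (constructive_indefinite_description _ (Hu n)).
  set vL := fun n => proj1_sig (constructive_indefinite_description _ (H0 n)).
  have H1 : forall n, exists vt, circ sg 0 (u n) (v0 n) /\ circ sg L (u n) (vL n) /\ cut sg L (u n) vt /\ v n = v0 n - vL n + vt
    := fun n => proj2_sig (constructive_indefinite_description _ (H0 n)).
  set vt := fun n => proj1_sig (constructive_indefinite_description _ (H1 n)).
  have H2 : forall n, circ sg 0 (u n) (v0 n) /\ circ sg L (u n) (vL n) /\ cut sg L (u n) (vt n) /\ v n = v0 n - vL n + vt n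
    := fun n => proj2_sig (constructive_indefinite_description _ (H1 n)).
  clearbody v0 vL vt. clear H0 H1.
  have Hc : forall x : R, (0 <= x)%R -> (forall z, Cmod z = exp x -> on_loop sg L z) ->
    forall eps : R, (0 < eps)%R -> exists n0, forall n, (n0 <= n)%nat ->
     forall t, (- PI <= t <= PI)%R ->
     (Cmod (Ci * (Cexp (sg * (x + t * Ci)) * f (Cexp (x + t * Ci))) -
        Ci * (Cexp (sg * (x + t * Ci)) * u n (Cexp (x + t * Ci)))) < eps)%R.
  { move=> x hx hon eps he.
    have hs := exp_pos (sg * x).
    have [n0 Hn] := Hl (eps / exp (sg * x))%R ltac:(by apply Rdiv_lt_0_compat).
    exists n0 => n hn t _.
    have -> : Ci * (Cexp (sg * (x + t * Ci)) * f (Cexp (x + t * Ci))) -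
        Ci * (Cexp (sg * (x + t * Ci)) * u n (Cexp (x + t * Ci))) =
        Ci * (Cexp (sg * (x + t * Ci)) * (f (Cexp (x + t * Ci)) - u n (Cexp (x + t * Ci)))) by ring.
    rewrite !Cmod_mult Cmod_Ci Cmod_Cexp.
    have -> : Re (sg * (x + t * Ci)) = (sg * x)%R by rewrite /Re /=; ring.
    have A := Hn n hn (Cexp (x + t * Ci)) (hon _ (Cmod_Cexp_line x t)).
    apply Rmult_lt_reg_r with (/ exp (sg * x))%R; first by apply Rinv_0_lt_compat.
    eapply Rle_lt_trans; last exact A. right. field. lra. }
  have [l0 [hl0 c0]] := CInt_lim _ _ _ _ _ PI_le (fun n => proj1 (H2 n))
    (Hc 0%R (Rle_refl 0) (fun z hz => or_introl (eq_trans hz exp_0))).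
  have [lL [hlL cL]] := CInt_lim _ _ _ _ _ PI_le (fun n => proj1 (proj2 (H2 n)))
    (Hc L hL (fun z hz => or_intror (or_introl hz))).
  have [lt [hlt ct]] : exists l, Clim vt l /\ cut sg L f l.
  { apply: (CInt_lim _ _ _ _ _ hL (fun n => proj1 (proj2 (proj2 (H2 n))))) => eps he.
    set M := (Cmod (tau sg) * exp (Rabs (sg * L)) + 1)%R.
    have hM : (0 < M)%R.
    { have := Cmod_ge_0 (tau sg). have := exp_pos (Rabs (sg * L)). rewrite /M; nra. }
    have [n0 Hn] := Hl (eps / M)%R ltac:(by apply Rdiv_lt_0_compat).
    exists n0 => n hn t ht.
    have -> : tau sg * (Cexp (sg * t) * f (- Cexp t)) - tau sg * (Cexp (sg * t) * u n (- Cexp t)) =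
      tau sg * (Cexp (sg * t) * (f (- Cexp t) - u n (- Cexp t))) by ring.
    case: (Ceq_dec (tau sg) 0) => [->|h]; first by rewrite Cmult_0_l Cmod_0.
    have A := Hn n hn (- Cexp t) (or_intror (or_intror (conj h (ex_intro _ t (conj ht eq_refl))))).
    rewrite !Cmod_mult Cmod_Cexp.
    have -> : Re (sg * t) = (sg * t)%R by rewrite /Re /=; ring.
    have B : (exp (sg * t) <= exp (Rabs (sg * L)))%R.
    { apply exp_le. eapply Rle_trans; first apply Rle_abs.
      rewrite !Rabs_mult (Rabs_pos_eq t) ?(Rabs_pos_eq L); try lra.
      apply Rmult_le_compat_l; [apply Rabs_pos | lra]. }
    have D := Cmod_ge_0 (f (- Cexp t) - u n (- Cexp t)).
    have D2 := Cmod_ge_0 (tau sg). have D3 := exp_pos (sg * t).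
    set d := Cmod (f (- Cexp t) - u n (- Cexp t)) in A D |- *.
    have F : (M * d < eps)%R.
    { apply Rmult_lt_reg_r with (/ M)%R; first by apply Rinv_0_lt_compat.
      eapply Rle_lt_trans; last exact A. right. field. lra. }
    eapply Rle_lt_trans; last exact F. rewrite -Rmult_assoc.
    apply Rmult_le_compat_r => //. rewrite /M. nra. }
  exists l0, lL, lt; repeat split => //.
  apply: (Clim_unique _ _ _ Hv).
  apply: Clim_ext (Clim_plus _ _ _ _ (Clim_minus _ _ _ _ hl0 hlL) hlt) => n.
  by case: (H2 n) => _ [_ [_ ->]].
Qed.

(** [exp (c w)] with [c = sg + n] has the primitive [exp (c w) / c], whose corner values cancel
    around the loop. For [c = 0] the integrand in [w] is constant: each circle gives [2 pi i], the
    circles cancel, and so do the edges. *)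
Lemma loop_zpow (sg L : R) (n : Z) : (0 <= L)%R -> loop sg L (fun z => zpow z n) 0.
Proof.
  move=> hL. set c := RtoC sg + IZR n.
  have Ec : forall u t : R, Ci * (Cexp (sg * (u + t * Ci)) * zpow (Cexp (u + t * Ci)) n) = Ci * Cexp (c * (u + t * Ci)).
  { move=> u t. rewrite zpow_Cexp -Cexp_plus. do 2 f_equal. rewrite /c; ring. }
  have Et : forall u : R, tau sg * (Cexp (sg * u) * zpow (- Cexp u) n) =
    1 * Cexp (c * (PI * Ci + u * 1)) + (- (1)) * (1 * Cexp (c * (- PI * Ci + u * 1))).
  { move=> u. rewrite /tau.
    have A1 : Cexp (sg * (PI * Ci)) * (Cexp (sg * u) * zpow (- Cexp u) n) = Cexp (c * (PI * Ci + u * 1)).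
    { rewrite -Cexp_add_PI zpow_Cexp -!Cexp_plus. f_equal. rewrite /c; ring. }
    have A2 : Cexp (- (sg * (PI * Ci))) * (Cexp (sg * u) * zpow (- Cexp u) n) = Cexp (c * (- PI * Ci + u * 1)).
    { rewrite -Cexp_sub_PI zpow_Cexp -!Cexp_plus. f_equal. rewrite /c; ring. }
    rewrite -A1 -A2. ring. }
  case: (Ceq_dec c 0) => [hc|hc].
  - exists (2 * PI * Ci), (2 * PI * Ci), 0.
    have Hcirc : forall u : R, circ sg u (fun z => zpow z n) (2 * PI * Ci).
    { move=> u. have -> : 2 * PI * Ci = RtoC (PI - - PI) * Ci by rewrite RtoC_minus RtoC_opp; ring.
      apply: (CInt_ext _ _ _ _ _ PI_le _ (CInt_const Ci (- PI) PI)) => t _.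
      rewrite Ec hc Cmult_0_l Cexp_0; ring. }
    repeat split => //; last ring.
    have -> : (0 : C) = RtoC (L - 0) * 0 by ring.
    apply: (CInt_ext _ _ _ _ _ hL _ (CInt_const 0 0 L)) => t _.
    rewrite Et hc !Cmult_0_l Cexp_0; ring.
  - have Hcirc : forall u : R, circ sg u (fun z => zpow z n)
      ((Cexp (c * (u + PI * Ci)) - Cexp (c * (u + - PI * Ci))) / c).
    { move=> u. have := CInt_Cexp c u Ci (- PI) PI hc. rewrite RtoC_opp => H.
      apply: (CInt_ext _ _ _ _ _ PI_le _ H) => t _. by rewrite Ec. }
    eexists; eexists; eexists; split; last split; last split; [apply Hcirc | apply Hcirc | |].
    + apply: (CInt_ext _ _ _ _ _ hL (fun t _ => eq_sym (Et t))).
      apply CInt_plus; first apply CInt_Cexp => //.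
      apply CInt_scal. apply CInt_Cexp => //.
    + have -> : PI * Ci + L * 1 = L + PI * Ci by ring.
      have -> : - PI * Ci + L * 1 = L + - PI * Ci by ring.
      have -> : PI * Ci + 0 * 1 = 0 + PI * Ci by ring.
      have -> : - PI * Ci + 0 * 1 = 0 + - PI * Ci by ring.
      field. done.
Qed.

(** * Residue theorem for a single simple pole *)

Section Pole.
Variables (sg L : R) (b be K : C).
Hypothesis hL : (0 <= L)%R.
Hypothesis hb : b * be = 1.
Hypothesis hK : loop sg L (fun z => / (1 - b * z)) K.
Hypothesis hne : forall z, on_loop sg L z -> 1 - b * z <> 0.

Let b_neq0 : b <> 0.
Proof. move=> E. apply C1_nz. rewrite -hb E; ring. Qed.

Let be_neq0 : be <> 0.
Proof. move=> E. apply C1_nz. rewrite -hb E; ring. Qed.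

Lemma zpow_succ (z : C) (n : Z) : z <> 0 -> zpow z (n + 1) = z * zpow z n.
Proof.
  move=> hz. rewrite /zpow. case: (Z.le_gt_cases 0 n) => hn.
  - have -> : Z.to_nat (n + 1) = S (Z.to_nat n) by lia.
    have -> : Z.to_nat (- (n + 1)) = 0%nat by lia.
    have -> : Z.to_nat (- n) = 0%nat by lia.
    rewrite Cpow_S; ring.
  - have -> : Z.to_nat (n + 1) = 0%nat by lia.
    have -> : Z.to_nat (- n) = S (Z.to_nat (- (n + 1))) by lia.
    have -> : Z.to_nat n = 0%nat by lia.
    rewrite Cpow_S /=. field. done.
Qed.

Lemma zpow_pred (z : C) (n : Z) : z <> 0 -> zpow z (n - 1) = / z * zpow z n.
Proof.
  move=> hz. have := zpow_succ z (n - 1) hz. have -> : (n - 1 + 1)%Z = n by lia.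
  move=> ->. field. done.
Qed.

(** With [b z = 1 - (1 - b z)], raising or lowering [n] by one costs a factor [1/b] or [b] and a
    Laurent monomial, whose loop integral is [0]. Thus the kernel integral [K] determines all the
    others. *)
Lemma loop_zpow_pole (n : Z) : loop sg L (fun z => zpow z n / (1 - b * z)) (K * zpow be n).
Proof.
  have E0 : forall z, on_loop sg L z -> z <> 0.
  { move=> z hz. exact: (annulus_neq0 L z (on_loop_annulus sg L z hL hz)). }
  move: n; apply Z.peano_ind.
  - rewrite zpow_0 Cmult_1_r. apply: (loop_ext _ _ _ _ _ hL _ hK) => z hz.
    rewrite zpow_0. rewrite /Cdiv; ring.
  - move=> n IH. rewrite -Z.add_1_r.
    have A := loop_scal sg L (/ b) _ _ hL (loop_plus _ _ _ _ _ _ hL IH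
      (loop_scal sg L (- (1)) _ _ hL (loop_zpow sg L n hL))).
    have -> : K * zpow be (n + 1) = / b * (K * zpow be n + - (1) * 0).
    { rewrite zpow_succ //. have -> : be = / b by rewrite -(Cmult_1_l (/ b)) -hb; field.
      ring. }
    apply: (loop_ext _ _ _ _ _ hL _ A) => z hz.
    rewrite zpow_succ; last by apply E0.
    field. split => //. by apply hne.
  - move=> n IH. rewrite -Z.sub_1_r.
    have A := loop_plus _ _ _ _ _ _ hL (loop_zpow sg L (n - 1) hL) (loop_scal sg L b _ _ hL IH).
    have -> : K * zpow be (n - 1) = 0 + b * (K * zpow be n).
    { rewrite zpow_pred //. have -> : be = / b by rewrite -(Cmult_1_l (/ b)) -hb; field.
      field. done. }
    apply: (loop_ext _ _ _ _ _ hL _ A) => z hz.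
    rewrite zpow_pred; last by apply E0.
    field. split => //; [by apply E0 | by apply hne].
Qed.

Lemma loop_laurent_pole (P : C -> C) : laurent P ->
  loop sg L (fun z => P z / (1 - b * z)) (K * P be).
Proof.
  have E0 : forall z, on_loop sg L z -> z <> 0.
  { move=> z hz. exact: (annulus_neq0 L z (on_loop_annulus sg L z hL hz)). }
  move=> HP.
  have H : forall n, loop sg L (fun z => zpow z n * P z / (1 - b * z)) (K * (zpow be n * P be)).
  { elim: HP => {P} [c|f _ IH|f _ IH|f g _ IH1 _ IH2] n.
    - have -> : K * (zpow be n * c) = c * (K * zpow be n) by ring.
      apply: (loop_ext _ _ _ _ _ hL _ (loop_scal sg L c _ _ hL (loop_zpow_pole n))) => z hz.
      rewrite /Cdiv; ring.
    - have -> : K * (zpow be n * (be * f be)) = K * (zpow be (n + 1) * f be) by rewrite zpow_succ //; ring.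
      apply: (loop_ext _ _ _ _ _ hL _ (IH (n + 1)%Z)) => z hz.
      rewrite zpow_succ; [rewrite /Cdiv; ring | by apply E0].
    - have -> : K * (zpow be n * (/ be * f be)) = K * (zpow be (n - 1) * f be) by rewrite zpow_pred //; ring.
      apply: (loop_ext _ _ _ _ _ hL _ (IH (n - 1)%Z)) => z hz.
      rewrite zpow_pred; [rewrite /Cdiv; ring | by apply E0].
    - have -> : K * (zpow be n * (f be + g be)) = K * (zpow be n * f be) + K * (zpow be n * g be) by ring.
      apply: (loop_ext _ _ _ _ _ hL _ (loop_plus _ _ _ _ _ _ hL (IH1 n) (IH2 n))) => z hz.
      rewrite /Cdiv; ring. }
  have := H 0%Z. rewrite zpow_0 Cmult_1_l => H0.
  apply: (loop_ext _ _ _ _ _ hL _ H0) => z hz. rewrite zpow_0 /Cdiv; ring.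
Qed.

Variable delta : R.
Hypothesis hdelta : (0 < delta)%R.
Hypothesis hne' : forall z, on_loop sg L z -> (delta <= Cmod (1 - b * z))%R.
Hypothesis hbe : annulus L be.

(** Both sides pass to uniform limits of Laurent polynomials: by [hne'] the denominator stays at
    least [delta] on the loop, and the pole [be] lies in the annulus where the approximation
    holds. *)
Lemma loop_hol_pole (G : C -> C) : hol L G -> loop sg L (fun z => G z / (1 - b * z)) (K * G be).
Proof.
  move=> HG.
  have HP : forall n : nat, exists P, laurent P /\ forall z, annulus L z -> (Cmod (G z - P z) <= / (INR n + 1))%R.
  { move=> n. apply HG. apply Rinv_0_lt_compat. have := pos_INR n; lra. }
  set P := fun n => proj1_sig (constructive_indefinite_description _ (HP n)).
  have HP' : forall n, laurent (P n) /\ forall z, annulus L z -> (Cmod (G z - P n z) <= / (INR n + 1))%R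
    := fun n => proj2_sig (constructive_indefinite_description _ (HP n)).
  clearbody P.
  have small : forall eps, (0 < eps)%R -> exists n0 : nat, forall n, (n0 <= n)%nat -> (/ (INR n + 1) < eps)%R.
  { move=> eps he. have hi : (0 < / eps)%R by apply Rinv_0_lt_compat.
    have [n0 Hn0] := INR_unbounded (/ eps). exists n0 => n hn.
    rewrite -(Rinv_inv eps). apply Rinv_lt_contravar.
    - apply Rmult_lt_0_compat => //. have := pos_INR n; lra.
    - have := le_INR _ _ hn. lra. }
  apply: (loop_lim _ _ (fun n z => P n z / (1 - b * z)) _ (fun n => K * P n be) _ hL).
  - move=> n. apply loop_laurent_pole. apply HP'.
  - move=> eps he. have [n0 Hn] := small (eps * delta)%R ltac:(nra).
    exists n0 => n hn z hz.
    have -> : G z / (1 - b * z) - P n z / (1 - b * z) = (G z - P n z) / (1 - b * z) by rewrite /Cdiv; ring.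
    rewrite Cmod_div; last by apply hne.
    have A := proj2 (HP' n) z (on_loop_annulus sg L z hL hz).
    have B := hne' z hz. have D := Hn n hn. have F := Cmod_ge_0 (G z - P n z).
    apply Rmult_lt_reg_r with (Cmod (1 - b * z)); first lra.
    have -> : (Cmod (G z - P n z) / Cmod (1 - b * z) * Cmod (1 - b * z) = Cmod (G z - P n z))%R by field; lra.
    nra.
  - apply Clim_scal => eps he. have [n0 Hn] := small eps he. exists n0 => n hn.
    rewrite Cmod_minus_sym. eapply Rle_lt_trans; last exact (Hn n hn).
    by apply (proj2 (HP' n)).
Qed.

End Pole.

(** * Kernel integrals for the exponents 0 and 1/2 *)

Lemma RtoC_m1 : RtoC (-1)%R = - (1).
Proof. by apply: injective_projections; rewrite /=; ring. Qed.

(** Expand geometrically and integrate termwise: only the constant term survives. The sign [s] lets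
    the same expansion serve in [z] on the inner circle and in [1/z] on the outer one. *)
Lemma CInt_geom (s : R) (y : C) : (s = 1 \/ s = -1)%R -> (Cmod y < 1)%R ->
  CInt (fun t => Ci * / (1 - y * Cexp (s * (t * Ci)))) (- PI) PI (2 * PI * Ci).
Proof.
  move=> hs hy.
  set u := fun (n : nat) (t : R) => Csum (seq 0 n) (fun k => Ci * (y * Cexp (s * (t * Ci))) ^ k).
  (* The integral of the first [n] terms: zero for the empty sum, and constant once the term of
     index [0] is present. *)
  set v := fun n : nat => match n with O => (0 : C) | S _ => 2 * PI * Ci end.
  have Hu : forall n, CInt (u n) (- PI) PI (v n).
  { elim=> [|n IH].
    - have := CInt_const 0 (- PI) PI. by rewrite Cmult_0_r.
    - have K : CInt (fun t => Ci * (y * Cexp (s * (t * Ci))) ^ n) (- PI) PI (v (S n) - v n).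
      { case: n {IH} => [|n].
        - have -> : v 1%nat - v 0%nat = RtoC (PI - - PI) * Ci by rewrite /v RtoC_minus RtoC_opp; ring.
          apply: (CInt_ext _ _ _ _ _ PI_le _ (CInt_const Ci (- PI) PI)) => t _. rewrite /=; ring.
        - have -> : v (S (S n)) - v (S n) = y ^ S n * 0 by rewrite /v; ring.
          have hc : RtoC (INR (S n) * s) <> 0.
          { move=> /RtoC_inj E. have h1 : INR (S n) <> 0%R by apply not_0_INR.
            case: hs => hs'; rewrite hs' in E; lra. }
          have E0 : Cexp ((INR (S n) * s)%R * (0 + PI * Ci)) = Cexp ((INR (S n) * s)%R * (0 + (- PI)%R * Ci)).
          { have X1 : Cexp (PI * Ci) = - (1) by rewrite -(Cplus_0_l (PI * Ci)) Cexp_add_PI Cexp_0.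
            have X2 : Cexp ((- PI)%R * Ci) = - (1).
            { have -> : (- PI)%R * Ci = 0 - PI * Ci by rewrite RtoC_opp; ring. by rewrite Cexp_sub_PI Cexp_0. }
            rewrite !(RtoC_mult (INR (S n)) s) -!Cmult_assoc !Cexp_INR_mult !Cplus_0_l.
            case: hs => ->.
            - by rewrite !Cmult_1_l X1 X2.
            - have -> : (-1)%R * (PI * Ci) = (- PI)%R * Ci by rewrite RtoC_m1 (RtoC_opp PI); ring.
              have -> : (-1)%R * ((- PI)%R * Ci) = PI * Ci by rewrite RtoC_m1 (RtoC_opp PI); ring.
              by rewrite X1 X2. }
          have J := CInt_Cexp _ 0 Ci (- PI) PI hc.
          rewrite E0 in J.
          have J0 : (0 : C) = (Cexp ((INR (S n) * s)%R * (0 + (- PI)%R * Ci)) - Cexp ((INR (S n) * s)%R * (0 + (- PI)%R * Ci))) / (INR (S n) * s)%R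
            by rewrite /Cdiv; ring.
          rewrite [X in y ^ S n * X]J0.
          apply: (CInt_ext _ _ _ _ _ PI_le _ (CInt_scal (y ^ S n) _ _ _ _ J)) => t _.
          rewrite Cpow_mult_l -Cexp_INR_mult (RtoC_mult (INR (S n)) s).
          have -> : INR (S n) * s * (0 + t * Ci) = INR (S n) * (s * (t * Ci)) by ring.
          ring. }
      have -> : v (S n) = v n + (v (S n) - v n) by ring.
      apply: (CInt_ext _ _ _ _ _ PI_le _ (CInt_plus _ _ _ _ _ _ IH K)) => t _.
      by rewrite /u Csum_seq_S. }
  have hmod : forall t : R, Cmod (Cexp (s * (t * Ci))) = 1%R.
  { move=> t. rewrite Cmod_Cexp -exp_0. f_equal. rewrite /Re /=; ring. }
  have [l [Hl HI]] : exists l, Clim v l /\ CInt (fun t => Ci * / (1 - y * Cexp (s * (t * Ci)))) (- PI) PI l.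
  { apply: (CInt_lim u _ _ _ _ PI_le Hu) => eps he.
    have [n0 Hn] := geom_small (/ (1 - Cmod y)) (Cmod y) (eps / 2) (conj (Cmod_ge_0 y) hy) ltac:(lra).
    exists n0 => n hn t _.
    set x := y * Cexp (s * (t * Ci)).
    have hx : Cmod x = Cmod y by rewrite /x Cmod_mult hmod Rmult_1_r.
    have hx0 := Cmod_1_minus_ge x. rewrite hx in hx0.
    have hne : 1 - x <> 0 by apply Cmod_gt_0; lra.
    have E : Ci * / (1 - x) - u n t = Ci * (x ^ n / (1 - x)).
    { rewrite /u -/x. clear hn. elim: n => [|n IH]; first by rewrite /=; field.
      rewrite Csum_seq_S -/x.
      transitivity (Ci * / (1 - x) - Csum (seq 0 n) (fun k => Ci * x ^ k) - Ci * x ^ n); first ring.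
      rewrite IH /=. field. done. }
    rewrite E Cmod_mult Cmod_Ci Cmod_div // Cmod_pow hx.
    have A := Hn n hn. have hyn := pow_le _ n (Cmod_ge_0 y).
    have B : (/ Cmod (1 - x) <= / (1 - Cmod y))%R by apply Rinv_le_contravar; lra.
    have D : (Cmod y ^ n / Cmod (1 - x) <= / (1 - Cmod y) * Cmod y ^ n)%R
      by rewrite /Rdiv Rmult_comm; apply Rmult_le_compat_r.
    lra. }
  have -> : 2 * PI * Ci = l; last done.
  symmetry. apply: (Clim_unique _ _ _ Hl). apply (Clim_ext_ev (fun _ => 2 * PI * Ci) _ _ 1%nat); last apply Clim_const.
  by case=> [|n] hn //; lia.
Qed.

Lemma tau_0 : tau 0 = 0.
Proof. rewrite /tau !Cmult_0_l. have -> : - (0) = (0 : C) by ring. ring. Qed.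

(** The pole lies between the circles. On the inner one [b z] is small; on the outer one
    [1/(1 - b z) = 1 - 1/(1 - 1/(b z))] integrates to [2 pi i - 2 pi i]. *)
Lemma loop_kernel_0 (L : R) (b be : C) : (0 <= L)%R -> b * be = 1 -> (1 < Cmod be < exp L)%R ->
  loop 0 L (fun z => / (1 - b * z)) (2 * PI * Ci).
Proof.
  move=> hL hb hbe.
  have hb0 : b <> 0 by move=> E; apply C1_nz; rewrite -hb E; ring.
  have hm : (Cmod b * Cmod be = 1)%R by rewrite -Cmod_mult hb Cmod_1.
  have hmb : (0 < Cmod b)%R by apply Cmod_gt_0.
  exists (2 * PI * Ci), 0, 0; repeat split; last ring.
  - have h1 : (Cmod b < 1)%R by nra.
    apply: (CInt_ext _ _ _ _ _ PI_le _ (CInt_geom 1 b (or_introl eq_refl) h1)) => t _.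
    rewrite !Cmult_0_l Cplus_0_l Cexp_0 !Cmult_1_l. done.
  - have h1 : (Cmod (/ (b * Cexp L)) < 1)%R.
    { have hE := Cexp_neq0 L. rewrite Cmod_inv; last by apply Cmult_neq_0.
      rewrite Cmod_mult Cmod_Cexp /=. rewrite -Rinv_1. apply Rinv_lt_contravar; nra. }
    have A := CInt_plus _ _ _ _ _ _ (CInt_const Ci (- PI) PI)
      (CInt_scal (- (1)) _ _ _ _ (CInt_geom (-1) (/ (b * Cexp L)) (or_intror eq_refl) h1)).
    have -> : (0 : C) = (PI - - PI)%R * Ci + - (1) * (2 * PI * Ci) by rewrite RtoC_minus RtoC_opp; ring.
    apply: (CInt_ext _ _ _ _ _ PI_le _ A) => t _.
    rewrite !Cmult_0_l Cexp_0 !Cmult_1_l Cexp_plus.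
    have -> : (-1)%R * (t * Ci) = - (t * Ci) by rewrite RtoC_m1; ring.
    rewrite Cexp_opp. have hE := Cexp_neq0 L. have hE2 := Cexp_neq0 (t * Ci).
    have hne : b * (Cexp L * Cexp (t * Ci)) - 1 <> 0.
    { move=> E. have E1 : b * (Cexp L * Cexp (t * Ci)) = 1.
      { transitivity (b * (Cexp L * Cexp (t * Ci)) - 1 + 1); [ring | rewrite E; ring]. }
      have : Cmod (b * (Cexp L * Cexp (t * Ci))) = 1%R by rewrite E1 Cmod_1.
      rewrite -Cexp_plus Cmod_mult Cmod_Cexp_line. nra. }
    have hne2 : 1 - b * (Cexp L * Cexp (t * Ci)) <> 0.
    { move=> E. apply hne. transitivity (- (1 - b * (Cexp L * Cexp (t * Ci)))); [ring | rewrite E; ring]. }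
    field. repeat split => //.
    move=> E. apply hne. rewrite -E. ring.
  - have := CInt_const 0 0 L. rewrite Cmult_0_r => H.
    apply: (CInt_ext _ _ _ _ _ hL _ H) => t _. rewrite tau_0. ring.
Qed.

Section HalfIntegerKernel.
Local Open Scope R_scope.

Let Ch (x : R) : R := (exp x + exp (- x)) / 2.
Let Sh (x : R) : R := (exp x - exp (- x)) / 2.

Let Ch_Sh (x : R) : (Ch x) ^ 2 = (Sh x) ^ 2 + 1.
Proof.
  have h : exp x * exp (- x) = 1 by rewrite -exp_plus Rplus_opp_r exp_0.
  rewrite /Ch /Sh. nra.
Qed.

Let Ch_pos (x : R) : 0 < Ch x.
Proof. rewrite /Ch. have := exp_pos x. have := exp_pos (- x). lra. Qed.

Let Sh_pos (x : R) : 0 < x -> 0 < Sh x.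
Proof. move=> h. rewrite /Sh. have := exp_increasing (- x) x ltac:(lra). lra. Qed.

Let Sh_neg (x : R) : x < 0 -> Sh x < 0.
Proof. move=> h. rewrite /Sh. have := exp_increasing x (- x) ltac:(lra). lra. Qed.

(** The squared modulus of [sinh (x + i f)]. *)
Let Dn (x f : R) : R := Sh x ^ 2 + sin f ^ 2.

Let Dn_eq (x f : R) : Dn x f = (Ch x + cos f) * (Ch x - cos f).
Proof. rewrite /Dn. have := Ch_Sh x. have := sin2_cos2 f. rewrite /Rsqr. nra. Qed.

Let Dn_pos_factors (x f : R) : 0 < Dn x f -> 0 < Ch x + cos f /\ 0 < Ch x - cos f.
Proof. rewrite Dn_eq => h. have := Ch_pos x. split; nra. Qed.

(** Real and imaginary parts of [- 1 / (2 sinh (x + i f))]. *)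
Let ReK (x f : R) : R := - (Sh x * cos f) / (2 * Dn x f).
Let ImK (x f : R) : R := Ch x * sin f / (2 * Dn x f).
(** [ln |(1 + e^z) / (1 - e^z)|] at [z = x + i f]. The factor [1/2] of the primitive in [z]
    disappears because the kernels are integrated in [t] with [z] depending on [t/2]; the [1/2] seen
    here comes from squared moduli. *)
Let Am (x f : R) : R := / 2 * (ln (Ch x + cos f) - ln (Ch x - cos f)).

(* [e^z / (1 - e^(2z)) = - 1 / (2 sinh z)], whose primitive is [log ((1 + e^z) / (1 - e^z)) / 2]. *)
Lemma half_kernel_eq (x f : R) : 0 < Dn x f ->
  (Cexp (x + f * Ci) / (1 - Cexp (2 * (x + f * Ci))))%C = (ReK x f, ImK x f).
Proof.
  move=> hD.
  have E1 : ((ReK x f, ImK x f) * (Cexp (- (x + f * Ci)) - Cexp (x + f * Ci)))%C = 1%C.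
  { rewrite /Cexp.
    have -> : Re (- (x + f * Ci))%C = - x by rewrite /Re /=; ring.
    have -> : Im (- (x + f * Ci))%C = - f by rewrite /Im /=; ring.
    have -> : Re (x + f * Ci)%C = x by rewrite /Re /=; ring.
    have -> : Im (x + f * Ci)%C = f by rewrite /Im /=; ring.
    rewrite cos_neg sin_neg.
    have hx : exp x = Ch x + Sh x by rewrite /Ch /Sh; field.
    have hx' : exp (- x) = Ch x - Sh x by rewrite /Ch /Sh; field.
    rewrite hx hx'.
    have hcs : sin f ^ 2 = 1 - cos f ^ 2 by have := sin2_cos2 f; rewrite /Rsqr; nra.
    have hC := Ch_Sh x.
    apply: injective_projections; rewrite /ReK /ImK /=.
    - transitivity ((Sh x ^ 2 * cos f ^ 2 + Ch x ^ 2 * sin f ^ 2) / Dn x f); first by field; lra.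
      have -> : Sh x ^ 2 * cos f ^ 2 + Ch x ^ 2 * sin f ^ 2 = Dn x f by rewrite /Dn hC hcs; ring.
      field; lra.
    - field; lra. }
  have h0 := Cexp_neq0 (x + f * Ci)%C.
  have E2 : (1 - Cexp (2 * (x + f * Ci)) = Cexp (x + f * Ci) * (Cexp (- (x + f * Ci)) - Cexp (x + f * Ci)))%C.
  { rewrite Cexp_opp.
    have -> : (2 * (x + f * Ci) = (x + f * Ci) + (x + f * Ci))%C by ring.
    rewrite Cexp_plus. field. done. }
  rewrite E2.
  have h1 : (Cexp (- (x + f * Ci)) - Cexp (x + f * Ci))%C <> 0%C.
  { move=> E. rewrite E in E1. apply C1_nz. rewrite -E1. ring. }
  have -> : (Cexp (x + f * Ci) / (Cexp (x + f * Ci) * (Cexp (- (x + f * Ci)) - Cexp (x + f * Ci))) =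
    1 / (Cexp (- (x + f * Ci)) - Cexp (x + f * Ci)))%C by field; split.
  rewrite -E1. field. done.
Qed.

(** The imaginary part of the primitive is the argument of [- Sh x + i sin f]. On vertical lines
    [Sh x] does not vanish and [- atan (sin f / Sh x)] is a smooth branch; on horizontal lines
    [sin f] does not vanish and [atan (Sh x / sin f)] is one. *)
Lemma half_kernel_vert (x o a b : R) : x <> 0 ->
  CInt (fun t => Ci * (ReK x ((t - o) / 2), ImK x ((t - o) / 2)))%C a b
    (Am x ((b - o) / 2) - Am x ((a - o) / 2),
     atan (sin ((a - o) / 2) / Sh x) - atan (sin ((b - o) / 2) / Sh x)).
Proof.
  move=> hx.
  have hS : Sh x <> 0.
  { case: (Rtotal_order x 0) => [h|[h|h]]; [have := Sh_neg x h; lra | lra | have := Sh_pos x h; lra]. }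
  have hD : forall f, 0 < Dn x f.
  { move=> f. rewrite /Dn. have := pow2_ge_0 (sin f). have : 0 < Sh x ^ 2 by apply pow2_gt_0. lra. }
  apply CInt_of_Re_Im.
  - apply (is_RInt_ext (fun t => - ImK x ((t - o) / 2))).
    { move=> t _. rewrite /Re /=; ring. }
    apply: (is_RInt_derive (fun t => Am x ((t - o) / 2))) => t _.
    + have [h1 h2] := Dn_pos_factors _ _ (hD ((t - o) / 2)).
      rewrite /Am /ImK Dn_eq. auto_derive; first by (split; [exact h1 | split; [exact h2 | done]]).
      change ((t + - o) * / 2) with ((t - o) / 2). field. lra.
    + apply: ex_derive_continuous. rewrite /ImK /Dn. auto_derive. change ((t + - o) * / 2) with ((t - o) / 2).
      have := hD ((t - o) / 2). rewrite /Dn /=. lra.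
  - apply (is_RInt_ext (fun t => ReK x ((t - o) / 2))).
    { move=> t _. rewrite /Im /=; ring. }
    have -> : atan (sin ((a - o) / 2) / Sh x) - atan (sin ((b - o) / 2) / Sh x) =
      minus (- atan (sin ((b - o) / 2) / Sh x)) (- atan (sin ((a - o) / 2) / Sh x))
      by rewrite /minus /plus /opp /=; ring.
    apply: (is_RInt_derive (fun t => - atan (sin ((t - o) / 2) / Sh x))) => t _.
    + have h := hD ((t - o) / 2).
      rewrite /ReK. auto_derive => //. rewrite /Dn in h |- *.
      change ((t + - o) * / 2) with ((t - o) / 2). field.
      rewrite /= in h. split => //. lra.
    + apply: ex_derive_continuous. rewrite /ReK /Dn. auto_derive. change ((t + - o) * / 2) with ((t - o) / 2).
      have := hD ((t - o) / 2). rewrite /Dn /=. lra.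
Qed.

Lemma half_kernel_hor (f r a b : R) : sin f <> 0 ->
  CInt (fun t => (ReK ((t - r) / 2) f, ImK ((t - r) / 2) f))%C a b
    (Am ((b - r) / 2) f - Am ((a - r) / 2) f,
     atan (Sh ((b - r) / 2) / sin f) - atan (Sh ((a - r) / 2) / sin f)).
Proof.
  move=> hs.
  have hD : forall x, 0 < Dn x f.
  { move=> x. rewrite /Dn. have := pow2_ge_0 (Sh x). have : 0 < sin f ^ 2 by apply pow2_gt_0. lra. }
  apply CInt_of_Re_Im.
  - apply (is_RInt_ext (fun t => ReK ((t - r) / 2) f)) => //.
    apply: (is_RInt_derive (fun t => Am ((t - r) / 2) f)) => t _.
    + have [h1 h2] := Dn_pos_factors _ _ (hD ((t - r) / 2)).
      rewrite /Am /ReK Dn_eq. rewrite /Ch in h1 h2 |- *. auto_derive; first by (split; [exact h1 | split; [exact h2 | done]]).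
      rewrite /Sh. change ((t + - r) * / 2) with ((t - r) / 2). field. lra.
    + apply: ex_derive_continuous. have := hD ((t - r) / 2).
      rewrite /ReK /Dn /Sh => h. auto_derive.
      change ((t + - r) * / 2) with ((t - r) / 2). rewrite /= in h. lra.
  - apply (is_RInt_ext (fun t => ImK ((t - r) / 2) f)) => //.
    apply: (is_RInt_derive (fun t => atan (Sh ((t - r) / 2) / sin f))) => t _.
    + have h := hD ((t - r) / 2).
      rewrite /ImK. rewrite /Dn /Sh /Ch in h |- *. auto_derive => //.
      change ((t + - r) * / 2) with ((t - r) / 2). field.
      rewrite /= in h. split => //. lra.
    + apply: ex_derive_continuous. have := hD ((t - r) / 2).
      rewrite /ImK /Dn /Sh /Ch => h. auto_derive.
      change ((t + - r) * / 2) with ((t - r) / 2). rewrite /= in h. lra.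
Qed.

Lemma atan_inv_add (u v : R) : 0 < u * v -> atan (u / v) + atan (v / u) = PI / 2.
Proof.
  move=> h. have hu : u <> 0 by nra. have hv : v <> 0 by nra.
  have -> : v / u = / (u / v) by field.
  rewrite atan_inv; first ring.
  have -> : u / v = u * v * (/ v) ^ 2 by field.
  apply Rmult_lt_0_compat => //. by apply pow2_gt_0, Rinv_neq_0_compat.
Qed.

Lemma atan_inv_sub (u v : R) : u * v < 0 -> atan (u / v) + atan (v / u) = - (PI / 2).
Proof.
  move=> h. have hu : u <> 0 by nra. have hv : v <> 0 by nra.
  have := atan_inv_add (- u) v ltac:(nra).
  have -> : - u / v = - (u / v) by field.
  have -> : v / - u = - (v / u) by field.
  rewrite !atan_opp. lra.
Qed.

(** The corner values of [Am] cancel. The branches of the argument used on adjacent sides differ by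
    a quarter turn, and the four corners add up to [2 pi]. The bounds on [om] place the pole
    strictly inside the slit annulus. *)
Lemma loop_kernel_half (L : R) (om : C) : 0 < Re om < L -> - PI < Im om < PI ->
  loop (/ 2) L (fun z => / (1 - Cexp (- om) * z))%C (2 * PI * Ci * Cexp (om / 2))%C.
Proof.
  move=> hre him.
  have hPI := PI_RGT_0.
  have oE : om = (Re om + Im om * Ci)%C by apply: injective_projections; rewrite /Re /Im /=; ring.
  (* With [z = (w - om) / 2] the integrand is [exp (om / 2)] times the kernel
     [e^z / (1 - e^(2z))]. *)
  have F : forall u t : R, 0 < Dn ((u - Re om) / 2) ((t - Im om) / 2) ->
    (Cexp ((/ 2)%R * (u + t * Ci)) * / (1 - Cexp (- om) * Cexp (u + t * Ci)))%C =
    (Cexp (om / 2) * (ReK ((u - Re om) / 2) ((t - Im om) / 2), ImK ((u - Re om) / 2) ((t - Im om) / 2)))%C.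
  { move=> u t hD. rewrite -half_kernel_eq //.
    have E : (((u - Re om) / 2)%R + ((t - Im om) / 2)%R * Ci = (u + t * Ci - om) / 2)%C.
    { rewrite {3}oE /Rdiv !RtoC_mult !RtoC_minus RtoC_inv; last lra. field. }
    rewrite E.
    have -> : (2 * ((u + t * Ci - om) / 2) = - om + (u + t * Ci))%C.
    { field. }
    rewrite (Cexp_plus (- om)%C).
    have -> : ((/ 2)%R * (u + t * Ci) = om / 2 + (u + t * Ci - om) / 2)%C.
    { rewrite RtoC_inv; last lra. field. }
    rewrite (Cexp_plus (om / 2)%C). set X := Cexp (om / 2)%C. set Y := Cexp ((u + t * Ci - om) / 2)%C.
    rewrite /Cdiv. ring. }
  have hsplus : 0 < sin ((PI - Im om) / 2) by apply sin_gt_0; lra.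
  have hsminus : sin ((- PI - Im om) / 2) < 0.
  { have -> : (- PI - Im om) / 2 = - ((PI + Im om) / 2) by field.
    rewrite sin_neg. have : 0 < sin ((PI + Im om) / 2) by apply sin_gt_0; lra. lra. }
  have hDx : forall x f, x <> 0 -> 0 < Dn x f.
  { move=> x f hx. have hS : Sh x <> 0.
    { case: (Rtotal_order x 0) => [h|[h|h]]; [have := Sh_neg x h; lra | lra | have := Sh_pos x h; lra]. }
    rewrite /Dn. have := pow2_ge_0 (sin f). have : 0 < Sh x ^ 2 by apply pow2_gt_0. lra. }
  have hDf : forall x f, sin f <> 0 -> 0 < Dn x f.
  { move=> x f hx. rewrite /Dn. have := pow2_ge_0 (Sh x). have : 0 < sin f ^ 2 by apply pow2_gt_0. lra. }
  have V : forall u : R, u <> Re om -> circ (/ 2) u (fun z => / (1 - Cexp (- om) * z))%C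
    (Cexp (om / 2) * (Am ((u - Re om) / 2) ((PI - Im om) / 2) - Am ((u - Re om) / 2) ((- PI - Im om) / 2),
     atan (sin ((- PI - Im om) / 2) / Sh ((u - Re om) / 2)) - atan (sin ((PI - Im om) / 2) / Sh ((u - Re om) / 2)))%R)%C.
  { move=> u hu. have hx : (u - Re om) / 2 <> 0 by lra.
    apply: (CInt_ext _ _ _ _ _ PI_le _ (CInt_scal (Cexp (om / 2)) _ _ _ _ (half_kernel_vert _ (Im om) (- PI) PI hx))) => t _.
    rewrite F; last by apply hDx. ring. }
  have H := CInt_plus _ _ _ _ _ _
    (CInt_scal (Cexp (om / 2)) _ _ _ _ (half_kernel_hor _ (Re om) 0 L (Rgt_not_eq _ _ hsplus)))
    (CInt_scal (- Cexp (om / 2))%C _ _ _ _ (half_kernel_hor _ (Re om) 0 L (Rlt_not_eq _ _ hsminus))).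
  eexists; eexists; eexists; split; last split; last split;
    [apply V; lra | apply V; lra | |].
  - apply: (CInt_ext _ _ _ _ _ _ _ H); first lra.
    move=> t ht.
    have F1 := F t PI (hDf _ _ (Rgt_not_eq _ _ hsplus)).
    have F2 := F t (- PI) (hDf _ _ (Rlt_not_eq _ _ hsminus)).
    rewrite Cexp_add_PI in F1.
    have Em : (t + (- PI)%R * Ci = t - PI * Ci)%C by rewrite RtoC_opp; ring.
    rewrite Em Cexp_sub_PI in F2.
    have opp_mult : forall x y : C, (- x * y = - (x * y))%C by move=> x y; ring.
    rewrite opp_mult -F1 -F2 /tau.
    have -> : ((/ 2)%R * (t + PI * Ci) = (/ 2)%R * (PI * Ci) + (/ 2)%R * t)%C by ring.
    have -> : ((/ 2)%R * (t - PI * Ci) = - ((/ 2)%R * (PI * Ci)) + (/ 2)%R * t)%C by ring.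
    rewrite !Cexp_plus. ring.
  - set x0 := (0 - Re om) / 2. set x1 := (L - Re om) / 2.
    have hx0 : Sh x0 < 0 by apply Sh_neg; rewrite /x0; lra.
    have hx1 : 0 < Sh x1 by apply Sh_pos; rewrite /x1; lra.
    set fp := (PI - Im om) / 2. set fm := (- PI - Im om) / 2.
    fold fp in hsplus. fold fm in hsminus.
    (* One identity per corner; the signs of [Sh] and of the sine there decide between [pi/2] and
       [- pi/2]. *)
    have a1 := atan_inv_add (sin fm) (Sh x0) ltac:(nra).
    have a2 := atan_inv_sub (sin fp) (Sh x0) ltac:(nra).
    have a3 := atan_inv_sub (sin fm) (Sh x1) ltac:(nra).
    have a4 := atan_inv_add (sin fp) (Sh x1) ltac:(nra).
    have -> : (2 * PI * Ci * Cexp (om / 2) = Cexp (om / 2) * (0, 2 * PI)%R)%C.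
    { have -> : (0, 2 * PI)%R = (2 * PI * Ci)%C by apply: injective_projections; rewrite /=; ring.
      ring. }
    set E := Cexp (om / 2).
    match goal with |- _ = (E * ?a - E * ?b + (E * ?c + - E * ?d))%C =>
      transitivity (E * (a - b + c - d))%C; last ring end.
    f_equal. apply: injective_projections; rewrite /=; lra.
Qed.

End HalfIntegerKernel.

(** * Partial fractions and residues *)

Section PartialFractions.
Variables (T : Type) (eq_dec : forall x y : T, {x = y} + {x <> y}) (b : T -> C).

(** Replaces a factor by [1] instead of deleting it, so that the index list is the same in every
    coefficient. *)
Definition except_one (x : T) (F : T -> C) (y : T) : C :=
  match eq_dec y x with left _ => 1 | right _ => F y end.

Lemma Gprod_except_one_notin (x : T) (F : T -> C) (l : list T) : ~ In x l ->
  Gprod l (except_one x F) = Gprod l F.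
Proof.
  move=> hx. apply Gprod_ext => y hy. rewrite /except_one. case: eq_dec => // E. by rewrite E in hy.
Qed.

(** In the induction the old expansion is multiplied by the new factor [1/(1 - b x0 z)] and each
    product of two poles is split. The coefficient at the new pole is the old expansion evaluated at
    [z = / b x0]. *)
Lemma partial_fractions (l : list T) : NoDup l -> l <> nil ->
  (forall x, In x l -> b x <> 0) ->
  (forall x y, In x l -> In y l -> x <> y -> b x <> b y) ->
  forall z, (forall x, In x l -> 1 - b x * z <> 0) ->
  / Gprod l (fun x => 1 - b x * z) =
  Csum l (fun x => / (1 - b x * z) * / Gprod l (except_one x (fun y => 1 - b y / b x))).
Proof.
  elim: l => [|x0 l IH] // hnd _ hb0 hbd z hz.
  inversion hnd as [|x' l' hx0 hl E1]; subst.
  case: l IH hnd hb0 hbd hz hx0 hl => [|x1 l1] IH hnd hb0 hbd hz hx0 hl.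
  { rewrite /= /except_one. case: eq_dec => // _. rewrite !Cmult_1_r Cplus_0_r.
    have -> : / (1 : C) = 1 by field. ring. }
  set l := x1 :: l1 in IH hnd hb0 hbd hz hx0 hl |- *.
  have h0 : b x0 <> 0 by apply hb0; left.
  have IH' := IH hl ltac:(done) (fun x hx => hb0 x (or_intror hx))
    (fun x y hx hy => hbd x y (or_intror hx) (or_intror hy)).
  have A := IH' z (fun x hx => hz x (or_intror hx)).
  have B := IH' (/ b x0).
  have B1 : forall x, In x l -> 1 - b x * / b x0 <> 0.
  { move=> x hx E. apply (hbd x x0); [by right | by left | by move=> Ex; rewrite Ex in hx |].
    transitivity (b x0 * (1 - (1 - b x * / b x0))); [by field | rewrite E; ring]. }
  have {}B := B B1.
  change (/ ((1 - b x0 * z) * Gprod l (fun x => 1 - b x * z)) =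
    / (1 - b x0 * z) * / (except_one x0 (fun y => 1 - b y / b x0) x0 * Gprod l (except_one x0 (fun y => 1 - b y / b x0)))
    + Csum l (fun x => / (1 - b x * z) * / (except_one x (fun y => 1 - b y / b x) x0 * Gprod l (except_one x (fun y => 1 - b y / b x))))).
  rewrite Gprod_except_one_notin //.
  have -> : except_one x0 (fun y => 1 - b y / b x0) x0 = 1.
  { rewrite /except_one. by case: eq_dec. }
  rewrite Cmult_1_l. change (fun y => 1 - b y / b x0) with (fun y => 1 - b y * / b x0).
  rewrite Cinv_mult A B -!Csum_scal -Csum_plus.
  apply Csum_ext => x hx.
  have hne : x0 <> x by move=> E; rewrite E in hx0.
  rewrite {3}/except_one. case: eq_dec => // _.
  rewrite Cinv_mult. set P := / Gprod l _.
  have hx' : b x <> 0 by apply hb0; right.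
  have hz0 : 1 - b x0 * z <> 0 by apply hz; left.
  have hzx : 1 - b x * z <> 0 by apply hz; right.
  have hd : b x0 - b x <> 0.
  { move=> E. apply (hbd x0 x); [by left | by right | done |].
    transitivity (b x0 - b x + b x); [ring | rewrite E; ring]. }
  have hd' : b x - b x0 <> 0.
  { move=> E. apply hd. transitivity (- (b x - b x0)); [ring | rewrite E; ring]. }
  field. by repeat split.
Qed.

End PartialFractions.

(** The point [-1] has distance [|sin (Im w)|] from the line carrying the ray of argument [Im w]; if
    the sine vanishes, the ray is the positive axis and the modulus is at least [1]. On the cut,
    [1 - b z] with [z = - e^u] has this form. *)
Lemma one_plus_ray_lower (w : C) : (- PI < Im w < PI)%R ->
  exists c : R, (0 < c)%R /\ forall u : R, (c <= Cmod (1 + Cexp (u + w)))%R.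
Proof.
  move=> hw.
  have E : forall u : R, Cexp (u + w) = (exp (u + Re w) * cos (Im w), exp (u + Re w) * sin (Im w))%R.
  { move=> u. rewrite /Cexp.
    have -> : Re (u + w) = (u + Re w)%R by [].
    have -> : Im (u + w) = (Im w)%R by rewrite /Im /=; ring. done. }
  case: (Req_dec (sin (Im w)) 0) => hs.
  - exists 1%R; split; first lra. move=> u. rewrite E.
    have hc : (0 < cos (Im w))%R.
    { have h0 : Im w = 0%R.
      { case: (Rtotal_order (Im w) 0) => [h|[h|h]] //.
        - have := sin_gt_0 (- Im w) ltac:(lra) ltac:(lra). rewrite sin_neg; lra.
        - have := sin_gt_0 (Im w) ltac:(lra) ltac:(lra). lra. }
      rewrite h0 cos_0; lra. }
    eapply Rle_trans; last apply re_le_Cmod. rewrite /Re /=.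
    have h := exp_pos (u + fst w). rewrite Rabs_pos_eq; rewrite /Im in hc *; nra.
  - exists (Rabs (sin (Im w))); split; first by apply Rabs_pos_lt.
    move=> u. rewrite E. set t := exp _.
    rewrite -(Rabs_pos_eq (Cmod _)); last apply Cmod_ge_0.
    apply Rsqr_le_abs_0. rewrite /Rsqr.
    have -> : (Cmod (1 + (t * cos (Im w), t * sin (Im w))%R) * Cmod (1 + (t * cos (Im w), t * sin (Im w))%R) =
      (1 + t * cos (Im w)) ^ 2 + (t * sin (Im w)) ^ 2)%R.
    { have := Cmod2_alt (1 + (t * cos (Im w), t * sin (Im w))%R). rewrite /Re /Im /= !Rmult_1_r => ->. ring. }
    have h1 := sin2_cos2 (Im w). rewrite /Rsqr in h1.
    (* [|1 + t e^(i phi)|^2 - sin^2 phi = (cos phi + t)^2]. *)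
    have : (0 <= (cos (Im w) + t) ^ 2)%R by apply pow2_ge_0. nra.
Qed.

Lemma pair_eq_dec (x y : nat * nat) : {x = y} + {x <> y}.
Proof. decide equality; apply Nat.eq_dec. Qed.

Lemma except_In (k j : nat) (l : list nat) : In j (except k l) <-> In j l /\ j <> k.
Proof.
  rewrite /except filter_In. split; move=> [h1 h2]; split=> //.
  - move=> E. rewrite E Nat.eqb_refl in h2. discriminate.
  - apply Bool.negb_true_iff. by apply Nat.eqb_neq.
Qed.

Lemma except_notin (k : nat) (l : list nat) : ~ In k l -> except k l = l.
Proof.
  elim: l => [|y l IH] //= h. case E: (Nat.eqb y k) => /=.
  - exfalso; apply h; left. by apply Nat.eqb_eq.
  - f_equal. apply IH => h2; apply h; by right.
Qed.

Lemma Gprod_except (k : nat) (l : list nat) (F : nat -> C) : NoDup l -> In k l ->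
  Gprod l F = F k * Gprod (except k l) F.
Proof.
  elim: l => [|y l IH] //= hnd hin. inversion hnd as [|y' l' hy hl E1]; subst.
  case: (Nat.eq_dec y k) => E.
  - subst y. rewrite Nat.eqb_refl /=. by rewrite -/(except k l) except_notin.
  - have -> : Nat.eqb y k = false by apply Nat.eqb_neq.
    case: hin => [//|hin]. rewrite /= -/(except k l) IH //. ring.
Qed.

(** * Finite residue sums on a slit annulus *)

Section Residues.
Variables (q logq : C) (J : list nat) (a al : nat -> C) (sg : R) (g : C -> C).
Hypothesis hlogq : Cexp logq = q.
Hypothesis hq : (Cmod q < 1)%R.
Hypothesis hJ : NoDup J.
Hypothesis hal : forall j, Cexp (al j) = a j.
Hypothesis ha1 : forall j, In j J -> (Cmod (a j) < 1)%R.
Hypothesis hdist : forall j k m n, In j J -> In k J -> j <> k -> a j * q ^ m <> a k * q ^ n.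
Hypothesis hsg : sg = 0%R \/
  (sg = (/ 2)%R /\ Im logq = 0%R /\ forall j, In j J -> (- PI < Im (al j) < PI)%R).
Hypothesis hg : forall L, hol L g.

Definition integrand (z : C) : C :=
  (z - / z) * g z / Gprod J (fun j => qpoch (a j * z) q * qpoch (a j / z) q).

(** The symbol [(q^(-n); q)] without its vanishing factor of index [n]; it is what the factor
    [(a_k z; q)] leaves at the pole [z = 1/(a_k q^n)]. *)
Definition q_drop (n : nat) : C := Gprod (seq 0 n) (fun m => 1 - q ^ m / q ^ n) * qpoch q q.

(* Minus the residue of [exp (sg w) integrand (exp w)] at [w = - log (a_k q^n)]: the loop runs clockwise. *)
Definition residue (k n : nat) : C :=
  Cexp (sg * - (al k + INR n * logq)) * ((/ (a k * q ^ n) - a k * q ^ n) * g (/ (a k * q ^ n)))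
  / (Gprod J (fun j => qpoch (a j * (a k * q ^ n)) q)
     * Gprod (except k J) (fun j => qpoch (a j / (a k * q ^ n)) q) * q_drop n).

Lemma q_neq0 : q <> 0.
Proof. rewrite -hlogq. apply Cexp_neq0. Qed.

Lemma a_neq0 (j : nat) : a j <> 0.
Proof. rewrite -hal. apply Cexp_neq0. Qed.

Lemma aq_neq0 (j n : nat) : a j * q ^ n <> 0.
Proof. apply Cmult_neq_0; [apply a_neq0 | apply Cpow_nz, q_neq0]. Qed.

Lemma Cexp_log_pole (k n : nat) : Cexp (- (al k + INR n * logq)) = / (a k * q ^ n).
Proof. by rewrite Cexp_opp Cexp_plus hal Cexp_INR_mult hlogq. Qed.

Lemma Cmod_aq_lt1 (k n : nat) : In k J -> (Cmod (a k * q ^ n) < 1)%R.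
Proof.
  move=> hk. rewrite Cmod_mult Cmod_pow. have h1 := ha1 k hk. have h2 := Cmod_ge_0 (a k).
  have := Cmod_pow_le_1 q hq n. nra.
Qed.

Lemma q_pow_inj (m n : nat) : q ^ m = q ^ n -> m = n.
Proof.
  have H : forall m n, (m < n)%nat -> q ^ m <> q ^ n.
  { move=> {}m {}n hmn E. have hr : (0 < Cmod q)%R by apply Cmod_gt_0, q_neq0.
    have := f_equal Cmod E. rewrite !Cmod_pow. have -> : n = (m + S (n - m - 1))%nat by lia.
    rewrite pow_add. have h1 : (0 < Cmod q ^ m)%R by apply pow_lt.
    have h2 := Cmod_pow_le_1 q hq (n - m - 1). rewrite /=.
    have h3 : (Cmod q * Cmod q ^ (n - m - 1) < 1)%R by nra. nra. }
  move=> E. case: (Nat.lt_trichotomy m n) => [h|[h|h]] //; exfalso.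
  - by apply (H m n h). - by apply (H n m h).
Qed.

Lemma Cmod_inv_sub_lower (b z : C) : (Rabs (1 - Cmod b * Cmod z) <= Cmod (1 - b * z))%R.
Proof.
  rewrite -Cmod_mult. have h1 := Cmod_ge_minus 1 (b * z). have h2 := Cmod_ge_minus (b * z) 1.
  rewrite Cmod_minus_sym in h2. rewrite Cmod_1 in h1 h2. apply Rabs_le. lra.
Qed.

Lemma cut_lower (k n : nat) : In k J -> tau sg <> 0 ->
  exists c : R, (0 < c)%R /\ forall u : R, (c <= Cmod (1 - a k * q ^ n * - Cexp u))%R.
Proof.
  move=> hk ht. case: hsg => [h0|[h1 [h2 h3]]]; first by rewrite h0 tau_0 in ht.
  (* As [logq] is real, all [a_k q^n] lie on the ray of [a_k], which is not the negative axis. *)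
  have hw : (- PI < Im (al k + INR n * logq) < PI)%R.
  { rewrite im_plus. have -> : Im (INR n * logq) = 0%R by rewrite /Im /= -/(Im logq) h2; ring.
    have := h3 k hk. lra. }
  have [c [hc Hc]] := one_plus_ray_lower _ hw.
  exists c; split=> // u. have := Hc u.
  rewrite !Cexp_plus hal Cexp_INR_mult hlogq.
  have -> : 1 + Cexp u * (a k * q ^ n) = 1 - a k * q ^ n * - Cexp u by ring. done.
Qed.

Lemma loop_pole (L : R) (k n : nat) : (0 <= L)%R -> In k J -> (1 < Cmod (a k * q ^ n) * exp L)%R ->
  loop sg L (fun z => / (1 - a k * q ^ n * z)) (2 * PI * Ci * Cexp (sg * - (al k + INR n * logq))).
Proof.
  move=> hL hk hb. have hb0 := aq_neq0 k n. have hb1 := Cmod_aq_lt1 k n hk.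
  have hbp : (0 < Cmod (a k * q ^ n))%R by apply Cmod_gt_0.
  have hi : (1 < / Cmod (a k * q ^ n) < exp L)%R.
  { split.
    - rewrite -Rinv_1. apply Rinv_lt_contravar; lra.
    - apply Rmult_lt_reg_l with (Cmod (a k * q ^ n)) => //. rewrite Rinv_r; lra. }
  case: hsg => [h0|[h1 [h2 h3]]].
  - rewrite h0 Cmult_0_l Cexp_0 Cmult_1_r.
    apply (loop_kernel_0 L _ (/ (a k * q ^ n))) => //; first by field; split; [apply Cpow_nz, q_neq0 | apply a_neq0].
    by rewrite Cmod_inv.
  - set om := - (al k + INR n * logq).
    have E : Cexp (- om) = a k * q ^ n.
    { rewrite Cexp_opp Cexp_log_pole. field. split; [apply Cpow_nz, q_neq0 | apply a_neq0]. }
    have Er : exp (Re om) = (/ Cmod (a k * q ^ n))%R.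
    { rewrite -Cmod_Cexp Cexp_log_pole Cmod_inv //. }
    have Ei : Im om = (- Im (al k))%R.
    { rewrite /om im_opp im_plus. have -> : Im (INR n * logq) = 0%R by rewrite /Im /= -/(Im logq) h2; ring. ring. }
    have h3' := h3 k hk.
    have H := loop_kernel_half L om ltac:(split; apply exp_lt_inv; rewrite Er ?exp_0; lra) ltac:(lra).
    rewrite E in H. rewrite h1. have -> : (/ 2)%R * om = om / 2 by rewrite RtoC_inv; [rewrite /Cdiv; ring | lra].
    exact H.
Qed.

Lemma pole_lower (L : R) (k n : nat) : (0 <= L)%R -> In k J -> (1 < Cmod (a k * q ^ n) * exp L)%R ->
  exists c : R, (0 < c)%R /\ forall z, on_loop sg L z -> (c <= Cmod (1 - a k * q ^ n * z))%R.
Proof.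
  move=> hL hk hb. have hb1 := Cmod_aq_lt1 k n hk.
  set b := a k * q ^ n in hb hb1 |- *.
  set c1 := Rmin (1 - Cmod b) (Cmod b * exp L - 1).
  have hc1 : (0 < c1)%R by apply Rmin_pos; lra.
  have hc2 : (c1 <= 1 - Cmod b)%R by apply Rmin_l.
  have hc3 : (c1 <= Cmod b * exp L - 1)%R by apply Rmin_r.
  have Hcirc : forall z, Cmod z = 1%R \/ Cmod z = exp L -> (c1 <= Cmod (1 - b * z))%R.
  { move=> z hz. eapply Rle_trans; last apply Cmod_inv_sub_lower.
    case: hz => ->.
    - rewrite Rmult_1_r Rabs_pos_eq; lra.
    - rewrite Rabs_left; lra. }
  case: (Ceq_dec (tau sg) 0) => ht.
  - exists c1; split=> // z [hz|[hz|[ht' _]]] //; apply Hcirc; auto.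
  - have [c [hc Hc]] := cut_lower k n hk ht.
    exists (Rmin c1 c); split; first by apply Rmin_pos.
    move=> z [hz|[hz|[_ [u [hu ->]]]]].
    + eapply Rle_trans; first apply Rmin_l. apply Hcirc; auto.
    + eapply Rle_trans; first apply Rmin_l. apply Hcirc; auto.
    + eapply Rle_trans; first apply Rmin_r. apply Hc.
Qed.

Lemma q_drop_split (n N : nat) : (n < N)%nat ->
  Gprod (seq 0 N) (except_one nat Nat.eq_dec n (fun m => 1 - q ^ m / q ^ n)) * qpoch (q ^ (N - n)) q = q_drop n.
Proof.
  move=> hn. have hqn : q ^ n <> 0 by apply Cpow_nz, q_neq0.
  have -> : seq 0 N = seq 0 n ++ n :: seq (S n) (N - n - 1).
  { rewrite cons_seq. have -> : S (N - n - 1) = (N - n)%nat by lia.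
    have := seq_app n (N - n) 0. rewrite Nat.add_0_l => <-. f_equal; lia. }
  rewrite Gprod_app /q_drop -(Cmult_assoc (Gprod (seq 0 n) _)). f_equal.
  { apply Gprod_except_one_notin. rewrite in_seq. lia. }
  change (except_one nat Nat.eq_dec n (fun m => 1 - q ^ m / q ^ n) n *
    Gprod (seq (S n) (N - n - 1)) (except_one nat Nat.eq_dec n (fun m => 1 - q ^ m / q ^ n)) * qpoch (q ^ (N - n)) q = qpoch q q).
  rewrite {1}/except_one. case: Nat.eq_dec => // _. rewrite Cmult_1_l.
  rewrite Gprod_except_one_notin; last by rewrite in_seq; lia.
  rewrite (qpoch_split q hq (N - n - 1) q). f_equal.
  - rewrite /qpochn. have E : forall m i0, Gprod (seq (S n + i0) m) (fun m => 1 - q ^ m / q ^ n) = Gprod (seq i0 m) (fun k => 1 - q * q ^ k).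
    { elim=> [|m IH] i0 //.
      change ((1 - q ^ (S n + i0) / q ^ n) * Gprod (seq (S (S n + i0)) m) (fun m => 1 - q ^ m / q ^ n) =
        (1 - q * q ^ i0) * Gprod (seq (S i0) m) (fun k => 1 - q * q ^ k)).
      have -> : S (S n + i0) = (S n + S i0)%nat by lia.
      rewrite IH. f_equal. rewrite Cpow_add_r Cpow_S. field. done. }
    have := E (N - n - 1)%nat 0%nat. by rewrite Nat.add_0_r.
  - f_equal. rewrite -Cpow_S. f_equal. lia.
Qed.

(** [n k] counts the poles [1/(a_k q^m)] inside the outer circle and depends on [k]. Splitting off
    their factors leaves a part regular on the annulus, and partial fractions reduce the loop to one
    pole at a time. At least one pole must be inside, since the expansion has no empty case. *)
Lemma loop_integrand (L : R) (n : nat -> nat) : (0 <= L)%R ->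
  (forall k m, In k J -> (m < n k)%nat -> (1 < Cmod (a k * q ^ m) * exp L)%R) ->
  (forall k, In k J -> (Cmod (a k * q ^ n k) * exp L < 1)%R) ->
  (exists k, In k J /\ (0 < n k)%nat) ->
  loop sg L integrand (2 * PI * Ci * Csum J (fun k => Csum (seq 0 (n k)) (residue k))).
Proof.
  move=> hL hin hout [k0 [hk0 hn0]].
  set l := flat_map (fun k => map (fun m => (k, m)) (seq 0 (n k))) J.
  set b := fun x : nat * nat => a (fst x) * q ^ snd x.
  (* The symbols [(a_j / z; q)] have their zeros inside the unit circle and the shifted
     [(a_j q^(n j) z; q)] beyond the outer circle. *)
  set G := fun z => (z - / z) * g z * Gprod J (fun j => / qpoch (a j * / z) q)
    * Gprod J (fun j => / qpoch (a j * q ^ n j * z) q).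
  have hl : forall k m, In (k, m) l <-> In k J /\ (m < n k)%nat.
  { move=> k m. rewrite /l in_flat_map. split.
    - move=> [k' [h1 h2]]. apply in_map_iff in h2. move: h2 => [m' [E h2]]. case: E => <- <-.
      split=> //. apply in_seq in h2. lia.
    - move=> [h1 h2]. exists k; split=> //. apply in_map_iff. exists m; split=> //. apply in_seq. lia. }
  have hnd : NoDup l.
  { rewrite /l. elim: (J) (hJ) => [|k J' IH] hnd /=; first constructor.
    inversion hnd as [|k' J'' h1 h2 E1]; subst.
    apply NoDup_app.
    - apply FinFun.Injective_map_NoDup; last apply seq_NoDup. by move=> x y [].
    - by apply IH.
    - move=> [k' m] h3 h4. apply in_map_iff in h3. move: h3 => [m' [E _]]. case: E => E1 E2. subst.
      apply in_flat_map in h4. move: h4 => [k2 [h5 h6]]. apply in_map_iff in h6. move: h6 => [m' [E _]].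
      case: E => E1 E2. by subst. }
  have hGprod_l : forall F : nat * nat -> C, Gprod l F = Gprod J (fun k => Gprod (seq 0 (n k)) (fun m => F (k, m))).
  { move=> F. rewrite /l Gprod_flat_map. apply Gprod_ext => k _. by rewrite Gprod_map. }
  have hG : hol L G.
  { rewrite /G. apply hol_mult; first apply hol_mult; first apply hol_mult.
    - apply hol_minus; [apply hol_id | apply hol_inv].
    - apply hg.
    - apply hol_Gprod => j hj. apply (hol_inv_qpoch _ _ _ (Cmod (a j))) => //; first by apply ha1.
      + apply hol_mult; [apply hol_const | apply hol_inv].
      + move=> z hz. rewrite Cmod_mult. have := annulus_inv L z hz. have := Cmod_ge_0 (a j). nra.
    - apply hol_Gprod => j hj. apply (hol_inv_qpoch _ _ _ (Cmod (a j * q ^ n j) * exp L)) => //; first by apply hout.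
      + apply hol_mult; [apply hol_const | apply hol_id].
      + move=> z hz. rewrite Cmod_mult. apply Rmult_le_compat_l; [apply Cmod_ge_0 | apply hz]. }
  have hfac : forall z, integrand z = G z * / Gprod l (fun x => 1 - b x * z).
  { move=> z. rewrite /integrand /G hGprod_l /Cdiv -!Gprod_inv -!Cmult_assoc. do 2 f_equal.
    rewrite -!Gprod_mult. apply Gprod_ext => j _.
    rewrite (qpoch_split q hq (n j) (a j * z)) !Cinv_mult /qpochn.
    have -> : a j * z * q ^ n j = a j * q ^ n j * z by ring.
    have -> : Gprod (seq 0 (n j)) (fun k => 1 - a j * z * q ^ k) = Gprod (seq 0 (n j)) (fun m => 1 - b (j, m) * z).
    { apply Gprod_ext => m _. rewrite /b /=. ring. }
    ring. }
  have hb0 : forall x, b x <> 0 by move=> [k m]; apply aq_neq0.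
  have hbd : forall x y, In x l -> In y l -> x <> y -> b x <> b y.
  { move=> [k m] [j i] h1 h2 hne. apply hl in h1. apply hl in h2. rewrite /b /=.
    case: (Nat.eq_dec k j) => E.
    - subst j. move=> E. apply hne. f_equal. apply q_pow_inj.
      have h0 := a_neq0 k. transitivity (/ a k * (a k * q ^ m)); [by field | rewrite E; by field].
    - apply hdist; tauto. }
  have hpole : forall x, In x l -> loop sg L (fun z => G z / (1 - b x * z))
    (2 * PI * Ci * Cexp (sg * - (al (fst x) + INR (snd x) * logq)) * G (/ b x)).
  { move=> [k m] hx. have [hk hm] := proj1 (hl k m) hx.
    have hb := hin k m hk hm.
    have [c [hc Hc]] := pole_lower L k m hL hk hb.
    apply: (loop_hol_pole sg L (a k * q ^ m) (/ b (k, m)) _ hL _ (loop_pole L k m hL hk hb) _ c hc Hc _ G hG).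
    - apply Cinv_r. apply aq_neq0.
    - move=> z hz. apply Cmod_gt_0. have := Hc z hz. lra.
    - have h1 := Cmod_aq_lt1 k m hk. have h0 : (0 < Cmod (a k * q ^ m))%R by apply Cmod_gt_0, aq_neq0.
      rewrite /annulus /b /= Cmod_inv; last apply aq_neq0. split.
      + rewrite -Rinv_1. apply Rinv_le_contravar; lra.
      + apply Rlt_le, Rmult_lt_reg_l with (Cmod (a k * q ^ m)) => //. rewrite Rinv_r; lra. }
  have hne : forall z, on_loop sg L z -> forall x, In x l -> 1 - b x * z <> 0.
  { move=> z hz [k m] hx. have [hk hm] := proj1 (hl k m) hx.
    have [c [hc Hc]] := pole_lower L k m hL hk (hin k m hk hm).
    apply Cmod_gt_0. have := Hc z hz. rewrite /b /=. lra. }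
  have hlne : l <> nil.
  { move=> E. have : In (k0, 0%nat) l by apply hl. by rewrite E. }
  set D := fun x => Gprod l (except_one _ pair_eq_dec x (fun y => 1 - b y / b x)).
  have hsum := loop_Csum sg L l (fun x z => / D x * (G z / (1 - b x * z)))
    (fun x => / D x * (2 * PI * Ci * Cexp (sg * - (al (fst x) + INR (snd x) * logq)) * G (/ b x))) hL.
  have h0 : loop sg L (fun _ => 0) 0.
  { have := loop_scal sg L 0 _ _ hL (loop_zpow sg L 0 hL). rewrite Cmult_0_l.
    apply loop_ext => // z _. ring. }
  have {}hsum := hsum h0 (fun x hx => loop_scal sg L (/ D x) _ _ hL (hpole x hx)).
  have -> : 2 * PI * Ci * Csum J (fun k => Csum (seq 0 (n k)) (residue k)) =
    Csum l (fun x => / D x * (2 * PI * Ci * Cexp (sg * - (al (fst x) + INR (snd x) * logq)) * G (/ b x))).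
  { rewrite /l Csum_flat_map -Csum_scal. apply Csum_ext => k hk.
    rewrite Csum_map -Csum_scal. apply Csum_ext => m hm. apply in_seq in hm.
    have hkm : In (k, m) l by apply hl; split=> //; lia.
    have hb := aq_neq0 k m.
    rewrite [fst (k, m)]/= [snd (k, m)]/=.
    have hD : / D (k, m) = / Gprod (except k J) (fun j => qpochn (n j) (a j / (a k * q ^ m)) q) *
       / Gprod (seq 0 (n k)) (except_one nat Nat.eq_dec m (fun i => 1 - q ^ i / q ^ m)).
    { rewrite -Cinv_mult /D hGprod_l (Gprod_except k J _ hJ hk). f_equal. rewrite Cmult_comm. f_equal.
      - apply Gprod_ext => j hj. apply except_In in hj. rewrite /qpochn. apply Gprod_ext => i _.
        rewrite /except_one. case: pair_eq_dec => E; first by case: E => E _; case: hj.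
        rewrite /b /=. rewrite /Cdiv. ring.
      - apply Gprod_ext => i _. rewrite /except_one. case: pair_eq_dec => E; case: Nat.eq_dec => E' //.
        + by case: E.
        + by rewrite E' in E.
        + rewrite /b /=. have hqm : q ^ m <> 0 by apply Cpow_nz, q_neq0. have := a_neq0 k => hak.
          field. done. }
    rewrite hD /residue /G /b [fst (k, m)]/= [snd (k, m)]/=.
    have -> : / / (a k * q ^ m) = a k * q ^ m by field; split; [apply Cpow_nz, q_neq0 | apply a_neq0].
    rewrite (Gprod_except k J (fun j => / qpoch (a j * q ^ n j * / (a k * q ^ m)) q) hJ hk).
    have -> : a k * q ^ n k * / (a k * q ^ m) = q ^ (n k - m).
    { have -> : n k = (n k - m + m)%nat by lia. rewrite Cpow_add_r.
      have -> : (n k - m + m - m)%nat = (n k - m)%nat by lia.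
      field. split; [apply Cpow_nz, q_neq0 | apply a_neq0]. }
    rewrite -(q_drop_split m (n k)); last lia.
    have -> : Gprod (except k J) (fun j => qpoch (a j / (a k * q ^ m)) q) =
      Gprod (except k J) (fun j => qpochn (n j) (a j / (a k * q ^ m)) q) *
      Gprod (except k J) (fun j => qpoch (a j * q ^ n j * / (a k * q ^ m)) q).
    { rewrite -Gprod_mult. apply Gprod_ext => j _. rewrite (qpoch_split q hq (n j)). do 2 f_equal.
      rewrite /Cdiv; ring. }
    rewrite !Gprod_inv. rewrite /Cdiv !Cinv_mult. ring. }
  apply: (loop_ext _ _ _ _ _ hL _ hsum) => z hz.
  rewrite hfac (partial_fractions _ pair_eq_dec b l hnd hlne (fun x _ => hb0 x) hbd z (hne z hz)).
  rewrite -Csum_scal. apply Csum_ext => x _. rewrite -/(D x) /Cdiv. ring.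
Qed.

End Residues.

(** * Closing the contour at infinity *)

(** An open interval of length at most [l] meets each coset of [l Z] at most once, so cutting it at
    that point leaves an interval avoiding the coset; the induction keeps such an interval. The
    purpose is a radius whose multiples by powers of [1/|q|] meet no pole. *)
Lemma avoid_cosets (J : list nat) (la : nat -> R) (l : R) : (0 < l)%R ->
  exists x, (0 < x < l)%R /\ forall j (m : Z), In j J -> x <> (la j + IZR m * l)%R.
Proof.
  move=> hl.
  have [x0 [x1 [h1 [h2 [h3 H]]]]] : exists x0 x1, (0 <= x0)%R /\ (x0 < x1)%R /\ (x1 <= l)%R /\
    forall x j (m : Z), In j J -> (x0 < x < x1)%R -> x <> (la j + IZR m * l)%R.
  { elim: J => [|k J [x0 [x1 [h1 [h2 [h3 H]]]]]].
    - exists 0%R, l. repeat split; try lra. by move=> x j m [].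
    - case: (classic (exists m : Z, (x0 < la k + IZR m * l < x1)%R)) => [[m hm]|hno].
      + exists x0, (la k + IZR m * l)%R. repeat split; try lra.
        move=> x j m' [E|hj] hx; last by apply H; [exact hj | lra].
        subst j. move=> E. rewrite E in hx.
        have hlt : (IZR m' < IZR m)%R by nra.
        have hle : (IZR m' <= IZR (m - 1))%R by apply IZR_le; apply lt_IZR in hlt; lia.
        rewrite minus_IZR in hle. nra.
      + exists x0, x1. repeat split; try lra.
        move=> x j m [E|hj] hx; last by apply H.
        subst j. move=> E. apply hno. exists m. by rewrite -E. }
  exists ((x0 + x1) / 2)%R. split; first lra. move=> j m hj. apply H => //. lra.
Qed.

Lemma geometric_crossing (x r : R) : (0 < x)%R -> (0 < r < 1)%R -> (forall m, x * r ^ m <> 1)%R ->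
  exists N : nat, (forall m, (m < N)%nat -> (1 < x * r ^ m)%R) /\ (x * r ^ N < 1)%R.
Proof.
  move=> hx hr hne.
  have [M HM] : exists M, (x * r ^ M < 1)%R.
  { have [M HM] := geom_small x r (/ 2) ltac:(lra) ltac:(lra). exists M. have := HM M (Nat.le_refl M). lra. }
  elim: M HM => [|M IH] HM; first by exists 0%nat; split=> // m hm; lia.
  case: (Rlt_le_dec (x * r ^ M) 1) => h; first by apply IH.
  exists (S M). split=> // m hm.
  have h' : (1 < x * r ^ M)%R by have := hne M; lra.
  eapply Rlt_le_trans; first exact h'. apply Rmult_le_compat_l; first lra.
  have -> : M = (m + (M - m))%nat by lia. rewrite pow_add.
  have h1 : (0 < r ^ m)%R by apply pow_lt; lra.
  have h2 : (0 < r ^ (M - m) <= 1)%R.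
  { split; first by apply pow_lt; lra. rewrite -(pow1 (M - m)). apply pow_incr. lra. }
  nra.
Qed.

Lemma one_minus_geom_lower (x r : R) : (0 <= x)%R -> (0 <= r < 1)%R -> (forall k, x * r ^ k <> 1)%R ->
  exists c, (0 < c)%R /\ forall k, (c <= Rabs (1 - x * r ^ k))%R.
Proof.
  move=> hx hr hne.
  have [K HK] := geom_small x r (/ 2) hr ltac:(lra).
  have [c [hc Hc]] : exists c, (0 < c)%R /\ forall k, (k < K)%nat -> (c <= Rabs (1 - x * r ^ k))%R.
  { clear HK. elim: K => [|K [c [hc Hc]]]; first by exists 1%R; split; [lra | move=> k hk; lia].
    exists (Rmin c (Rabs (1 - x * r ^ K))). split.
    - apply Rmin_pos => //. apply Rabs_pos_lt. have := hne K. lra.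
    - move=> k hk. case: (Nat.eq_dec k K) => [->|hk']; first apply Rmin_r.
      eapply Rle_trans; first apply Rmin_l. apply Hc; lia. }
  exists (Rmin c (/ 2)). split; first by apply Rmin_pos; lra.
  move=> k. case: (Nat.lt_ge_cases k K) => hk.
  - eapply Rle_trans; first apply Rmin_l. by apply Hc.
  - eapply Rle_trans; first apply Rmin_r. have := HK k hk. have := Rle_abs (1 - x * r ^ k). lra.
Qed.

Lemma Gprod_bounded {T U} (l : list T) (P : U -> Prop) (F : T -> U -> C) :
  (forall x, In x l -> exists M, forall z, P z -> (Cmod (F x z) <= M)%R) ->
  exists M, (0 <= M)%R /\ forall z, P z -> (Cmod (Gprod l (fun x => F x z)) <= M)%R.
Proof.
  elim: l => [|x l IH] H.
  - exists 1%R. split; first lra. move=> z _. rewrite /= Cmod_1. lra.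
  - have [M1 H1] := H x (or_introl eq_refl).
    have [M2 [h2 H2]] := IH (fun y hy => H y (or_intror hy)).
    exists (Rabs M1 * M2)%R. split; first by apply Rmult_le_pos => //; apply Rabs_pos.
    move=> z hz. rewrite /= Cmod_mult. apply Rmult_le_compat; try apply Cmod_ge_0; last by apply H2.
    eapply Rle_trans; [by apply H1 | apply Rle_abs].
Qed.

Lemma theta_lower (q : C) (M c : R) : (Cmod q < 1)%R -> (0 < c)%R -> exists m, (0 < m)%R /\
  forall x, (Cmod x <= M)%R -> (Cmod (q / x) <= M)%R ->
    (forall k, (c <= Cmod (1 - x * q ^ k))%R) -> (forall k, (c <= Cmod (1 - q / x * q ^ k))%R) ->
    (m <= Cmod (theta x q))%R.
Proof.
  move=> hq hc. have [m [hm H]] := qpoch_lower q hq M c hc.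
  exists (m * m)%R. split; first nra. move=> x h1 h2 h3 h4.
  rewrite /theta Cmod_mult. apply Rmult_le_compat; try lra; by apply H.
Qed.

(** * Quasi-periodicity and decay of the integrand *)

Section Limit.
Variables (q logq : C) (J : list nat) (a al : nat -> C) (sg : R) (g : C -> C) (N : nat).
Hypothesis hlogq : Cexp logq = q.
Hypothesis hq : (Cmod q < 1)%R.
Hypothesis hJ : NoDup J.
Hypothesis hal : forall j, Cexp (al j) = a j.
Hypothesis ha1 : forall j, In j J -> (Cmod (a j) < 1)%R.
Hypothesis hdist : forall j k m n, In j J -> In k J -> j <> k -> a j * q ^ m <> a k * q ^ n.
Hypothesis hsg : sg = 0%R \/
  (sg = (/ 2)%R /\ Im logq = 0%R /\ forall j, In j J -> (- PI < Im (al j) < PI)%R).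
Hypothesis hg : forall L, hol L g.
Hypothesis hJN : length J = (2 * N)%nat.
Hypothesis hN : (0 < N)%nat.
Hypothesis hX : forall w, Cexp (sg * (w - logq)) * g (Cexp w / q) =
  Cexp (sg * w) * g (Cexp w) * (Cexp w ^ (2 * N) / q ^ N).

Let c : C := q ^ (N - 1) / Gprod J a.
Hypothesis hc : (Cmod c < 1)%R.

Let q0 : q <> 0 := q_neq0 q logq hlogq.
Let a0 (j : nat) : a j <> 0 := a_neq0 a al hal j.

Let r : R := Cmod q.

Let hr : (0 < r < 1)%R.
Proof. split; [by apply Cmod_gt_0 | done]. Qed.

(* The part of the integrand which is exactly quasi-periodic under [w -> w - log q]; the other factor
   [Bd] stays bounded at infinity. *)
Let Elt (w : C) : C :=
  Cexp w * (Cexp (sg * w) * g (Cexp w)) / Gprod J (fun j => theta (a j * Cexp w) q).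

Let Elt_step (w : C) : Elt (w - logq) = c * Elt w.
Proof.
  rewrite /Elt Cexp_minus hlogq hX. set z := Cexp w. have hz : z <> 0 by apply Cexp_neq0.
  have -> : Gprod J (fun j => theta (a j * (z / q)) q) =
    (z / q) ^ (2 * N) * Gprod J a * Gprod J (fun j => theta (a j * z) q).
  { have -> : (z / q) ^ (2 * N) = Gprod J (fun _ => - (z / q)).
    { rewrite Gprod_const hJN !Cpow_mult_r. f_equal. rewrite /=. ring. }
    rewrite -!Gprod_mult. apply Gprod_ext => j _.
    have -> : a j * (z / q) = a j * z / q by rewrite /Cdiv; ring.
    rewrite theta_div_p //; last by apply Cmult_neq_0.
    rewrite /Cdiv; ring. }
  rewrite /c /Cdiv !Cinv_mult Cpow_mult_l Cpow_inv // !Cinv_mult.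
  have hzN : z ^ (2 * N) <> 0 by apply Cpow_nz.
  have hqN : q ^ N <> 0 by apply Cpow_nz.
  have hqN' : q ^ (2 * N) = q * q ^ (N - 1) * q ^ N.
  { rewrite -Cpow_S -Cpow_add_r. f_equal. lia. }
  rewrite hqN'. have hq1 : q ^ (N - 1) <> 0 by apply Cpow_nz.
  move: (/ Gprod J (fun j => theta (a j * z) q)) (/ Gprod J a) => I A.
  field. by repeat split.
Qed.

Let Elt_iter (n : nat) (w : C) : Elt (w - INR n * logq) = c ^ n * Elt w.
Proof.
  elim: n => [|n IH].
  - rewrite /= Cmult_0_l. have -> : w - 0 = w by ring. ring.
  - rewrite S_INR RtoC_plus. have -> : w - (INR n + 1) * logq = w - INR n * logq - logq by ring.
    rewrite Elt_step IH /=. ring.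
Qed.

(** Completing [(a_j z; q)] to a theta function costs the factor [(q / (a_j z); q)]; what is left of
    [z - 1/z] after giving [z] to [Elt] is [1 - 1/z^2]. *)
Let Bd (z : C) : C := (1 - / z ^ 2) * Gprod J (fun j => qpoch (q / (a j * z)) q / qpoch (a j / z) q).

Let Bd_bounded : exists M, (0 <= M)%R /\ forall z, (1 <= Cmod z)%R -> (Cmod (Bd z) <= M)%R.
Proof.
  have hz0 : forall z, (1 <= Cmod z)%R -> z <> 0 by move=> z h E; rewrite E Cmod_0 in h; lra.
  have hzi : forall z, (1 <= Cmod z)%R -> (0 < / Cmod z <= 1)%R.
  { move=> z h. split; first by apply Rinv_0_lt_compat; lra. rewrite -Rinv_1. apply Rinv_le_contravar; lra. }
  destruct (Gprod_bounded J (fun z => (1 <= Cmod z)%R)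
    (fun j z => qpoch (q / (a j * z)) q / qpoch (a j / z) q)) as [M [hM HM]].
  { move=> j hj.
    have [K HK] := qpoch_ratio_bounded q hq (Cmod (q / a j)) (Cmod (a j)) (ha1 j hj).
    exists K => z hz. have hz1 := hzi z hz. apply HK.
    - have -> : q / (a j * z) = q / a j / z by rewrite /Cdiv Cinv_mult; ring.
      rewrite Cmod_div; last by apply hz0. have := Cmod_ge_0 (q / a j). rewrite /Rdiv. nra.
    - rewrite Cmod_div; last by apply hz0. have := Cmod_ge_0 (a j). rewrite /Rdiv. nra. }
  exists (2 * M)%R. split; first lra. move=> z hz. rewrite /Bd Cmod_mult.
  apply Rmult_le_compat; try apply Cmod_ge_0; last by apply HM.
  eapply Rle_trans; first apply Cmod_1_minus_le.
  rewrite Cmod_inv; last by apply Cpow_nz, hz0. rewrite Cmod_pow.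
  have h : (1 <= Cmod z ^ 2)%R by nra.
  have : (/ Cmod z ^ 2 <= 1)%R by rewrite -Rinv_1; apply Rinv_le_contravar; lra. lra.
Qed.

Let integrand_eq (w : C) : (forall j, In j J -> theta (a j * Cexp w) q <> 0) ->
  Cexp (sg * w) * integrand q J a g (Cexp w) = Bd (Cexp w) * Elt w.
Proof.
  move=> h. rewrite /integrand /Bd /Elt. set z := Cexp w. have hz : z <> 0 by apply Cexp_neq0.
  have -> : (1 - / z ^ 2) * Gprod J (fun j => qpoch (q / (a j * z)) q / qpoch (a j / z) q) *
    (z * (Cexp (sg * w) * g z) / Gprod J (fun j => theta (a j * z) q)) =
    (1 - / z ^ 2) * (z * (Cexp (sg * w) * g z)) *
    (Gprod J (fun j => qpoch (q / (a j * z)) q / qpoch (a j / z) q) / Gprod J (fun j => theta (a j * z) q))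
    by rewrite /Cdiv; ring.
  rewrite -Gprod_div.
  have -> : Gprod J (fun j => qpoch (q / (a j * z)) q / qpoch (a j / z) q / theta (a j * z) q) =
    / Gprod J (fun j => qpoch (a j * z) q * qpoch (a j / z) q); last first.
  - rewrite /Cdiv. move: (/ Gprod J _) => I. field. done.
  - rewrite -Gprod_inv. apply Gprod_ext => j hj. have := h j hj. rewrite /theta -/z => hth.
    have hT : qpoch (q / (a j * z)) q <> 0 by move=> E; apply hth; rewrite E; ring.
    rewrite /Cdiv !Cinv_mult. set X := / qpoch (a j * z) q. set Y := / qpoch (a j * / z) q.
    rewrite /Cdiv Cinv_mult in hT. set T := qpoch _ q. transitivity (X * Y * (T * / T)); first ring.
    rewrite Cinv_r //. ring.
Qed.

Let theta_shift (n : nat) (w : C) (j : nat) :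
  theta (a j * Cexp w) q <> 0 -> theta (a j * Cexp (w - INR n * logq)) q <> 0.
Proof.
  move=> h. elim: n => [|n IH].
  - rewrite /= Cmult_0_l. have -> : w - 0 = w by ring. done.
  - rewrite S_INR RtoC_plus. have -> : w - (INR n + 1) * logq = w - INR n * logq - logq by ring.
    rewrite Cexp_minus hlogq.
    have -> : a j * (Cexp (w - INR n * logq) / q) = a j * Cexp (w - INR n * logq) / q by rewrite /Cdiv; ring.
    have hz : a j * Cexp (w - INR n * logq) <> 0 by apply Cmult_neq_0; [done | apply Cexp_neq0].
    rewrite theta_div_p //. apply Cmult_neq_0 => //.
    have hz' : a j * Cexp (w - INR n * logq) / q <> 0 by apply Cmult_neq_0; [done | by apply Cinv_neq0].
    move=> E. apply hz'. transitivity (- - (a j * Cexp (w - INR n * logq) / q)); [ring | rewrite E; ring].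
Qed.

(** Applied to the circle of radius [exp L0] and to one period of the upper edge of the cut; all
    later circles and periods are reached by [Elt_iter]. The bound concerns [Re w] alone because
    [sg] is real and everything else depends on [Cexp w]. *)
Let Elt_bounded (P : C -> Prop) (L M d : R) : (0 < d)%R ->
  (forall w, P w -> annulus L (Cexp w) /\ (Rabs (Re w) <= M)%R /\
    forall j, In j J -> (forall k, (d <= Cmod (1 - a j * Cexp w * q ^ k))%R) /\
      (forall k, (d <= Cmod (1 - q / (a j * Cexp w) * q ^ k))%R)) ->
  exists C0, (0 <= C0)%R /\ forall w, P w ->
    (Cmod (Elt w) <= C0)%R /\ forall j, In j J -> theta (a j * Cexp w) q <> 0.
Proof.
  move=> hd H.
  have Hth : forall j, In j J -> exists m, (0 < m)%R /\ forall w, P w -> (m <= Cmod (theta (a j * Cexp w) q))%R.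
  { move=> j hj.
    have [m [hm Hm]] := theta_lower q (Rmax (Cmod (a j) * exp L) (Cmod (q / a j))) d hq hd.
    exists m; split=> // w hw. have [h1 [_ h2]] := H w hw. have [h3 h4] := h2 j hj.
    apply Hm => //.
    - eapply Rle_trans; last apply Rmax_l. rewrite Cmod_mult. apply Rmult_le_compat_l; [apply Cmod_ge_0 | apply h1].
    - eapply Rle_trans; last apply Rmax_r.
      have -> : q / (a j * Cexp w) = q / a j * / Cexp w by rewrite /Cdiv Cinv_mult; ring.
      rewrite Cmod_mult. have := annulus_inv L _ h1. have := Cmod_ge_0 (q / a j). nra. }
  have [M1 [hM1 HM1]] := hol_bounded L g (hg L).
  destruct (Gprod_bounded J P (fun j w => / theta (a j * Cexp w) q)) as [M2 [hM2 HM2]].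
  { move=> j hj. have [m [hm Hm]] := Hth j hj. exists (/ m)%R => w hw.
    have h := Hm w hw. rewrite Cmod_inv; last by apply Cmod_gt_0; lra. apply Rinv_le_contravar; lra. }
  exists (exp M * (exp (Rabs sg * M) * M1) * M2)%R. split.
  { have h1 := exp_pos M. have h2 := exp_pos (Rabs sg * M). apply Rmult_le_pos => //. apply Rmult_le_pos; nra. }
  move=> w hw. have [h1 [h2 h3]] := H w hw. split; last first.
  { move=> j hj. have [m [hm Hm]] := Hth j hj. apply Cmod_gt_0. have := Hm w hw. lra. }
  rewrite /Elt /Cdiv -Gprod_inv !Cmod_mult !Cmod_Cexp.
  have e1 : (exp (Re w) <= exp M)%R.
  { apply exp_le. have := Rle_abs (Re w); lra. }
  have e2 : (exp (Re (sg * w)) <= exp (Rabs sg * M))%R.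
  { apply exp_le. have -> : Re (sg * w) = (sg * Re w)%R by rewrite /Re /=; ring.
    eapply Rle_trans; first apply Rle_abs. rewrite Rabs_mult. apply Rmult_le_compat_l => //. apply Rabs_pos. }
  have p1 := exp_pos (Re w). have p2 := exp_pos (Re (sg * w)).
  have p3 := Cmod_ge_0 (g (Cexp w)). have b1 := HM1 _ h1. have b2 := HM2 w hw.
  have p4 := Cmod_ge_0 (Gprod J (fun x => / theta (a x * Cexp w) q)).
  apply Rmult_le_compat => //; first by apply Rmult_le_pos; [lra | apply Rmult_le_pos; lra].
  apply Rmult_le_compat => //; first lra; first by apply Rmult_le_pos; lra.
  apply Rmult_le_compat => //; lra.
Qed.

Let uniform_j (P : nat -> R -> Prop) : (forall j c c', P j c -> (0 < c' <= c)%R -> P j c') ->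
  (forall j, In j J -> exists c, (0 < c)%R /\ P j c) -> exists c, (0 < c)%R /\ forall j, In j J -> P j c.
Proof.
  move=> hmon. elim: J => [|j l IH] H; first by exists 1%R; split; [lra | move=> j []].
  have [c1 [h1 H1]] := H j (or_introl eq_refl).
  have [c2 [h2 H2]] := IH (fun k hk => H k (or_intror hk)).
  have hm : (0 < Rmin c1 c2)%R by apply Rmin_pos.
  exists (Rmin c1 c2); split=> // k [<-|hk].
  - apply (hmon _ c1) => //. split => //. apply Rmin_l.
  - apply (hmon _ c2); first by apply H2. split => //. apply Rmin_r.
Qed.

Let ell : R := (- Re logq)%R.

Let exp_ell : exp ell = (/ r)%R.
Proof. rewrite /ell exp_Ropp /r -hlogq Cmod_Cexp. done. Qed.

Let ell_pos : (0 < ell)%R.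
Proof.
  apply exp_lt_inv. rewrite exp_0 exp_ell -{1}Rinv_1. apply Rinv_lt_contravar; lra.
Qed.

Let exp_n_ell (n : nat) : exp (INR n * ell) = (/ r ^ n)%R.
Proof.
  elim: n => [|n IH]; first by rewrite Rmult_0_l exp_0 /= Rinv_1.
  rewrite S_INR Rmult_plus_distr_r Rmult_1_l exp_plus IH exp_ell /=. field. split; [apply pow_nonzero |]; lra.
Qed.

Section Radius.
Variable L0 : R.
Hypothesis hL0 : (0 < L0 < ell)%R.
Hypothesis hL0' : forall j (m : Z), In j J -> L0 <> (- Re (al j) + IZR m * ell)%R.

Let Ln (n : nat) : R := (L0 + INR n * ell)%R.

Let Cmod_aq (j m : nat) : Cmod (a j * q ^ m) = exp (Re (al j) - INR m * ell).
Proof.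
  rewrite Cmod_mult Cmod_pow -hal Cmod_Cexp /Rminus exp_plus exp_Ropp exp_n_ell Rinv_inv. done.
Qed.

Let Ln_avoid (n j m : nat) : In j J -> (Cmod (a j * q ^ m) * exp (Ln n) <> 1)%R.
Proof.
  move=> hj. rewrite Cmod_aq -exp_plus -exp_0 => E. apply exp_inv in E.
  apply (hL0' j (Z.of_nat m - Z.of_nat n)%Z hj).
  rewrite minus_IZR -!INR_IZR_INZ. rewrite /Ln in E. lra.
Qed.

Let circle_decay : exists C0, (0 <= C0)%R /\ forall (n : nat) (t : R),
  (Cmod (Ci * (Cexp (sg * (Ln n + t * Ci)) * integrand q J a g (Cexp (Ln n + t * Ci)))) <= C0 * Cmod c ^ n)%R.
Proof.
  destruct (uniform_j (fun j d => (forall k, (d <= Rabs (1 - Cmod (a j) * exp L0 * r ^ k))%R) /\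
      (forall k, (d <= Rabs (1 - r / (Cmod (a j) * exp L0) * r ^ k))%R))) as [d [hd Hd]].
  { move=> j d1 d2 [h1 h2] h. split=> k; [have := h1 k | have := h2 k]; lra. }
  { move=> j hj. have hE := exp_pos L0. have hA : (0 < Cmod (a j))%R by apply Cmod_gt_0.
    have hAE : (0 < Cmod (a j) * exp L0)%R by apply Rmult_lt_0_compat.
    have [d1 [hd1 Hd1]] := one_minus_geom_lower (Cmod (a j) * exp L0) r ltac:(lra) ltac:(lra)
      ltac:(move=> k E; apply (Ln_avoid 0 j k hj); rewrite Cmod_mult Cmod_pow /Ln -/r Rmult_0_l Rplus_0_r -E; ring).
    (* The zeros of the second symbol of theta belong to the same coset, with negative index. *)
    have hneg : forall k, (r / (Cmod (a j) * exp L0) * r ^ k <> 1)%R.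
    { move=> k E.
      apply (hL0' j (- Z.of_nat (S k))%Z hj). apply exp_inv.
      rewrite opp_IZR -INR_IZR_INZ exp_plus Ropp_mult_distr_l_reverse !exp_Ropp exp_n_ell Rinv_inv.
      have -> : exp (Re (al j)) = Cmod (a j) by rewrite -hal Cmod_Cexp.
      apply Rmult_eq_reg_l with (Cmod (a j)); last lra.
      transitivity (Cmod (a j) * exp L0 * (r / (Cmod (a j) * exp L0) * r ^ k))%R.
      - rewrite E; ring.
      - rewrite /=. field. lra. }
    have [d2 [hd2 Hd2]] := one_minus_geom_lower (r / (Cmod (a j) * exp L0)) r
      ltac:(apply Rlt_le, Rdiv_lt_0_compat; lra) ltac:(lra) hneg.
    exists (Rmin d1 d2). split; first by apply Rmin_pos.
    split=> k; [eapply Rle_trans; [apply Rmin_l | apply Hd1] | eapply Rle_trans; [apply Rmin_r | apply Hd2]]. }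
  destruct (Elt_bounded (fun w => Re w = L0) L0 L0 d hd) as [C1 [hC1 HC1]].
  { move=> w hw. have hmod : Cmod (Cexp w) = exp L0 by rewrite Cmod_Cexp hw.
    split; last split.
    - rewrite /annulus hmod. split; last lra. rewrite -exp_0. apply exp_le; lra.
    - rewrite hw Rabs_pos_eq; lra.
    - move=> j hj. have [h1 h2] := Hd j hj. split=> k.
      + eapply Rle_trans; first apply (h1 k).
        have := Cmod_inv_sub_lower (a j * Cexp w) (q ^ k). by rewrite Cmod_mult Cmod_pow hmod.
      + eapply Rle_trans; first apply (h2 k).
        have := Cmod_inv_sub_lower (q / (a j * Cexp w)) (q ^ k).
        rewrite Cmod_div; last by apply Cmult_neq_0; [done | apply Cexp_neq0].
        by rewrite Cmod_mult Cmod_pow hmod. }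
  have [C2 [hC2 HC2]] := Bd_bounded.
  exists (C2 * C1)%R. split; first nra.
  move=> n t.
  (* For complex [logq] a step also rotates the circle; this shift of the imaginary part compensates
     and keeps [w0] on the line [Re w = L0]. *)
  set w0 := L0 + (t + INR n * Im logq) * Ci.
  have Ew : Ln n + t * Ci = w0 - INR n * logq.
  { rewrite /w0 /Ln /ell. apply: injective_projections; rewrite /Re /Im /=; ring. }
  have hw0 : Re w0 = L0 by rewrite /w0 /Re /=; ring.
  have [h1 h2] := HC1 w0 hw0.
  have hth : forall j, In j J -> theta (a j * Cexp (w0 - INR n * logq)) q <> 0.
  { move=> j hj. by apply theta_shift, h2. }
  rewrite Ew integrand_eq // Elt_iter (Cmod_mult Ci) (Cmod_mult (Bd _)) (Cmod_mult (c ^ n)) Cmod_Ci Rmult_1_l (Cmod_pow c).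
  have hz1 : (1 <= Cmod (Cexp (w0 - INR n * logq)))%R.
  { rewrite -Ew Cmod_Cexp_line -exp_0 /Ln. have := pos_INR n => hn.
    apply exp_le. nra. }
  have h3 := HC2 _ hz1. have p1 := Cmod_ge_0 (Bd (Cexp (w0 - INR n * logq))). have p2 := Cmod_ge_0 (Elt w0).
  have p3 := pow_le (Cmod c) n (Cmod_ge_0 c).
  have -> : (C2 * C1 * Cmod c ^ n = C2 * (Cmod c ^ n * C1))%R by ring.
  apply Rmult_le_compat => //; first by apply Rmult_le_pos. by apply Rmult_le_compat_l.
Qed.

Let cut_decay : exists C0, (0 <= C0)%R /\ forall (n : nat) (u : R), (Ln n <= u <= Ln (S n))%R ->
  (Cmod (tau sg * (Cexp (sg * u) * integrand q J a g (- Cexp u))) <= C0 * Cmod c ^ n)%R.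
Proof.
  have hcn : forall n, (0 <= Cmod c ^ n)%R by move=> n; apply pow_le, Cmod_ge_0.
  case: (Ceq_dec (tau sg) 0) => [ht|ht].
  { exists 0%R. split; first lra. move=> n u _. rewrite ht Cmult_0_l Cmod_0. have := hcn n; lra. }
  case: hsg => [h0|[h1 [h2 h3]]]; first by rewrite h0 tau_0 in ht.
  (* A real [logq] makes each step go along the edge, so that one period represents all of it. *)
  have hlq : logq = RtoC (Re logq) by apply: injective_projections; rewrite /= -?/(Im logq) ?h2.
  (* The bounds for [al j] and [- al j] serve the two symbols of [theta (a_j z)], whose arguments
     are [a_j z] and [q / (a_j z)]. *)
  destruct (uniform_j (fun j d => forall u : R, (d <= Cmod (1 + Cexp (u + al j)))%R /\
    (d <= Cmod (1 + Cexp (u + - al j)))%R)) as [d [hd Hd]].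
  { move=> j d1 d2 H h u. have [] := H u. lra. }
  { move=> j hj. have h3' := h3 j hj.
    have [d1 [hd1 H1]] := one_plus_ray_lower (al j) h3'.
    have [d2 [hd2 H2]] := one_plus_ray_lower (- al j) ltac:(rewrite im_opp; lra).
    exists (Rmin d1 d2). split; first by apply Rmin_pos.
    move=> u; split; [eapply Rle_trans; [apply Rmin_l | apply H1] | eapply Rle_trans; [apply Rmin_r | apply H2]]. }
  destruct (Elt_bounded (fun w => exists u : R, (L0 <= u <= L0 + ell)%R /\ w = u + PI * Ci)
    (L0 + ell) (L0 + ell) d hd) as [C1 [hC1 HC1]].
  { move=> w [u [hu ->]].
    have hre : Re (u + PI * Ci) = u by rewrite /Re /=; ring.
    split; last split.
    - rewrite /annulus Cmod_Cexp hre -exp_0. split; first by apply exp_le; lra.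
      apply exp_le; lra.
    - rewrite hre Rabs_pos_eq; lra.
    - move=> j hj. have Hj := Hd j hj. rewrite Cexp_add_PI. split=> k.
      + have [H _] := Hj (u + INR k * Re logq)%R.
        have -> : 1 - a j * - Cexp u * q ^ k = 1 + Cexp ((u + INR k * Re logq)%R + al j); last done.
        rewrite RtoC_plus RtoC_mult -hlq !Cexp_plus Cexp_INR_mult hlogq hal. ring.
      + have [_ H] := Hj (- u + INR (S k) * Re logq)%R.
        have -> : 1 - q / (a j * - Cexp u) * q ^ k = 1 + Cexp ((- u + INR (S k) * Re logq)%R + - al j); last done.
        rewrite RtoC_plus RtoC_opp RtoC_mult -hlq !Cexp_plus Cexp_INR_mult !Cexp_opp hlogq hal Cpow_S.
        have hu0 := Cexp_neq0 u. have haj := a0 j. field. done. }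
  have [C2 [hC2 HC2]] := Bd_bounded.
  exists (Cmod (tau sg) * (C2 * C1))%R. split; first by apply Rmult_le_pos; [apply Cmod_ge_0 | nra].
  move=> n u hu.
  set u0 := (u - INR n * ell)%R.
  have hu0 : (L0 <= u0 <= L0 + ell)%R.
  { rewrite /u0. rewrite /Ln S_INR in hu. lra. }
  set w0 := u0 + PI * Ci.
  have Ew : u + PI * Ci = w0 - INR n * logq.
  { rewrite /w0 /u0 /ell hlq. apply: injective_projections; rewrite /Re /Im /=; ring. }
  have [h4 h5] := HC1 w0 (ex_intro _ u0 (conj hu0 eq_refl)).
  have hth : forall j, In j J -> theta (a j * Cexp (w0 - INR n * logq)) q <> 0.
  { move=> j hj. by apply theta_shift, h5. }
  have hz1 : (1 <= Cmod (Cexp (w0 - INR n * logq)))%R.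
  { rewrite -Ew Cmod_Cexp_line -exp_0. rewrite /Ln in hu. have := pos_INR n => hn.
    apply exp_le. nra. }
  have K := integrand_eq _ hth.
  have K2 := f_equal Cmod K. rewrite Elt_iter (Cmod_mult (Bd _)) (Cmod_mult (c ^ n)) (Cmod_pow c) in K2.
  rewrite (Cmod_mult (tau sg)) Rmult_assoc. apply Rmult_le_compat_l; first apply Cmod_ge_0.
  (* The cut integrand and the one on the upper edge differ by [exp (sg i pi)], of modulus [1]. *)
  have -> : Cmod (Cexp (sg * u) * integrand q J a g (- Cexp u)) =
    Cmod (Cexp (sg * (w0 - INR n * logq)) * integrand q J a g (Cexp (w0 - INR n * logq))).
  { rewrite -Ew Cexp_add_PI !Cmod_mult. f_equal. rewrite !Cmod_Cexp. f_equal. rewrite /Re /=; ring. }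
  rewrite K2.
  have h6 := HC2 _ hz1. have p1 := Cmod_ge_0 (Bd (Cexp (w0 - INR n * logq))). have p2 := Cmod_ge_0 (Elt w0).
  have p3 := hcn n.
  have -> : (C2 * C1 * Cmod c ^ n = C2 * (Cmod c ^ n * C1))%R by ring.
  apply Rmult_le_compat => //; first by apply Rmult_le_pos. by apply Rmult_le_compat_l.
Qed.

Let Ln_pos (n : nat) : (0 < Ln n)%R.
Proof. rewrite /Ln. have := pos_INR n. nra. Qed.

Let pole_count (n : nat) : exists M : nat -> nat, forall k, In k J ->
  (forall m, (m < M k)%nat -> (1 < Cmod (a k * q ^ m) * exp (Ln n))%R) /\
  (Cmod (a k * q ^ M k) * exp (Ln n) < 1)%R.
Proof.
  have H : forall k, exists M : nat, In k J -> (forall m, (m < M)%nat -> (1 < Cmod (a k * q ^ m) * exp (Ln n))%R) /\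
    (Cmod (a k * q ^ M) * exp (Ln n) < 1)%R.
  { move=> k. case: (classic (In k J)) => hk; last by exists 0%nat.
    have E : forall m, (Cmod (a k * q ^ m) * exp (Ln n) = Cmod (a k) * exp (Ln n) * r ^ m)%R.
    { move=> m. rewrite Cmod_mult Cmod_pow /r. ring. }
    have [M [h1 h2]] := geometric_crossing (Cmod (a k) * exp (Ln n)) r
      ltac:(apply Rmult_lt_0_compat; [by apply Cmod_gt_0 | apply exp_pos]) ltac:(lra)
      ltac:(move=> m; rewrite -E; by apply Ln_avoid).
    exists M => _. split; last by rewrite E. move=> m hm. rewrite E. by apply h1. }
  exists (fun k => proj1_sig (constructive_indefinite_description _ (H k))) => k hk.
  exact (proj2_sig (constructive_indefinite_description _ (H k)) hk).
Qed.

(** The circles give the limit only along the radii [exp (Ln n)]; in between, the cut integral moves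
    by a geometrically small amount, so [L] may tend to infinity freely, as the improper integrals
    of the tails require. *)
Lemma hankel_limit_aux (S : nat -> C) :
  (forall k, In k J -> Clim (fun n => Csum (seq 0 n) (residue q logq J a al sg g k)) (S k)) ->
  exists v0 (vt : R -> C), circ sg 0 (integrand q J a g) v0 /\
    (forall L, (0 <= L)%R -> cut sg L (integrand q J a g) (vt L)) /\
    (forall eps, (0 < eps)%R -> exists L1, forall L, (L1 <= L)%R ->
       (Cmod (v0 + vt L - 2 * PI * Ci * Csum J S) < eps)%R).
Proof.
  move=> hS.
  set M := fun n => proj1_sig (constructive_indefinite_description _ (pole_count n)).
  have HM : forall n k, In k J -> (forall m, (m < M n k)%nat -> (1 < Cmod (a k * q ^ m) * exp (Ln n))%R) /\
    (Cmod (a k * q ^ M n k) * exp (Ln n) < 1)%R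
    := fun n => proj2_sig (constructive_indefinite_description _ (pole_count n)).
  clearbody M.
  have hMinf : forall k, In k J -> forall m, exists n0, forall n, (n0 <= n)%nat -> (m <= M n k)%nat.
  { move=> k hk m. have hak : (0 < Cmod (a k * q ^ m))%R by apply Cmod_gt_0, Cmult_neq_0; [done | by apply Cpow_nz].
    have hE := exp_pos L0.
    have [n0 Hn0] := geom_small (/ (Cmod (a k * q ^ m) * exp L0)) r 1 ltac:(lra) ltac:(lra).
    exists n0 => n hn. case: (Nat.le_gt_cases m (M n k)) => // hlt. exfalso.
    have [_ h] := HM n k hk. have hb := Hn0 n hn.
    have hp : (0 < r ^ n)%R by apply pow_lt; lra.
    have hexp : exp (Ln n) = (exp L0 / r ^ n)%R by rewrite /Ln exp_plus exp_n_ell.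
    have h2 : (Cmod (a k * q ^ m) <= Cmod (a k * q ^ M n k))%R.
    { have -> : m = (M n k + (m - M n k))%nat by lia. rewrite Cpow_add_r Cmult_assoc (Cmod_mult (a k * _)).
      rewrite Cmod_pow. have := Cmod_pow_le_1 q hq (m - M n k). have := Cmod_ge_0 (a k * q ^ M n k). nra. }
    have h3 : (Cmod (a k * q ^ m) * exp (Ln n) < 1)%R by have := exp_pos (Ln n); nra.
    rewrite hexp in h3.
    have h4 : (Cmod (a k * q ^ m) * exp L0 < r ^ n)%R.
    { apply Rmult_lt_reg_r with (/ r ^ n)%R; first by apply Rinv_0_lt_compat.
      rewrite Rinv_r; last lra. rewrite /Rdiv in h3. lra. }
    have h5 : (r ^ n <= Cmod (a k * q ^ m) * exp L0)%R.
    { have hpp : (0 < Cmod (a k * q ^ m) * exp L0)%R by nra.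
      apply Rmult_le_reg_l with (/ (Cmod (a k * q ^ m) * exp L0))%R; first by apply Rinv_0_lt_compat.
      rewrite Rinv_l; lra. }
    lra. }
  have [k0 hk0] : exists k, In k J.
  { move: hJN. case: (J) => [|k l] /=; [lia | by exists k; left]. }
  have [n1 Hn1] := hMinf k0 hk0 1%nat.
  have Hloop : forall n, (n1 <= n)%nat -> loop sg (Ln n) (integrand q J a g)
    (2 * PI * Ci * Csum J (fun k => Csum (seq 0 (M n k)) (residue q logq J a al sg g k))).
  { move=> n hn. apply (loop_integrand q logq J a al sg g) => //.
    - apply Rlt_le, Ln_pos.
    - move=> k m hk. apply (HM n k hk).
    - move=> k hk. apply (HM n k hk).
    - exists k0; split=> //. have := Hn1 n hn. lia. }
  have HV : Clim (fun n => 2 * PI * Ci * Csum J (fun k => Csum (seq 0 (M n k)) (residue q logq J a al sg g k)))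
    (2 * PI * Ci * Csum J S).
  { apply Clim_scal. apply (Clim_Csum J (fun n k => Csum (seq 0 (M n k)) (residue q logq J a al sg g k))) => k hk.
    apply (Clim_subseq (fun n => Csum (seq 0 n) (residue q logq J a al sg g k)) (S k) (fun n => M n k)); first by apply hS.
    by apply hMinf. }
  set V := 2 * PI * Ci * Csum J S in HV |- *.
  set Vn := fun n => 2 * PI * Ci * Csum J _ in HV, Hloop.
  have [v0 [_ [_ [hv0 _]]]] := Hloop n1 (Nat.le_refl _).
  have [CR [hCR HCR]] := circle_decay. have [CT [hCT HCT]] := cut_decay.
  (* A cut integral up to any [L] is the restriction of one belonging to a longer loop. *)
  have Hcut : forall L, (0 <= L)%R -> exists vt, cut sg L (integrand q J a g) vt.
  { move=> L hL.
    have [n2 Hn2] : exists n, (L <= Ln n)%R.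
    { have [n Hn] := INR_unbounded (L / ell). exists n. rewrite /Ln.
      have : (L / ell * ell < INR n * ell)%R by apply Rmult_lt_compat_r.
      have -> : (L / ell * ell = L)%R by field; lra. lra. }
    have hmon : (Ln n2 <= Ln (n1 + n2))%R.
    { rewrite /Ln plus_INR. have := pos_INR n1. nra. }
    have [_ [_ [vt [_ [_ [hvt _]]]]]] := Hloop (n1 + n2)%nat ltac:(lia).
    have [v hv] := ex_RInt_Chasles_1 (V := C_R_CompleteNormedModule) _ 0 L (Ln (n1 + n2)) ltac:(lra) (ex_intro _ vt hvt).
    by exists v. }
  set vt := fun L => match Rle_dec 0 L with
    | left h => proj1_sig (constructive_indefinite_description _ (Hcut L h)) | right _ => 0 end.
  have Hvt : forall L, (0 <= L)%R -> cut sg L (integrand q J a g) (vt L).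
  { move=> L hL. rewrite /vt. case: Rle_dec => // h.
    exact (proj2_sig (constructive_indefinite_description _ (Hcut L h))). }
  clearbody vt. exists v0, vt. split=> //. split=> //.
  (* What separates [v0 + vt] from the finite residue sum is exactly the outer circle. *)
  have Hn : forall n, (n1 <= n)%nat -> (Cmod (v0 + vt (Ln n) - Vn n) <= CR * Cmod c ^ n * (PI - - PI))%R.
  { move=> n hn. have [w0 [wL [wt [h1 [h2 [h3 E]]]]]] := Hloop n hn.
    change (Vn n = w0 - wL + wt) in E. rewrite E (CInt_unique _ _ _ _ _ h1 hv0) (CInt_unique _ _ _ _ _ h3 (Hvt (Ln n) (Rlt_le _ _ (Ln_pos n)))).
    have -> : v0 + vt (Ln n) - (v0 - wL + vt (Ln n)) = wL by ring.
    apply: (CInt_bound _ _ _ _ _ PI_le _ h2) => t _. apply HCR. }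
  have Hstep : forall n L, (Ln n <= L <= Ln ((Datatypes.S n)))%R -> (Cmod (vt L - vt (Ln n)) <= CT * Cmod c ^ n * ell)%R.
  { move=> n L hL. have hp := Ln_pos n.
    have [v hv] := ex_RInt_Chasles_2 (V := C_R_CompleteNormedModule) _ 0 (Ln n) L ltac:(lra) (ex_intro _ (vt L) (Hvt L ltac:(lra))).
    have E : vt L = vt (Ln n) + v.
    { apply: (CInt_unique _ _ _ _ _ (Hvt L ltac:(lra))).
      exact: (is_RInt_Chasles (V := C_R_CompleteNormedModule) _ _ _ _ _ _ (Hvt (Ln n) ltac:(lra)) hv). }
    have -> : vt L - vt (Ln n) = v by rewrite E; ring.
    have hb : forall t, (Ln n <= t <= L)%R ->
      (Cmod (tau sg * (Cexp (sg * t) * integrand q J a g (- Cexp t))) <= CT * Cmod c ^ n)%R.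
    { move=> t ht. apply HCT. split; [apply ht | lra]. }
    have B := CInt_bound _ (Ln n) L (CT * Cmod c ^ n) v (proj1 hL) hb hv.
    eapply Rle_trans; first exact B. apply Rmult_le_compat_l; first by apply Rmult_le_pos => //; apply pow_le, Cmod_ge_0.
    have E2 : Ln (Datatypes.S n) = (Ln n + ell)%R by rewrite /Ln S_INR; ring.
    rewrite E2 in hL. lra. }
  move=> eps he.
  have hPI := PI_RGT_0.
  have [m1 Hm1] := HV (eps / 3)%R ltac:(lra).
  have [m2 Hm2] := geom_small (CR * (PI - - PI)) (Cmod c) (eps / 4) (conj (Cmod_ge_0 c) hc) ltac:(lra).
  have [m3 Hm3] := geom_small (CT * ell) (Cmod c) (eps / 4) (conj (Cmod_ge_0 c) hc) ltac:(lra).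
  exists (Ln (n1 + m1 + m2 + m3)) => L hL.
  have hx : (0 <= (L - L0) / ell)%R.
  { apply Rmult_le_pos; last by apply Rlt_le, Rinv_0_lt_compat.
    rewrite /Ln in hL. have := pos_INR (n1 + m1 + m2 + m3). nra. }
  (* The last circle within radius [exp L]. *)
  have [n [hn1 hn2]] := nfloor_ex _ hx.
  have hx' : ((L - L0) / ell * ell = L - L0)%R by field; lra.
  have hLn : (Ln n <= L <= Ln (Datatypes.S n))%R.
  { rewrite /Ln S_INR. split; nra. }
  have hn : (n1 + m1 + m2 + m3 <= n)%nat.
  { apply Nat.lt_succ_r. apply INR_lt. rewrite S_INR.
    rewrite /Ln in hL. apply Rmult_lt_reg_r with ell => //. nra. }
  have A1 := Hm1 n ltac:(lia). have A2 := Hm2 n ltac:(lia). have A3 := Hm3 n ltac:(lia).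
  have B1 := Hn n ltac:(lia). have B2 := Hstep n L hLn.
  have -> : v0 + vt L - V = (vt L - vt (Ln n)) + ((v0 + vt (Ln n) - Vn n) + (Vn n - V)) by ring.
  eapply Rle_lt_trans; first apply Cmod_triangle.
  have := Cmod_triangle (v0 + vt (Ln n) - Vn n) (Vn n - V).
  lra.
Qed.

End Radius.

Lemma hankel_limit (S : nat -> C) :
  (forall k, In k J -> Clim (fun n => Csum (seq 0 n) (residue q logq J a al sg g k)) (S k)) ->
  exists v0 (vt : R -> C), circ sg 0 (integrand q J a g) v0 /\
    (forall L, (0 <= L)%R -> cut sg L (integrand q J a g) (vt L)) /\
    (forall eps, (0 < eps)%R -> exists L1, forall L, (L1 <= L)%R ->
       (Cmod (v0 + vt L - 2 * PI * Ci * Csum J S) < eps)%R).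
Proof.
  have [L0 [h1 h2]] := avoid_cosets J (fun j => (- Re (al j))%R) ell ell_pos.
  exact: (hankel_limit_aux L0 h1 (fun j m => h2 j m) S).
Qed.

End Limit.

(** * Jackson integrals *)

Lemma sum_n_m_Csum (f : nat -> C) (m n : nat) : sum_n_m f m (m + n) = Csum (seq m (S n)) f.
Proof.
  elim: n m => [|n IH] m; first by rewrite Nat.add_0_r sum_n_n /Csum /=; ring.
  rewrite sum_Sn_m; last lia. rewrite -Nat.add_succ_comm IH. done.
Qed.

Lemma Gprod_Cexp {T} (l : list T) (f : T -> C) : Gprod l (fun x => Cexp (f x)) = Cexp (Csum l f).
Proof. elim: l => [|x l IH] /=; [by rewrite Cexp_0 | by rewrite IH Cexp_plus]. Qed.

Lemma Csum_const {T} (l : list T) (c : C) : Csum l (fun _ => c) = INR (length l) * c.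
Proof.
  elim: l => [|x l IH]; first by rewrite /=; ring.
  change (c + Csum l (fun _ => c) = INR (S (length l)) * c). rewrite IH S_INR RtoC_plus. ring.
Qed.

(** What remains of the residue sum over the poles [1/(a_k q^n)] after removing the value of
    [exp (sg w) g (exp w)] at [z = 1/a_k]. It does not depend on the numerator, so the integral of
    [Phi] and the auxiliary relations share it. *)
Definition jackson_weight (N : nat) (q logq : C) (s a : nat -> C) (k : nat) : C :=
  J_N N logq s (s k * logq)
  / (Cexp ((INR N - sum_n_m s 1 (2 * N)) * (s k * logq))
     * Gprod (except k (seq 1 (2 * N))) (fun j => theta (a j / a k) q) * qpoch q q ^ 2).

Section Jackson.
Variables (N : nat) (q logq : C) (s a : nat -> C).
Hypothesis hN : (0 < N)%nat.
Hypothesis hlogq : Cexp logq = q.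
Hypothesis hq : (Cmod q < 1)%R.
Hypothesis haE : forall j, a j = qpow logq (s j).

Let J := seq 1 (2 * N).

Hypothesis ha1 : forall j, In j J -> (Cmod (a j) < 1)%R.
Hypothesis hgen : forall j k, In j J -> In k J -> j <> k -> theta (a j / a k) q <> 0.
Hypothesis hc : (Cmod (q ^ (N - 1) / Gprod J a) < 1)%R.

Let al (j : nat) : C := s j * logq.
Let kappa : C := INR N - sum_n_m s 1 (2 * N).

Let hal (j : nat) : Cexp (al j) = a j.
Proof. by rewrite haE. Qed.

Let q0 : q <> 0 := q_neq0 q logq hlogq.
Let a0 (j : nat) : a j <> 0 := a_neq0 a al hal j.

Let hJ : NoDup J := seq_NoDup (2 * N) 1.

Let length_J : length J = (2 * N)%nat := length_seq (2 * N) 1.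

(** All integer powers of [q] are zeros of [theta], so coinciding points would make
    [theta (a_j / a_k)] vanish; the two cases correspond to its two symbols. *)
Lemma points_distinct (j k m n : nat) : In j J -> In k J -> j <> k -> a j * q ^ m <> a k * q ^ n.
Proof.
  move=> hj hk hne E. have hth := hgen j k hj hk hne. have hak := a0 k. have haj := a0 j.
  have hx : a j / a k <> 0 by apply Cmult_neq_0; [done | by apply Cinv_neq0].
  have hqm : q ^ m <> 0 by apply Cpow_nz. have hqn : q ^ n <> 0 by apply Cpow_nz.
  case: (Nat.le_gt_cases n m) => h.
  - apply (theta_neq0_pow q hq _ (m - n) hth).
    have E2 : a j * q ^ (m - n) * q ^ n = a k * q ^ n.
    { rewrite -E -Cmult_assoc -Cpow_add_r. do 2 f_equal. lia. }
    transitivity (a j * q ^ (m - n) * q ^ n / (a k * q ^ n)); first by field; split.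
    rewrite E2. field. by split.
  - apply (theta_neq0_pow_r q hq _ (n - m - 1) hx hth).
    have E2 : a j * q ^ m = a k * q ^ S (n - m - 1) * q ^ m.
    { rewrite E -Cmult_assoc -Cpow_add_r. do 2 f_equal. lia. }
    transitivity (a j * q ^ m / (a k * q ^ m)); first by field; split.
    rewrite E2. field. by split.
Qed.

Let kappa_eq : Csum J (fun j => 1 / 2 - s j) = kappa.
Proof.
  rewrite /kappa. have -> : (2 * N = 1 + (2 * N - 1))%nat by lia.
  rewrite sum_n_m_Csum. have -> : S (2 * N - 1) = (2 * N)%nat by lia. rewrite -/J.
  rewrite (Csum_ext J _ (fun j => 1 / 2 + (- (1)) * s j)); last by move=> j _; ring.
  rewrite Csum_plus Csum_scal Csum_const length_J mult_INR RtoC_mult /=.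
  have -> : ((1 + 1)%R : C) = 2 by []. field.
Qed.

Let Cexp_kappa_logq : Cexp (kappa * logq) = q ^ N / Gprod J a.
Proof.
  rewrite /kappa /Cminus Cmult_plus_distr_r Cexp_plus Cexp_INR_mult hlogq /Cdiv. f_equal.
  have -> : - sum_n_m s 1 (2 * N) * logq = - (sum_n_m s 1 (2 * N) * logq) by ring.
  rewrite Cexp_opp. f_equal.
  rewrite (Gprod_ext J a (fun j => Cexp (logq * s j))); last first.
  { move=> j _. rewrite haE /qpow. f_equal. ring. }
  rewrite Gprod_Cexp Csum_scal. f_equal. rewrite Cmult_comm. f_equal.
  have -> : (2 * N = 1 + (2 * N - 1))%nat by lia.
  rewrite sum_n_m_Csum. f_equal. rewrite /J. f_equal. lia.
Qed.

Let Q (k n : nat) : C := Q_N N logq s (al k + INR n * logq).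

Let Cexp_point (k n : nat) : Cexp (al k + INR n * logq) = a k * q ^ n.
Proof. by rewrite Cexp_plus hal Cexp_INR_mult hlogq. Qed.

Let Q_eq (k n : nat) : Q k n = (/ (a k * q ^ n) - a k * q ^ n) * (Cexp (kappa * (al k + INR n * logq)) *
  Gprod J (fun j => qpoch (q / a j * (a k * q ^ n)) q / qpoch (a j * (a k * q ^ n)) q)).
Proof.
  rewrite /Q /Q_N Cexp_point hlogq -Gprod_nat -/J. f_equal.
  rewrite Gprod_mult. f_equal.
  - rewrite -kappa_eq -(Cmult_comm (al k + INR n * logq)) -Csum_scal -Gprod_Cexp.
    apply Gprod_ext => j _. f_equal. ring.
  - apply Gprod_ext => j _. by rewrite -!(haE j).
Qed.

(** One step multiplies [z^kappa] by [q^N / prod a_j], and the factor [1/z] of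
    [1/z - z = (1 - z^2) / z] by [1/q]; together this is the ratio [c]. The remaining factors stay
    bounded. *)
Lemma Q_geometric (k : nat) : In k J -> exists l, Clim (fun n => Csum (seq 0 n) (Q k)) l.
Proof.
  move=> hk. set c := q ^ (N - 1) / Gprod J a.
  destruct (Gprod_bounded J (fun n : nat => True)
    (fun j n => qpoch (q / a j * (a k * q ^ n)) q / qpoch (a j * (a k * q ^ n)) q)) as [M [hM HM]].
  { move=> j hj.
    have [K HK] := qpoch_ratio_bounded q hq (Cmod (q / a j)) (Cmod (a j)) (ha1 j hj).
    exists K => n _. have hy := Cmod_aq_lt1 q J a hq ha1 k n hk. have hy0 := Cmod_ge_0 (a k * q ^ n).
    apply HK; rewrite Cmod_mult.
    - have := Cmod_ge_0 (q / a j). nra.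
    - have := Cmod_ge_0 (a j). nra. }
  apply (Cseries_geom_ex _ (2 * Cmod (/ a k * Cexp (kappa * al k)) * M) (Cmod c)).
  { split; [apply Cmod_ge_0 | exact hc]. }
  move=> n. rewrite Q_eq.
  have E : (/ (a k * q ^ n) - a k * q ^ n) * (Cexp (kappa * (al k + INR n * logq)) *
    Gprod J (fun j => qpoch (q / a j * (a k * q ^ n)) q / qpoch (a j * (a k * q ^ n)) q)) =
    (1 - (a k * q ^ n) ^ 2) * (/ a k * Cexp (kappa * al k)) *
    Gprod J (fun j => qpoch (q / a j * (a k * q ^ n)) q / qpoch (a j * (a k * q ^ n)) q) * c ^ n.
  { have -> : kappa * (al k + INR n * logq) = kappa * al k + INR n * (kappa * logq) by ring.
    rewrite Cexp_plus Cexp_INR_mult Cexp_kappa_logq.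
    have -> : c = (q ^ N / Gprod J a) * / q.
    { rewrite /c. have {2}-> : N = S (N - 1) by lia. rewrite Cpow_S /Cdiv. move: (/ Gprod J a) => I. field. done. }
    rewrite (Cpow_mult_l (q ^ N / Gprod J a)) Cpow_inv //.
    have hqn : q ^ n <> 0 by apply Cpow_nz. have hak := a0 k.
    move: (Gprod J (fun j => _)) ((q ^ N / Gprod J a) ^ n) => G I. field. by split. }
  rewrite E Cmod_mult Cmod_pow.
  apply Rmult_le_compat_r; first by apply pow_le, Cmod_ge_0.
  rewrite Cmod_mult. apply Rmult_le_compat; try apply Cmod_ge_0; last by apply (HM n).
  rewrite Cmod_mult. apply Rmult_le_compat_r; first apply Cmod_ge_0.
  eapply Rle_trans; first apply Cmod_1_minus_le.
  rewrite Cmod_pow. have hy := Cmod_aq_lt1 q J a hq ha1 k n hk. have hy0 := Cmod_ge_0 (a k * q ^ n).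
  nra.
Qed.

Let Sq (k : nat) : C := Cseries (Q k).

Lemma Q_sum (k : nat) : In k J -> Clim (fun n => Csum (seq 0 n) (Q k)) (Sq k).
Proof.
  move=> hk. have [l Hl] := Q_geometric k hk. rewrite /Sq (Cseries_eq _ _ Hl). exact Hl.
Qed.

Lemma J_N_eq (k : nat) : In k J -> J_N N logq s (s k * logq) = Sq k.
Proof.
  move=> hk. rewrite /J_N /Cbiseries -/(al k).
  have -> : Cseries (fun n => Q_N N logq s (al k + IZR (Z.of_nat n) * logq)) = Sq k.
  { apply Cseries_eq. apply: Clim_ext (Q_sum k hk) => n. apply Csum_ext => m _. by rewrite /Q INR_IZR_INZ. }
  rewrite (Cseries_eq _ 0); first ring.
  apply: Clim_ext (Clim_const 0) => n. rewrite (Csum_ext _ _ (fun _ => 0)); first by rewrite Csum_0.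
  move=> m _. set w := al k + _ * logq.
  have Ew : Cexp w = a k * / q ^ S m.
  { rewrite /w Cexp_plus hal. f_equal. rewrite opp_IZR -INR_IZR_INZ RtoC_opp.
    have -> : - INR (S m) * logq = - (INR (S m) * logq) by ring.
    by rewrite Cexp_opp Cexp_INR_mult hlogq. }
  (* At [z = a_k q^(-m-1)] the numerator symbol of the factor [j = k] is [(q^(-m); q)], which is
     zero: the bilateral sum truncates. *)
  rewrite /Q_N -Gprod_nat (Gprod_eq0 _ _ k) //; first ring.
  rewrite Ew hlogq (qpoch_eq0 q hq _ m); first by rewrite /Cdiv; ring.
  rewrite -haE Cpow_S. have hqm : q ^ m <> 0 by apply Cpow_nz. have hak := a0 k. field. by repeat split.
Qed.

Lemma qpoch_q_neq0 : qpoch q q <> 0.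
Proof. by apply qpoch_neq0_small. Qed.

(** * Residues as terms of the Jackson series *)

Section Numerator.
Variables (sg : R) (g : C -> C).
Hypothesis hX : forall w, Cexp (sg * (w - logq)) * g (Cexp w / q) =
  Cexp (sg * w) * g (Cexp w) * (Cexp w ^ (2 * N) / q ^ N).

Let X (k n : nat) : C := Cexp (sg * - (al k + INR n * logq)) * g (/ (a k * q ^ n)).

Let Theta (k n : nat) : C := Gprod (except k J) (fun j => theta (a j / (a k * q ^ n)) q).
(** [theta (q^(-n))] without its vanishing factor: it stands for the index [j = k] missing from
    [Theta] and obeys the same kind of recursion. *)
Let Delta (n : nat) : C := q_drop q n * qpoch (q ^ S n) q.

Let X_step (k n : nat) : X k (S n) = X k n * / ((a k * q ^ n) ^ (2 * N) * q ^ N).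
Proof.
  rewrite /X. have := hX (- (al k + INR n * logq)).
  rewrite Cexp_opp Cexp_point.
  have -> : - (al k + INR n * logq) - logq = - (al k + INR (S n) * logq) by rewrite S_INR RtoC_plus; ring.
  have hy : a k * q ^ n <> 0 by apply Cmult_neq_0; [done | by apply Cpow_nz].
  have -> : / (a k * q ^ n) / q = / (a k * q ^ S n).
  { rewrite Cpow_S /Cdiv !Cinv_mult. ring. }
  move=> ->. by rewrite Cpow_inv // (Cinv_mult (_ ^ (2 * N))).
Qed.

Let Theta_step (k n : nat) : Theta k (S n) = Gprod (except k J) (fun j => - (a j / (a k * q ^ S n))) * Theta k n.
Proof.
  rewrite /Theta -Gprod_mult. apply Gprod_ext => j _.
  have hy : a k * q ^ n <> 0 by apply Cmult_neq_0; [done | by apply Cpow_nz].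
  have E : a j / (a k * q ^ S n) = a j / (a k * q ^ n) / q.
  { rewrite Cpow_S /Cdiv !Cinv_mult. ring. }
  rewrite E theta_div_p //. apply Cmult_neq_0; [done | by apply Cinv_neq0].
Qed.

Let Delta_step (n : nat) : Delta (S n) = - / q ^ S n * Delta n.
Proof.
  rewrite /Delta /q_drop Gprod_seq_S_l (qpoch_step q hq (q ^ S n)).
  have -> : q ^ S n * q = q ^ S (S n) by rewrite (Cpow_S q (S n)); ring.
  have hqn : q ^ n <> 0 by apply Cpow_nz.
  rewrite (Gprod_ext (seq 0 n) (fun k => 1 - q ^ S k / q ^ S n) (fun m => 1 - q ^ m / q ^ n)); last first.
  { move=> m _. rewrite !Cpow_S. field. by split. }
  move: (Gprod _ _) (qpoch q q) (qpoch (q ^ S (S n)) q) => G1 G2 G3. rewrite Cpow_S /=. field. by split.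
Qed.

(** Both sides agree at [n = 0] and have the same multiplier: in one step the [2N - 1] thetas and
    [Delta] give [prod a_j / (a_k q^(n+1))^(2N)], the exponential with [kappa] gives
    [q^N / prod a_j], and the product of these is the multiplier of [X]. *)
Let X_eq (k n : nat) : In k J ->
  X k n = X k 0%nat / (Cexp (kappa * al k) * Theta k 0%nat * qpoch q q ^ 2) *
    (Cexp (kappa * (al k + INR n * logq)) * Theta k n * Delta n).
Proof.
  move=> hk. elim: n => [|n IH].
  - have hT : Theta k 0 <> 0.
    { apply Gprod_neq0 => j hj. apply except_In in hj. rewrite /= Cmult_1_r. apply hgen; tauto. }
    have -> : Delta 0 = qpoch q q ^ 2.
    { rewrite /Delta /q_drop /=. have -> : q * 1 = q by ring. ring. }
    have -> : al k + INR 0 * logq = al k by rewrite /=; ring.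
    have hE := Cexp_neq0 (kappa * al k). have hqq := qpoch_q_neq0. field. by repeat split.
  - rewrite X_step Theta_step Delta_step IH.
    have -> : kappa * (al k + INR (S n) * logq) = kappa * (al k + INR n * logq) + kappa * logq
      by rewrite S_INR RtoC_plus; ring.
    rewrite (Cexp_plus (kappa * (al k + INR n * logq))) Cexp_kappa_logq.
    have hqn : q ^ n <> 0 by apply Cpow_nz. have hak := a0 k.
    (* The multiplier of [Delta], written as the factor of index [k] that completes the product over
       [J]. *)
    have -> : - / q ^ S n = - (a k / (a k * q ^ S n)).
    { rewrite Cpow_S. field. by repeat split. }
    have E : Gprod (except k J) (fun j => - (a j / (a k * q ^ S n))) * - (a k / (a k * q ^ S n)) =
      Gprod J a * / (a k * q ^ S n) ^ (2 * N).
    { rewrite Cmult_comm -(Gprod_except k J (fun j => - (a j / (a k * q ^ S n))) hJ hk).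
      rewrite (Gprod_ext J _ (fun j => a j * - / (a k * q ^ S n))); last by move=> j _; rewrite /Cdiv; ring.
      rewrite Gprod_mult Gprod_const length_J. f_equal. rewrite -Cpow_inv; last first.
      { apply Cmult_neq_0; [done | by apply Cpow_nz]. }
      rewrite !(Cpow_mult_r _ 2 N). f_equal. rewrite /=. ring. }
    have E2 : q ^ N / Gprod J a * (Gprod (except k J) (fun j => - (a j / (a k * q ^ S n))) * - (a k / (a k * q ^ S n))) =
      / ((a k * q ^ n) ^ (2 * N) * q ^ N).
    { rewrite E. have hG : Gprod J a <> 0 by apply Gprod_neq0.
      have -> : (a k * q ^ S n) ^ (2 * N) = (a k * q ^ n) ^ (2 * N) * (q ^ N * q ^ N).
      { rewrite Cpow_S. have -> : a k * (q * q ^ n) = a k * q ^ n * q by ring.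
        rewrite Cpow_mult_l. f_equal. rewrite -Cpow_add_r. f_equal. lia. }
      have hy : (a k * q ^ n) ^ (2 * N) <> 0 by apply Cpow_nz, Cmult_neq_0.
      have hqN : q ^ N <> 0 by apply Cpow_nz. field. by repeat split. }
    rewrite -E2. move: (q ^ N / Gprod J a) (Gprod (except k J) _) (a k / (a k * q ^ S n)) => A B D.
    rewrite /Cdiv. move: (/ (_ * _ * _)) => I. ring.
Qed.

(** [X_eq] trades the numerator for thetas. One symbol of each theta cancels a denominator of the
    residue and the other is a numerator of [Q]; in the same way [Delta] cancels [q_drop] and leaves
    the numerator for [j = k]. *)
Lemma residue_eq (k n : nat) : In k J -> residue q logq J a al sg g k n =
  X k 0%nat / (Cexp (kappa * al k) * Theta k 0%nat * qpoch q q ^ 2) * Q k n.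
Proof.
  move=> hk. rewrite Q_eq /residue.
  have hy : a k * q ^ n <> 0 by apply Cmult_neq_0; [done | by apply Cpow_nz].
  transitivity (X k n * ((/ (a k * q ^ n) - a k * q ^ n) /
    (Gprod J (fun j => qpoch (a j * (a k * q ^ n)) q) *
     Gprod (except k J) (fun j => qpoch (a j / (a k * q ^ n)) q) * q_drop q n))).
  { rewrite /X /Cdiv. move: (/ (_ * _ * _)) => I. ring. }
  rewrite X_eq //.
  have ET : Theta k n = Gprod (except k J) (fun j => qpoch (a j / (a k * q ^ n)) q) *
    Gprod (except k J) (fun j => qpoch (q / a j * (a k * q ^ n)) q).
  { rewrite -Gprod_mult. apply Gprod_ext => j _. rewrite /theta. do 2 f_equal. have haj := a0 j.
    have hqn : q ^ n <> 0 by apply Cpow_nz. have hak := a0 k. field. by repeat split. }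
  have hT : Theta k n <> 0.
  { elim: n {hy ET} => [|n IH].
    - apply Gprod_neq0 => j hj. apply except_In in hj. rewrite /= Cmult_1_r. apply hgen; tauto.
    - rewrite Theta_step. apply Cmult_neq_0 => //. apply Gprod_neq0 => j _ E.
      have h : a j / (a k * q ^ S n) = 0 by transitivity (- - (a j / (a k * q ^ S n))); [ring | rewrite E; ring].
      move: h. apply Cmult_neq_0; [done | apply Cinv_neq0, Cmult_neq_0; [done | by apply Cpow_nz]]. }
  have hD : Delta n <> 0.
  { elim: n {hy ET hT} => [|n IH].
    - rewrite /Delta /q_drop /=. have -> : q * 1 = q by ring. have h := qpoch_q_neq0.
      apply Cmult_neq_0 => //. by rewrite Cmult_1_l.
    - rewrite Delta_step. apply Cmult_neq_0 => // E.
      have h : / q ^ S n = 0 by transitivity (- - / q ^ S n); [ring | rewrite E; ring].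
      move: h. by apply Cinv_neq0, Cpow_nz. }
  rewrite Gprod_div (Gprod_except k J (fun j => qpoch (q / a j * (a k * q ^ n)) q) hJ hk).
  have -> : q / a k * (a k * q ^ n) = q ^ S n.
  { rewrite Cpow_S. have hak := a0 k. field. done. }
  rewrite ET in hT |- *. rewrite /Delta in hD |- *.
  have h1 : Gprod (except k J) (fun j => qpoch (a j / (a k * q ^ n)) q) <> 0 by move=> E; apply hT; rewrite E; ring.
  have h2 : q_drop q n <> 0 by move=> E; apply hD; rewrite E; ring.
  move: h1 h2.
  move: (Gprod (except k J) (fun j => qpoch (a j / (a k * q ^ n)) q))
    (Gprod (except k J) (fun j => qpoch (q / a j * (a k * q ^ n)) q))
    (Gprod J (fun j => qpoch (a j * (a k * q ^ n)) q)) (q_drop q n) (qpoch (q ^ S n) q)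
    (Cexp (kappa * (al k + INR n * logq))) (X k 0%nat / _) (/ (a k * q ^ n) - a k * q ^ n)
    => P B A D E1 E2 H Y hP hD'.
  rewrite /Cdiv !Cinv_mult.
  transitivity (H * (Y * (E2 * (E1 * B * / A))) * (P * / P) * (D * / D)); first ring.
  rewrite !Cinv_r //. ring.
Qed.
End Numerator.

(** The common source of two applications: the numerator of [Phi], with [sg] equal to [0] or [1/2],
    and the products of thetas, with [sg = 0]. The limit in [L] is part of the conclusion, so
    convergence of the tails is derived from it. *)
Lemma hankel_sum (sg : R) (g : C -> C) :
  (forall w, Cexp (sg * (w - logq)) * g (Cexp w / q) =
    Cexp (sg * w) * g (Cexp w) * (Cexp w ^ (2 * N) / q ^ N)) ->
  (sg = 0%R \/ (sg = (/ 2)%R /\ Im logq = 0%R /\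
    forall j, In j J -> (- PI < Im (s j * logq) < PI)%R)) ->
  (forall L, hol L g) ->
  exists v0 (vt : R -> C), circ sg 0 (integrand q J a g) v0 /\
    (forall L, (0 <= L)%R -> cut sg L (integrand q J a g) (vt L)) /\
    (forall eps, (0 < eps)%R -> exists L1, forall L, (L1 <= L)%R ->
       (Cmod (v0 + vt L - 2 * PI * Ci * Csum J (fun k =>
          Cexp (sg * - (s k * logq)) * g (/ a k) * jackson_weight N q logq s a k)%C) < eps)%R).
Proof.
  move=> hX hsg hg.
  have Hres : forall k, In k J -> Clim (fun n => Csum (seq 0 n) (residue q logq J a al sg g k))
    (Cexp (sg * - al k) * g (/ a k) * jackson_weight N q logq s a k).
  { move=> k hk.
    have -> : Cexp (sg * - al k) * g (/ a k) * jackson_weight N q logq s a k =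
      (Cexp (sg * - al k) * g (/ a k)) / (Cexp (kappa * al k) *
      Gprod (except k J) (fun j => theta (a j / a k) q) * qpoch q q ^ 2) * Sq k.
    { rewrite /jackson_weight (J_N_eq k hk) -/J -/kappa -/(al k) /Cdiv; ring. }
    apply: Clim_ext (Clim_scal _ _ _ (Q_sum k hk)) => n.
    rewrite -Csum_scal. apply Csum_ext => m _.
    rewrite (residue_eq sg g hX k m hk).
    have -> : al k + INR 0 * logq = al k by rewrite /=; ring.
    have -> : a k * q ^ 0 = a k by rewrite /=; ring.
    done. }
  exact: (hankel_limit q logq J a al sg g N hlogq hq hJ hal ha1 points_distinct hsg hg
    length_J hN hX hc _ Hres).
Qed.

Lemma cut_0 (L : R) (f : C -> C) (v : C) : (0 <= L)%R -> cut 0 L f v -> v = 0.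
Proof.
  move=> hL H. have H0 := CInt_const 0 0 L. rewrite Cmult_0_r in H0.
  apply: (CInt_unique _ _ _ _ _ H). apply: (CInt_ext _ _ _ _ _ hL _ H0) => t _.
  rewrite tau_0. ring.
Qed.

(** The substitution [t -> - t] realises [z -> 1/z] on the unit circle and gives [v = - v]. *)
Lemma circ_odd (f : C -> C) (v : C) : (forall z, f (/ z) = - f z) -> circ 0 0 f v -> v = 0.
Proof.
  move=> hf H.
  have H1 : CInt (fun t => Ci * (Cexp (0 * (0 + t * Ci)) * f (Cexp (0 + t * Ci)))) PI (- PI) v.
  { have H1 : is_RInt (V := C_R_CompleteNormedModule) (fun t => Ci * (Cexp (0 * (0 + t * Ci)) * f (Cexp (0 + t * Ci)))) (- PI) (- - PI) v
      by rewrite Ropp_involutive.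
    apply: (is_RInt_ext (V := C_R_CompleteNormedModule)) (is_RInt_comp_opp (V := C_R_CompleteNormedModule) _ _ _ _ H1) => t _.
    change (- (Ci * (Cexp (0 * (0 + (- t)%R * Ci)) * f (Cexp (0 + (- t)%R * Ci)))) =
      Ci * (Cexp (0 * (0 + t * Ci)) * f (Cexp (0 + t * Ci)))).
    have -> : 0 + (- t)%R * Ci = - (0 + t * Ci) by rewrite RtoC_opp; ring.
    rewrite Cexp_opp hf !Cmult_0_l. ring. }
  have H2 : CInt (fun t => Ci * (Cexp (0 * (0 + t * Ci)) * f (Cexp (0 + t * Ci)))) (- PI) PI (- v)
    := is_RInt_swap (V := C_R_CompleteNormedModule) _ _ _ _ H1.
  have E : v = - v := CInt_unique _ _ _ _ _ H H2.
  have h2 : (2 : C) <> 0 by move=> /RtoC_inj; lra.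
  transitivity ((v + v) / 2); first by field. rewrite {1}E. field.
Qed.

(* For a numerator invariant under [z -> 1/z] the integrand is odd, so its circle integral vanishes
   and the residue sum becomes a linear relation between Jackson integrals. *)
Lemma jackson_relation (g : C -> C) :
  (forall z : C, z <> 0 -> g (z / q) = g z * (z ^ (2 * N) / q ^ N)) ->
  (forall z, g (/ z) = g z) -> (forall L, hol L g) ->
  Csum J (fun k => g (a k) * jackson_weight N q logq s a k) = 0.
Proof.
  move=> hX hinv hg.
  have hX0 : forall w, Cexp (0%R * (w - logq)) * g (Cexp w / q) =
    Cexp (0%R * w) * g (Cexp w) * (Cexp w ^ (2 * N) / q ^ N).
  { move=> w. rewrite !Cmult_0_l Cexp_0 hX; [ring | apply Cexp_neq0]. }
  have [v0 [vt [h1 [h2 h3]]]] := hankel_sum 0 g hX0 (or_introl eq_refl) hg.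
  have hv0 : v0 = 0.
  { apply (circ_odd (integrand q J a g)) => // z. rewrite /integrand hinv.
    have -> : / / z = z.
    { case: (Ceq_dec z 0) => [->|hz]; [by rewrite !Cinv_0 | by field]. }
    have -> : Gprod J (fun j => qpoch (a j * / z) q * qpoch (a j / / z) q) =
      Gprod J (fun j => qpoch (a j * z) q * qpoch (a j / z) q).
    { apply Gprod_ext => j _. rewrite Cmult_comm. do 2 f_equal.
      case: (Ceq_dec z 0) => [->|hz]; [by rewrite Cinv_0 Cdiv_0_r Cmult_0_r | by field]. }
    rewrite /Cdiv. ring. }
  set V := Csum J (fun k => Cexp (0%R * - (s k * logq)) * g (/ a k) * jackson_weight N q logq s a k) in h3.
  have hV : V = 0.
  { apply Cmod_eq_0. case: (Rle_lt_or_eq_dec 0 (Cmod V) (Cmod_ge_0 V)) => [h|<-] //.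
    have hPI := PI_RGT_0.
    (* With both integrals zero the error is exactly [2 pi |V|]; taking that number as the error
       bound is contradictory. *)
    have [L1 H] := h3 (Cmod V * (2 * PI))%R ltac:(nra).
    have := H (Rmax L1 0) (Rmax_l _ _).
    rewrite hv0 (cut_0 _ _ _ (Rmax_r L1 0) (h2 _ (Rmax_r L1 0))).
    have -> : 0 + 0 - 2 * PI * Ci * V = - (2 * PI * Ci * V) by ring.
    rewrite Cmod_opp !Cmod_mult Cmod_Ci (Cmod_R PI) (Cmod_R 2) !Rabs_pos_eq; lra. }
  rewrite -hV. apply Csum_ext => k _. rewrite Cmult_0_l Cexp_0 hinv. ring.
Qed.

End Jackson.

(** * The integral of [Phi] *)

Lemma is_RInt_gen_infty (f F : R -> C) (l : C) :
  (forall L, (0 <= L)%R -> CInt f 0 L (F L)) ->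
  (forall eps, (0 < eps)%R -> exists L1, forall L, (L1 <= L)%R -> (Cmod (F L - l) < eps)%R) ->
  is_RInt_gen (V := C_R_CompleteNormedModule) f (at_point 0%R) (Rbar_locally p_infty) l.
Proof.
  move=> HF Hl P [eps HP]. have [L1 H] := Hl eps (cond_pos eps).
  exists (fun x => x = 0%R) (fun x => (Rmax L1 0 < x)%R) => //.
  - by exists (Rmax L1 0).
  - move=> x y -> hy. have h1 := Rmax_l L1 0. have h2 := Rmax_r L1 0.
    exists (F y). split; first by apply HF; lra.
    apply HP. have A := H y ltac:(lra).
    split; rewrite /ball /= /AbsRing_ball /abs /= /minus /plus /opp /=.
    + eapply Rle_lt_trans; last exact A. apply (re_le_Cmod (F y - l)).
    + eapply Rle_lt_trans; last exact A. apply (im_le_Cmod (F y - l)).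
Qed.

Lemma theta_1 (p : C) : (Cmod p < 1)%R -> theta 1 p = 0.
Proof. move=> hp. rewrite /theta (qpoch_eq0 p hp 1 0); first ring. rewrite /=; ring. Qed.

Section PhiIntegral.
Variables (N m : nat) (q logq : C) (s a : nat -> C) (sg : R).
Hypothesis hN : (0 < N)%nat.
Hypothesis hlogq : Cexp logq = q.
Hypothesis hq : (Cmod q < 1)%R.
Hypothesis haE : forall j, a j = qpow logq (s j).
Hypothesis hm : RtoC sg = INR m - INR N / 2.

Let p := qpow logq (INR N / 2).
Let J := seq 1 (2 * N).

(* [z^(-N/2) theta (z^N; q^(N/2))] is [exp (sg w)] times this function of [z = exp w], with [sg = 0]
   for even and [sg = 1/2] for odd [N]. *)
Definition Phi_num (z : C) : C := (/ z) ^ m * theta (z ^ N) (qpow logq (INR N / 2)).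

Let p0 : p <> 0 := Cexp_neq0 _.

Let p_sq : p * p = q ^ N.
Proof.
  rewrite /p /qpow -Cexp_plus -hlogq -Cexp_INR_mult. f_equal. field.
Qed.

Lemma Cmod_p_lt1 : (Cmod p < 1)%R.
Proof.
  have h : (Cmod p * Cmod p < 1)%R.
  { rewrite -Cmod_mult p_sq Cmod_pow. have hr := Cmod_ge_0 q.
    have -> : N = S (N - 1) by lia. have := Cmod_pow_le_1 q hq (N - 1). rewrite /=. nra. }
  have := Cmod_ge_0 p. nra.
Qed.

Lemma Cexp_half_sq (w : C) : Cexp (INR N / 2 * w) * Cexp (INR N / 2 * w) = Cexp w ^ N.
Proof. rewrite -Cexp_plus -Cexp_INR_mult. f_equal. field. Qed.

Lemma Phi_num_eq (w : C) :
  Cexp (sg * w) * Phi_num (Cexp w) = / Cexp (INR N / 2 * w) * theta (Cexp w ^ N) p.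
Proof.
  rewrite /Phi_num -/p Cmult_assoc. f_equal.
  rewrite -Cexp_opp -Cexp_INR_mult -Cexp_plus -Cexp_opp. f_equal. rewrite hm. field.
Qed.

Lemma Phi_eq_integrand (w : C) :
  Phi N logq s w = Cexp (sg * w) * integrand q J a Phi_num (Cexp w).
Proof.
  rewrite /Phi /integrand hlogq -/p -Gprod_nat -/J. set z := Cexp w. set e := Cexp (INR N / 2 * w).
  have hz : z <> 0 := Cexp_neq0 _. have he : e <> 0 := Cexp_neq0 _.
  have hzN : z ^ N = e * e by rewrite -Cexp_half_sq.
  have -> : Cexp (- (INR N / 2) * w) = / e.
  { rewrite -Cexp_opp. f_equal. ring. }
  have -> : Gprod J (fun j => qpoch (qpow logq (s j) * z) q * qpoch (qpow logq (s j) / z) q) =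
    Gprod J (fun j => qpoch (a j * z) q * qpoch (a j / z) q).
  { apply Gprod_ext => j _. by rewrite -!(haE j). }
  have -> : Cexp (sg * w) * ((z - / z) * Phi_num z / Gprod J (fun j => qpoch (a j * z) q * qpoch (a j / z) q)) =
    (z - / z) * (Cexp (sg * w) * Phi_num z) / Gprod J (fun j => qpoch (a j * z) q * qpoch (a j / z) q)
    by rewrite /Cdiv; ring.
  rewrite Phi_num_eq -/z -/e. f_equal. rewrite /theta hzN.
  case: (Ceq_dec (e - / e) 0) => hd.
  (* A removable singularity: the quotient in [Phi] is [0] by the convention [/ 0 = 0], and
     [theta (z^N)] vanishes there too, so the equality persists. *)
  - rewrite hd Cdiv_0_r. have -> : e * e = 1.
    { transitivity (1 + e * (e - / e)); [by field | rewrite hd; ring]. }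
    rewrite (qpoch_eq0 p Cmod_p_lt1 1 0); last by rewrite /=; ring. ring.
  - rewrite (qpoch_step p Cmod_p_lt1 (/ (e * e))).
    have -> : / (e * e) * p = p / (e * e) by rewrite /Cdiv; ring.
    have -> : 1 - / (e * e) = (e - / e) / e by field.
    have hd' : e * e - 1 <> 0.
    { move=> E. apply hd. transitivity ((e * e - 1) / e); [by field | rewrite E /Cdiv; ring]. }
    field. by repeat split.
Qed.

Lemma Phi_num_shift (w : C) : Cexp (sg * (w - logq)) * Phi_num (Cexp w / q) =
  Cexp (sg * w) * Phi_num (Cexp w) * (Cexp w ^ (2 * N) / q ^ N).
Proof.
  have -> : Cexp w / q = Cexp (w - logq) by rewrite Cexp_minus hlogq.
  rewrite !Phi_num_eq. have -> : INR N / 2 * (w - logq) = INR N / 2 * w - INR N / 2 * logq by ring.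
  rewrite !Cexp_minus hlogq. set e := Cexp (INR N / 2 * w).
  have he : e <> 0 := Cexp_neq0 _.
  change (Cexp (INR N / 2 * logq)) with p.
  rewrite Cpow_mult_l Cpow_inv; last by rewrite -hlogq; apply Cexp_neq0.
  rewrite Nat.mul_comm Cpow_mult_r -!Cexp_half_sq -/e -p_sq.
  have hee : e * e <> 0 by apply Cmult_neq_0.
  have hpp : p * p <> 0 by apply Cmult_neq_0.
  (* Since [q^N = p * p], the step [z -> z/q] divides [z^N] by [p] twice. *)
  have -> : e * e * / (p * p) = e * e / p / p by field.
  have hep : e * e / p <> 0 by apply Cmult_neq_0; [done | by apply Cinv_neq0].
  rewrite (theta_div_p p Cmod_p_lt1 p0 (e * e / p)) // (theta_div_p p Cmod_p_lt1 p0 (e * e)) //.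
  rewrite /=. field. by split.
Qed.

Lemma Phi_num_hol (L : R) : hol L Phi_num.
Proof.
  rewrite /Phi_num. apply hol_mult; first by apply hol_pow, hol_inv.
  rewrite /theta. apply hol_mult.
  - apply hol_qpoch; first exact Cmod_p_lt1. apply hol_pow, hol_id.
  - apply hol_qpoch; first exact Cmod_p_lt1.
    apply (hol_ext L (fun z => p * (/ z) ^ N)).
    + move=> z hz. rewrite Cpow_inv //. by apply (annulus_neq0 L).
    + apply hol_mult; [apply hol_const | apply hol_pow, hol_inv].
Qed.

Hypothesis ha1 : forall j, In j J -> (Cmod (a j) < 1)%R.
Hypothesis hgen : forall j k, In j J -> In k J -> j <> k -> theta (a j / a k) q <> 0.
Hypothesis hc : (Cmod (q ^ (N - 1) / Gprod J a) < 1)%R.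
Hypothesis hsg : if Nat.odd N then sg = (/ 2)%R /\ Im logq = 0%R /\
  (forall j, In j J -> (- PI < Im (s j * logq) < PI)%R) else sg = 0%R.

Let Ci_neq0 : Ci <> 0.
Proof. apply Cmod_gt_0. rewrite Cmod_Ci. lra. Qed.

Let PI_neq0 : RtoC PI <> 0.
Proof. have hPI := PI_RGT_0. move=> /RtoC_inj. lra. Qed.

Let sg_cases : sg = 0%R \/ (sg = (/ 2)%R /\ Im logq = 0%R /\
  forall j, In j J -> (- PI < Im (s j * logq) < PI)%R).
Proof. move: hsg. case: (Nat.odd N); tauto. Qed.

(** The limit relation controls only the difference of the two edges. Their integrands are the
    multiples [A / tau] and [B / tau] of the one in [cut], so each tail converges separately, and
    [A - B = tau] reassembles them. *)
Lemma I_N_residue_sum : ex_I_N N logq s /\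
  I_N N logq s = Csum J (fun k => Cexp (sg * - (s k * logq)) * Phi_num (/ a k) * jackson_weight N q logq s a k).
Proof.
  have [v0 [vt [h1 [h2 h3]]]] := hankel_sum N q logq s a hN hlogq hq haE ha1 hgen hc sg Phi_num
    Phi_num_shift sg_cases Phi_num_hol.
  set V := Csum J _ in h3 |- *.
  set t := / (2 * PI * Ci).
  have hcirc : CInt (circle_form N logq s) (- PI) PI (t * v0).
  { apply: (CInt_ext _ _ _ _ _ PI_le _ (CInt_scal t _ _ _ _ h1)) => x _.
    rewrite /circle_form /Phi_form Phi_eq_integrand -/J.
    have -> : (0 : C) + x * Ci = x * Ci by ring. rewrite /t /Cdiv. ring. }
  have Ecirc := is_RInt_unique (V := C_R_CompleteNormedModule) _ _ _ _ hcirc.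
  rewrite /ex_I_N /I_N Ecirc.
  case E : (Nat.odd N); move: hsg; rewrite E => hsgN.
  - move: hsgN => [hsg2 [_ _]].
    set A := Cexp (sg * (PI * Ci)). set B := Cexp (- (sg * (PI * Ci))).
    have htau : tau sg = A - B by [].
    (* For [sg = 1/2] the boundary factors are [i] and [- i], so [tau sg = 2 i]. *)
    have htau0 : tau sg <> 0.
    { rewrite htau. have -> : A = Ci.
      { rewrite /A. have -> : sg * (PI * Ci) = (0, PI / 2)%R
          by rewrite hsg2; apply: injective_projections; rewrite /=; field.
        rewrite /Cexp /Re /Im /= exp_0 cos_PI2 sin_PI2. by apply: injective_projections; rewrite /=; ring. }
      have -> : B = - Ci.
      { rewrite /B. have -> : - (sg * (PI * Ci)) = (0, - (PI / 2))%R
          by rewrite hsg2; apply: injective_projections; rewrite /=; field.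
        rewrite /Cexp /Re /Im /= exp_0 cos_neg sin_neg cos_PI2 sin_PI2. by apply: injective_projections; rewrite /=; ring. }
      move=> E0. have := f_equal Im E0. rewrite /Im /=. lra. }
    have hlim : forall c : C, forall eps, (0 < eps)%R -> exists L1, forall L, (L1 <= L)%R ->
      (Cmod (c * vt L - c * (2 * PI * Ci * V - v0)) < eps)%R.
    { move=> c eps he. have hcp := Cmod_ge_0 c.
      have [L1 H] := h3 (eps / (Cmod c + 1))%R ltac:(apply Rdiv_lt_0_compat; lra).
      exists L1 => L hL. have K := H L hL.
      have -> : c * vt L - c * (2 * PI * Ci * V - v0) = c * (v0 + vt L - 2 * PI * Ci * V) by ring.
      rewrite Cmod_mult. set x := Cmod (v0 + vt L - 2 * PI * Ci * V) in K |- *.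
      have hx : (0 <= x)%R := Cmod_ge_0 _.
      apply Rle_lt_trans with ((Cmod c + 1) * x)%R; first nra.
      apply Rmult_lt_reg_r with (/ (Cmod c + 1))%R; first by apply Rinv_0_lt_compat; lra.
      eapply Rle_lt_trans; last exact K. right. field. lra. }
    have hup : is_RInt_gen (V := C_R_CompleteNormedModule) (upper_tail_form N logq s) (at_point 0%R)
      (Rbar_locally p_infty) (t * A / tau sg * (2 * PI * Ci * V - v0)).
    { apply (is_RInt_gen_infty _ (fun L => t * A / tau sg * vt L)); last by apply hlim.
      move=> L hL. apply: (CInt_ext _ _ _ _ _ hL _ (CInt_scal (t * A / tau sg) _ _ _ _ (h2 L hL))) => x _.
      rewrite /upper_tail_form /Phi_form Phi_eq_integrand -/J Cexp_add_PI.
      have -> : sg * (x + PI * Ci) = sg * (PI * Ci) + sg * x by ring.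
      rewrite Cexp_plus -/A /t. field. by repeat split. }
    have hlow : is_RInt_gen (V := C_R_CompleteNormedModule) (lower_tail_form N logq s) (at_point 0%R)
      (Rbar_locally p_infty) (t * B / tau sg * (2 * PI * Ci * V - v0)).
    { apply (is_RInt_gen_infty _ (fun L => t * B / tau sg * vt L)); last by apply hlim.
      move=> L hL. apply: (CInt_ext _ _ _ _ _ hL _ (CInt_scal (t * B / tau sg) _ _ _ _ (h2 L hL))) => x _.
      rewrite /lower_tail_form /Phi_form Phi_eq_integrand -/J Cexp_sub_PI.
      have -> : sg * (x - PI * Ci) = - (sg * (PI * Ci)) + sg * x by ring.
      rewrite Cexp_plus -/B /t. field. by repeat split. }
    have hlow' : is_RInt_gen (V := C_R_CompleteNormedModule) (lower_tail_form N logq s)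
      (Rbar_locally p_infty) (at_point 0%R) (- (t * B / tau sg * (2 * PI * Ci * V - v0)))
      by apply (is_RInt_gen_swap (V := C_R_CompleteNormedModule) (Fa := Rbar_locally p_infty) (Fb := at_point 0%R)).
    split.
    + split; first by exists (t * v0). move=> _. split; [eexists; exact hlow' | eexists; exact hup].
    + rewrite (is_RInt_gen_unique (V := C_R_CompleteNormedModule) _ _ hup)
        (is_RInt_gen_unique (V := C_R_CompleteNormedModule) _ _ hlow').
      change (- (t * B / tau sg * (2 * PI * Ci * V - v0)) + t * v0 + t * A / tau sg * (2 * PI * Ci * V - v0) = V).
      transitivity (t * v0 + t * ((A - B) / tau sg) * (2 * PI * Ci * V - v0)); first by rewrite /Cdiv; ring.
      rewrite -htau. have -> : tau sg / tau sg = 1 by field.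
      rewrite /t. field. by split.
  - split; first by split; [exists (t * v0) | discriminate].
    (* Without a cut the error does not depend on [L], and an error below every [eps] is zero. *)
    have E0 : v0 = 2 * PI * Ci * V.
    { have hE : v0 - 2 * PI * Ci * V = 0.
      { apply Cmod_eq_0. case: (Rle_lt_or_eq_dec 0 _ (Cmod_ge_0 (v0 - 2 * PI * Ci * V))) => [h|<-] //.
        have [L1 H] := h3 _ h. have := H (Rmax L1 0) (Rmax_l _ _).
        have h0 := h2 _ (Rmax_r L1 0). rewrite {1}hsgN in h0.
        rewrite (cut_0 _ _ _ (Rmax_r L1 0) h0).
        have -> : v0 + 0 - 2 * PI * Ci * V = v0 - 2 * PI * Ci * V by ring. lra. }
      transitivity (v0 - 2 * PI * Ci * V + 2 * PI * Ci * V); [ring | rewrite hE; ring]. }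
    rewrite E0 /t. field. by split.
Qed.

End PhiIntegral.

(** * Elimination of the Jackson integrals at the last N + 1 points *)

Theorem proposition4p2 (N : nat) (q logq : C) (s a : nat -> C)
  (hN : (2 <= N)%nat)
  (hlogq : Cexp logq = q)
  (hq : (Cmod q < 1)%R)
  (ha : forall j : nat, a j = qpow logq (s j))
  (ha1 : forall j : nat, (1 <= j <= 2 * N)%nat -> (Cmod (a j) < 1)%R)
  (* the denominators of R_k and A_{ki} do not vanish *)
  (hgen : forall j k : nat, (1 <= j <= 2 * N)%nat -> (1 <= k <= 2 * N)%nat -> j <> k ->
     theta (a j * a k) q <> 0 /\ theta (a j / a k) q <> 0)
  (* h is finite and nonzero at a_i *)
  (hreg : forall i : nat, (1 <= i <= N - 1)%nat -> theta (a i ^ 2) q <> 0)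
  (* N odd: 0 < q < 1, and |arg a_j| < pi *)
  (hodd : Nat.odd N = true ->
     Im logq = 0%R /\
     forall j : nat, (1 <= j <= 2 * N)%nat -> (Rabs (Im (s j * logq)) < PI)%R)
  (hconv : (Cmod (q ^ (N - 1)) < Cmod (Cprod (seq 1 (2 * N)) a))%R) :
  ex_I_N N logq s /\
  I_N N logq s =
    sum_n_m (fun i : nat =>
      (R_coef N logq s i
       + sum_n_m (fun k : nat => R_coef N logq s k * A_coef N logq s k i) N (2 * N))
      * calJ_N N logq s (s i * logq)) 1 (N - 1).
Proof.
  set J := seq 1 (2 * N). set J1 := seq 1 (N - 1). set J2 := seq N (N + 1).
  have inJ : forall j, In j J -> (1 <= j <= 2 * N)%nat by move=> j /in_seq; lia.
  have in1 : forall j, In j J1 <-> (1 <= j <= N - 1)%nat by move=> j; rewrite in_seq; lia.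
  have in2 : forall j, In j J2 <-> (N <= j <= 2 * N)%nat by move=> j; rewrite in_seq; lia.
  have JE : J = J1 ++ J2.
  { rewrite /J /J1 /J2. have -> : (2 * N = (N - 1) + (N + 1))%nat by lia. rewrite seq_app. do 2 f_equal. lia. }
  have a0 : forall j, a j <> 0 by move=> j; rewrite ha; apply Cexp_neq0.
  have q0 : q <> 0 by rewrite -hlogq; apply Cexp_neq0.
  have hgen1 : forall j k, In j J -> In k J -> j <> k -> theta (a j * a k) q <> 0
    := fun j k hj hk hne => proj1 (hgen j k (inJ j hj) (inJ k hk) hne).
  have hgen2 : forall j k, In j J -> In k J -> j <> k -> theta (a j / a k) q <> 0
    := fun j k hj hk hne => proj2 (hgen j k (inJ j hj) (inJ k hk) hne).
  have haJ : forall j, In j J -> (Cmod (a j) < 1)%R := fun j hj => ha1 j (inJ j hj).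
  have hN0 : (0 < N)%nat by lia.
  have hc : (Cmod (q ^ (N - 1) / Gprod J a) < 1)%R.
  { have hG : Gprod J a <> 0 by apply Gprod_neq0.
    have hGp : (0 < Cmod (Gprod J a))%R by apply Cmod_gt_0.
    rewrite Cmod_div //. apply Rmult_lt_reg_r with (Cmod (Gprod J a)) => //.
    have -> : (Cmod (q ^ (N - 1)) / Cmod (Gprod J a) * Cmod (Gprod J a) = Cmod (q ^ (N - 1)))%R by field; lra.
    rewrite Rmult_1_l. exact hconv. }
  (* [m] is [N/2] rounded up, so that [m - N/2] is [0] or [1/2]. *)
  have [m [sg [hm hsg]]] : exists (m : nat) (sg : R), RtoC sg = INR m - INR N / 2 /\
    if Nat.odd N then sg = (/ 2)%R /\ Im logq = 0%R /\
      (forall j, In j J -> (- PI < Im (s j * logq) < PI)%R) else sg = 0%R.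
  { case E : (Nat.odd N).
    - have [h1 h2] := hodd E. have [k hk] := proj1 (Nat.odd_spec N) E.
      exists (S k), (/ 2)%R. split.
      + have hNk : RtoC (INR N) = 2 * INR k + 1.
        { rewrite -RtoC_mult -RtoC_plus. f_equal. rewrite hk plus_INR mult_INR /=. ring. }
        rewrite S_INR RtoC_plus hNk RtoC_inv; last lra. field.
      + split=> //. split=> // j hj. have [k1 k2] := Rabs_def2 _ _ (h2 j (inJ j hj)). by split.
    - have E' : Nat.even N = true by rewrite -Nat.negb_odd E.
      have [k hk] := proj1 (Nat.even_spec N) E'.
      exists k, 0%R. split=> //.
      have hNk : RtoC (INR N) = 2 * INR k.
      { rewrite -RtoC_mult. f_equal. rewrite hk mult_INR /=. ring. }
      rewrite hNk. field. }
  have [hex hI] := I_N_residue_sum N m q logq s a sg hN0 hlogq hq ha hm haJ hgen2 hc hsg.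
  split; first exact hex.
  rewrite hI -/J. set W := jackson_weight N q logq s a.
  set tt := fun j k => theta (a j * a k) q * theta (a j / a k) q.
  set den := fun k => Gprod (except k J) (fun j => tt j k).
  have httne : forall j k, In j J -> In k J -> j <> k -> tt j k <> 0.
  { move=> j k hj hk hne. apply Cmult_neq_0; [by apply hgen1 | by apply hgen2]. }
  have hqq : qpoch q q <> 0 by apply qpoch_neq0_small.
  have hden : forall k, In k J -> den k <> 0.
  { move=> k hk. apply Gprod_neq0 => j hj. apply except_In in hj. apply httne; tauto. }
  have J1J : forall j, In j J1 -> In j J by move=> j hj; rewrite JE; apply in_or_app; left.
  have J2J : forall j, In j J2 -> In j J by move=> j hj; rewrite JE; apply in_or_app; right.
  have J12 : forall i k, In i J1 -> In k J2 -> i <> k by move=> i k /in1 h1 /in2 h2; lia.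
  (* The numerator at [1/a_k] carries [a_k^(N/2)]; the factor [a k] bridges the gap to the exponent
     [N/2 - 1] of [R_coef]. *)
  have hR : forall k, In k J -> Cexp (sg * - (s k * logq)) * Phi_num N m logq (/ a k) =
    a k * R_coef N logq s k * qpoch q q ^ 2 * den k.
  { move=> k hk. have hE : / a k = Cexp (- (s k * logq)) by rewrite Cexp_opp ha.
    rewrite hE (Phi_num_eq N m logq sg hm) -hE.
    have Hd : R_coef N logq s k = Cexp ((INR N / 2 - 1) * (s k * logq)) * theta (/ a k ^ N) (qpow logq (INR N / 2)) /
      (qpoch q q ^ 2 * den k).
    { rewrite /R_coef hlogq -Gprod_nat -/J -(ha k). do 2 f_equal. apply Gprod_ext => j _. by rewrite /tt (ha j). }
    rewrite Hd Cpow_inv //.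
    have -> : INR N / 2 * - (s k * logq) = - (INR N / 2 * (s k * logq)) by ring.
    rewrite Cexp_opp.
    have -> : INR N / 2 * (s k * logq) = s k * logq + (INR N / 2 - 1) * (s k * logq) by ring.
    rewrite Cexp_plus. have -> : Cexp (s k * logq) = a k by rewrite ha /qpow.
    have hdk := hden k hk. have hak := a0 k. have hE2 := Cexp_neq0 ((INR N / 2 - 1) * (s k * logq)).
    field. by repeat split. }
  (* At [z = a_i] the numerator [theta (z^2)] of [h_N] cancels the factor [j = i] of its
     denominator, which is where [hreg] enters; the remaining thetas complete [den i]. *)
  have hW : forall i, In i J1 -> W i = calJ_N N logq s (s i * logq) / (a i * qpoch q q ^ 2 * den i).
  { move=> i hi. have hiJ := J1J i hi. have hr := hreg i ltac:(by apply in1).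
    have hai := a0 i.
    have hGT : Gprod (except i J) (fun j => theta (a j * a i) q) <> 0.
    { apply Gprod_neq0 => j hj. apply except_In in hj. apply hgen1; tauto. }
    have hGT2 : Gprod (except i J) (fun j => theta (a j / a i) q) <> 0.
    { apply Gprod_neq0 => j hj. apply except_In in hj. apply hgen2; tauto. }
    have hh : h_N N logq s (s i * logq) =
      Cexp ((INR N - sum_n_m s 1 (2 * N)) * (s i * logq)) / a i / Gprod (except i J) (fun j => theta (a j * a i) q).
    { rewrite /h_N hlogq. have -> : Cexp (s i * logq) = a i by rewrite ha /qpow.
      have -> : (INR N - 1 - sum_n_m s 1 (2 * N)) * (s i * logq) =
        (INR N - sum_n_m s 1 (2 * N)) * (s i * logq) - s i * logq by ring.
      rewrite Cexp_minus. have -> : Cexp (s i * logq) = a i by rewrite ha /qpow.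
      rewrite -Gprod_nat -/J.
      rewrite (Gprod_ext J _ (fun j => theta (a j * a i) q)); last by move=> j _; rewrite (ha j).
      rewrite (Gprod_except i J _ (seq_NoDup _ _) hiJ).
      have Esq : a i ^ 2 = a i * a i by rewrite /=; ring.
      rewrite Esq in hr |- *.
      field. by repeat split. }
    rewrite /W /jackson_weight /calJ_N hh /den /tt Gprod_mult -/J.
    have hE2 := Cexp_neq0 ((INR N - sum_n_m s 1 (2 * N)) * (s i * logq)).
    field. by repeat split. }
  (* [J2] has [N + 1] elements; omitting [k] leaves the [N] pairs for which the transformation law
     of [jackson_relation] holds. *)
  set g := fun k z => Gprod (except k J2) (fun j => theta (a j * z) q * theta (a j / z) q).
  have hrel : forall k, In k J2 -> W k = - Csum J1 (fun i => g k (a i) / g k (a k) * W i).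
  { move=> k hk. have hkJ := J2J k hk.
    have hgk : g k (a k) <> 0.
    { apply Gprod_neq0 => j hj. apply except_In in hj. apply httne; [apply J2J; tauto | done | tauto]. }
    have hlen : length (except k J2) = N.
    (* The length is read off from a product of constants [2]: removing [k] divides [2^(N+1)] by
       [2]. *)
    { have := Gprod_except k J2 (fun _ => RtoC 2) (seq_NoDup _ _) hk.
      rewrite !Gprod_const length_seq -Cpow_S -!RtoC_pow => /RtoC_inj E.
      have := Nat.pow_inj_r 2 (N + 1) (S (length (except k J2))) ltac:(lia).
      move=> H. suff : (N + 1 = S (length (except k J2)))%nat by lia.
      apply H. apply INR_eq. by rewrite !pow_INR. }
    have R0 := jackson_relation N q logq s a hN0 hlogq hq ha haJ hgen2 hc (g k).
    have {}R0 : Csum J (fun i => g k (a i) * W i) = 0.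
    { apply R0.
      - move=> z hz. rewrite /g.
        rewrite (Gprod_ext _ _ (fun j => z ^ 2 / q * (theta (a j * z) q * theta (a j / z) q))).
        + rewrite Gprod_mult Gprod_const hlen Cmult_comm. f_equal.
          rewrite /Cdiv Cpow_mult_l Cpow_inv //. by rewrite Cpow_mult_r.
        + move=> j _. have haj := a0 j.
          have -> : a j * (z / q) = a j * z / q by rewrite /Cdiv; ring.
          have -> : a j / (z / q) = q * (a j / z) by field; split.
          have haz : a j * z <> 0 by apply Cmult_neq_0.
          have haz' : a j / z <> 0 by apply Cmult_neq_0; [done | by apply Cinv_neq0].
          rewrite theta_div_p // theta_mul_p //. rewrite /=. field. by repeat split.
      - move=> z. rewrite /g. apply Gprod_ext => j _. rewrite Cmult_comm. f_equal.
        f_equal. case: (Ceq_dec z 0) => [->|hz]; [by rewrite Cinv_0 Cdiv_0_r Cmult_0_r | by field].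
      - move=> L. apply hol_Gprod => j _. have haj := a0 j. apply hol_mult.
        + rewrite /theta. apply hol_mult; apply hol_qpoch => //.
          * apply hol_mult; [apply hol_const | apply hol_id].
          * apply (hol_ext L (fun z => q / a j * / z)).
            { move=> z hz. by rewrite /Cdiv Cinv_mult Cmult_assoc. }
            apply hol_mult; [apply hol_const | apply hol_inv].
        + rewrite /theta. apply hol_mult; apply hol_qpoch => //.
          * apply hol_mult; [apply hol_const | apply hol_inv].
          * apply (hol_ext L (fun z => q / a j * z)).
            { move=> z hz. have hz0 := annulus_neq0 L z hz. field. by split. }
            apply hol_mult; [apply hol_const | apply hol_id]. }
    (* For [i <> k] in [J2] the value [g k (a i)] contains [theta (a_i / a_i) = theta 1 = 0], so a
       single term survives. *)
    have R2 : Csum J2 (fun i => g k (a i) * W i) = g k (a k) * W k.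
    { have Hl : forall l, NoDup l -> (forall i, In i l -> In i J2) ->
        Csum l (fun i => g k (a i) * W i) = match in_dec Nat.eq_dec k l with left _ => g k (a k) * W k | right _ => 0 end.
      { elim=> [|i l IH] hnd hin //. have [hi hl] := proj1 (NoDup_cons_iff i l) hnd.
        change (g k (a i) * W i + Csum l (fun i => g k (a i) * W i) =
          match in_dec Nat.eq_dec k (i :: l) with left _ => g k (a k) * W k | right _ => 0 end).
        rewrite IH //; last by move=> j hj; apply hin; right.
        case: (Nat.eq_dec i k) => E.
        - subst i. case: (in_dec Nat.eq_dec k l) => // _. case: in_dec => [_|h]; [ring | by exfalso; apply h; left].
        - have -> : g k (a i) = 0.
          { apply (Gprod_eq0 _ _ i); first by apply except_In; split; [apply hin; left |].
            have -> : a i / a i = 1 by field. rewrite theta_1 //. ring. }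
          case: (in_dec Nat.eq_dec k l) => h1; case: in_dec => h2; try ring.
          + by exfalso; apply h2; right.
          + by case: h2. }
      rewrite (Hl J2 (seq_NoDup _ _)) //. by case: in_dec. }
    have E1 : g k (a k) * W k = - Csum J1 (fun i => g k (a i) * W i).
    { rewrite -R2. rewrite JE Csum_app in R0.
      transitivity (Csum J1 (fun i => g k (a i) * W i) + Csum J2 (fun i => g k (a i) * W i) - Csum J1 (fun i => g k (a i) * W i));
        [ring | rewrite R0; ring]. }
    transitivity (/ g k (a k) * (g k (a k) * W k)); first by field.
    rewrite E1. rewrite (Csum_ext J1 (fun i => g k (a i) / g k (a k) * W i) (fun i => / g k (a k) * (g k (a i) * W i))).
    - rewrite Csum_scal. ring.
    - move=> i _. rewrite /Cdiv; ring. }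
  (* Both [den k] and [den i] split along [J1] and [J2], and the factors over [J2] other than the
     pair [i, k] cancel. For that pair, inversion of theta turns [tt i k] into [- (a_i / a_k)] times
     [tt k i]; this sign undoes the one in [hrel]. *)
  have hA : forall k i, In k J2 -> In i J1 ->
    a k * den k * (g k (a i) / g k (a k)) = - (A_coef N logq s k i * (a i * den i)).
  { move=> k i hk hi. have hkJ := J2J k hk. have hiJ := J1J i hi. have hik := J12 i k hi hk.
    have hnd : forall x n, NoDup (seq x n) := fun x n => seq_NoDup n x.
    have exapp : forall x l1 l2, except x (l1 ++ l2) = except x l1 ++ except x l2 by move=> x l1 l2; apply filter_app.
    have Dk : den k = tt i k * Gprod (except i J1) (fun j => tt j k) * g k (a k).
    { rewrite /den JE exapp Gprod_app (except_notin k J1); last by move=> /in1; have := proj1 (in2 k) hk; lia.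
      by rewrite (Gprod_except i J1 _ (hnd _ _) hi). }
    have Di : den i = Gprod (except i J1) (fun j => tt j i) * (tt k i * g k (a i)).
    { rewrite /den JE exapp Gprod_app (except_notin i J2); last by move=> /in2; have := proj1 (in1 i) hi; lia.
      by rewrite (Gprod_except k J2 _ (hnd _ _) hk). }
    have hAe : A_coef N logq s k i = Gprod (except i J1) (fun j => tt j k) / Gprod (except i J1) (fun j => tt j i).
    { rewrite -Gprod_div /A_coef hlogq -Gprod_nat -/J1. apply Gprod_ext => j _. by rewrite /tt !ha. }
    have hak := a0 k. have hai := a0 i.
    have hti : tt i k = - (a i / a k) * tt k i.
    { rewrite /tt. have -> : a i / a k = / (a k / a i) by field; split.
      rewrite theta_inv //; last by apply Cmult_neq_0; [done | by apply Cinv_neq0].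
      rewrite (Cmult_comm (a i) (a k)). field. by split. }
    have hgk : g k (a k) <> 0.
    { apply Gprod_neq0 => j hj. apply except_In in hj. apply httne; [apply J2J; tauto | done | tauto]. }
    have hGi : Gprod (except i J1) (fun j => tt j i) <> 0.
    { apply Gprod_neq0 => j hj. apply except_In in hj. apply httne; [apply J1J; tauto | done | tauto]. }
    rewrite Dk Di hAe hti. field. by repeat split. }
  have -> : (N - 1 = 1 + (N - 1 - 1))%nat by lia.
  rewrite sum_n_m_Csum. have -> : S (N - 1 - 1) = (N - 1)%nat by lia. rewrite -/J1.
  have -> : Csum J (fun k => Cexp (sg * - (s k * logq)) * Phi_num N m logq (/ a k) * W k) =
    Csum J (fun k => a k * R_coef N logq s k * qpoch q q ^ 2 * den k * W k).
  { apply Csum_ext => k hk. by rewrite hR. }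
  rewrite JE Csum_app.
  have -> : Csum J2 (fun k => a k * R_coef N logq s k * qpoch q q ^ 2 * den k * W k) =
    Csum J1 (fun i => Csum J2 (fun k => R_coef N logq s k * A_coef N logq s k i) * calJ_N N logq s (s i * logq)).
  { transitivity (Csum J2 (fun k => Csum J1 (fun i => R_coef N logq s k * A_coef N logq s k i * calJ_N N logq s (s i * logq)))).
    - apply Csum_ext => k hk. rewrite hrel //.
      transitivity (Csum J1 (fun i => - (a k * R_coef N logq s k * qpoch q q ^ 2 * den k) * (g k (a i) / g k (a k) * W i))).
      + rewrite Csum_scal. ring.
      + apply Csum_ext => i hi. rewrite hW //.
        have hk' := hA k i hk hi. have hdi := hden i (J1J i hi). have hai := a0 i.
        transitivity (- (a k * den k * (g k (a i) / g k (a k))) * R_coef N logq s k * qpoch q q ^ 2 *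
          (calJ_N N logq s (s i * logq) / (a i * qpoch q q ^ 2 * den i))); first ring.
        rewrite hk'. field. by repeat split.
    - rewrite Csum_swap. apply Csum_ext => i _.
      rewrite (Csum_ext J2 _ (fun k => calJ_N N logq s (s i * logq) * (R_coef N logq s k * A_coef N logq s k i))); last by move=> k _; ring.
      rewrite Csum_scal. ring. }
  rewrite -Csum_plus. apply Csum_ext => i hi.
  have -> : (2 * N = N + N)%nat by lia. rewrite sum_n_m_Csum.
  have -> : S N = (N + 1)%nat by lia. rewrite -/J2.
  rewrite hW //. have hdi := hden i (J1J i hi). have hai := a0 i. field. by repeat split.
Qed.
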